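(* Let $0<T<\infty$, $D_T=[0,1]\times[0,T]$, $\beta\in\mathbb{R}$ with $\beta\neq\pm1$, and let $\delta_1,\delta_2\ge 0$ satisfy $1+\delta_1\delta_2>\delta_1+\delta_2$. Let $\varphi,\psi:[0,1]\to\mathbb{R}$, $f:D_T\to\mathbb{R}$, $h:[0,T]\to\mathbb{R}$ satisfy: (i) $\varphi\in C^2[0,1]$, $\varphi'''\in L_2(0,1)$, $\varphi(0)=\beta\varphi(1)$, $\varphi'(0)=\varphi'(1)$, $\varphi''(0)=\beta\varphi''(1)$; (ii) $\psi\in C^1[0,1]$, $\psi''\in L_2(0,1)$, $\psi(0)=\beta\psi(1)$, $\psi'(0)=\psi'(1)$; (iii) $f,f_x\in C(D_T)$, $f_{xx}\in L_2(D_T)$, $f(0,t)=\beta f(1,t)$ and $f_x(0,t)=f_x(1,t)$ for $0\le t\le T$; (iv) $h\in C^2[0,T]$ and $h(t)\ne0$ for all $t\in[0,T]$; (v) $\int_0^1f(x,t)\,dx=0$ for $0\le t\le T$, $\int_0^1\varphi(x)\,dx=0$, $\int_0^1\psi(x)\,dx=0$; (vi) $h(0)+\delta_1h(T)=\varphi\left(\tfrac12\right)$, $h'(0)+\delta_2h'(T)=\psi\left(\tfrac12\right)$. Let $A(T)$, $B(T)$ be the explicit constants, and $E_T^3$ the normed space, defined in the context. Assume $$B(T)\,(A(T)+2)^2<1\quad\text{and}\quad \frac{(1+2\delta_1+3\delta_2+\delta_1\delta_2)\,T^2\,(A(T)+2)}{2(1+\delta_1)(1+\delta_2)}<1 .$$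 Then, with $R=A(T)+2$, the problem $$u_{tt}(x,t)-u_{xx}(x,t)=a(t)u(x,t)+f(x,t),\quad (x,t)\in D_T,$$ $$u(x,0)+\delta_1u(x,T)=\varphi(x),\quad u_t(x,0)+\delta_2u_t(x,T)=\psi(x),\quad 0\le x\le1,$$ $$u(0,t)=\beta u(1,t),\quad \int_0^1u(x,t)\,dx=0,\quad u\left(\tfrac12,t\right)=h(t),\quad 0\le t\le T,$$ for the unknown pair $\{u,a\}$ has a unique classical solution $z=\{u,a\}$ in the ball $K_R=\{z\in E_T^3:\ \|z\|_{E_T^3}\le R\}$.
   Context: A pair $\{u(x,t),a(t)\}$ is a classical solution of the problem if $u$, together with its derivatives $u_{xx}$ and $u_{tt}$, is continuous in $D_T$, $a$ is continuous on $[0,T]$, and the equation and all the conditions of the problem hold in the classical (usual) sense. Set $\lambda_k=2k\pi$ $(k=1,2,\ldots)$, $p=\frac{1-\beta}{1+\beta}$, $q=\frac{\beta}{1+\beta}$, and $$X_0(x)=px+q,\quad X_{2k-1}(x)=(px+q)\cos\lambda_kx,\quad X_{2k}(x)=\sin\lambda_kx,\quad k=1,2,\ldots;$$ this system is a Riesz basis of $L_2(0,1)$. The space $B_{2,T}^3$ consists of all functions $u(x,t)=\sum_{k=0}^\infty u_k(t)X_k(x)$ on $D_T$ with $u_k\in C[0,T]$ and finite norm $$\|u\|_{B_{2,T}^3}=\|u_0\|_{C[0,T]}+\Big\{\sum_{k=1}^\infty(\lambda_k^3\|u_{2k-1}\|_{C[0,T]})^2\Big\}^{1/2}+\Big\{\sum_{k=1}^\infty(\lambda_k^3\|u_{2k}\|_{C[0,T]})^2\Big\}^{1/2}.$$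 $E_T^3=B_{2,T}^3\times C[0,T]$, with norm $\|\{u,a\}\|_{E_T^3}=\|u\|_{B_{2,T}^3}+\|a\|_{C[0,T]}$. Constants. Put $\rho=\dfrac{1}{1-(\delta_1+\delta_2)+\delta_1\delta_2}$ and $M=1+2\rho(\delta_1+\delta_2+\delta_1\delta_2)$, $$\rho_1=\rho^2\Big[\delta_1\big(\tfrac{\delta_2}{2}+\tfrac T2\big)+\delta_2\big(\tfrac12+\tfrac T2+\delta_2(\tfrac14+\tfrac T2)\big)+\delta_1\delta_2\big(\tfrac12+\tfrac T2+\delta_2(\tfrac12+\tfrac T2)\big)\Big]+\tfrac T2+\delta_2\big(\tfrac12+\tfrac T2\big),$$ $$\rho_2=\rho^2\Big[\delta_1\big(\tfrac12+\tfrac T2\big)+\delta_1\big(\tfrac14+\tfrac T2\big)+\delta_2\big(\tfrac{\delta_1}{2}+\tfrac T2\big)+\delta_1\delta_2\big(\tfrac12+\tfrac T2+\delta_1(\tfrac12+\tfrac T2)\big)\Big]+\tfrac12+\tfrac T2+\delta_1\big(\tfrac12+\tfrac T2\big).$$ Then $$A_1(T)=\tfrac{2}{1+\delta_1}\|\varphi\|_{L_2(0,1)}+\tfrac{2T}{1+\delta_2}\|\psi\|_{L_2(0,1)}+\tfrac{2(1+3\delta_1+3\delta_2)}{(1+\delta_1)(1+\delta_2)}T\sqrt T\,\|f\|_{L_2(D_T)},$$ $$B_1(T)=\tfrac{1+3\delta_1+3\delta_2}{(1+\delta_1)(1+\delta_2)}T^2,$$ $$A_2(T)=4\sqrt2\rho(1+\delta_2)\|\varphi'''\|_{L_2(0,1)}+4\sqrt2\rho(1+\delta_1)\|\psi''\|_{L_2(0,1)}+4M\sqrt{2T}\,\|f_{xx}\|_{L_2(D_T)},\qquad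 B_2(T)=2MT,$$ $$A_3(T)=8\rho(1+\delta_2)\|\varphi'''(x)(1-q-px)-3p\varphi''(x)\|_{L_2(0,1)}+8\rho(1+\delta_1)\|\psi''(x)(1-q-px)-2p\psi'(x)\|_{L_2(0,1)}$$ $$+8M\sqrt T\,\|f_{xx}(x,t)(1-q-px)-2pf_x(x,t)\|_{L_2(D_T)}+8\rho_1\|\varphi'''\|_{L_2(0,1)}+8\rho_2\|\psi''\|_{L_2(0,1)}+8M^2T\sqrt T\,\|f_{xx}\|_{L_2(D_T)},$$ $$B_3(T)=2\sqrt2MT+2\sqrt2M^2T^2,$$ $$A_4(T)=\|h^{-1}\|_{C[0,T]}\Big\{\big\|h''(t)-f(\tfrac12,t)\big\|_{C[0,T]}+\tfrac12\Big(\sum_{k=1}^\infty\lambda_k^{-2}\Big)^{1/2}\big[2\sqrt2\rho(1+\delta_2)\|\varphi'''\|_{L_2(0,1)}+2\sqrt2\rho(1+\delta_1)\|\psi''\|_{L_2(0,1)}+2M\sqrt{2T}\,\|f_{xx}\|_{L_2(D_T)}\big]\Big\},$$ $$B_4(T)=\tfrac12\|h^{-1}\|_{C[0,T]}\Big(\sum_{k=1}^\infty\lambda_k^{-2}\Big)^{1/2}MT,$$ where $h^{-1}=1/h$, and finally $$A(T)=A_1(T)+A_2(T)+A_3(T)+A_4(T),\qquad B(T)=B_1(T)+B_2(T)+B_3(T)+B_4(T).$$ *)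

(* Defs.v *)
From HB Require Import structures.
From mathcomp Require Import all_boot all_order all_algebra.
From mathcomp Require Import all_classical all_reals all_analysis.

Set Implicit Arguments.
Unset Strict Implicit.
Unset Printing Implicit Defensive.
Import Order.TTheory GRing.Theory Num.Theory.
Import numFieldNormedType.Exports.

Local Open Scope classical_set_scope.
Local Open Scope ring_scope.

(* All functions are total on R (resp. R * R, in curried form); only their
   values on [0,1], [0,T] or D_T are ever constrained. *)

Definition I01 (R : realType) : set R := `]0, 1[.

Definition DT (R : realType) (T : R) : set (R * R) := `[0, 1] `*` `[0, T].

Definition cont_on (R : realType) (a b : R) (g : R -> R) : Prop :=
  {within `[a, b], continuous g}.

Definition cont_DT (R : realType) (T : R) (g : R -> R -> R) : Prop :=
  {within DT T, continuous (fun z : R * R => g z.1 z.2)}.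

(* [g'] is the classical derivative of [g] on [a,b], one-sided at a and b. *)
Definition deriv_on (R : realType) (a b : R) (g g' : R -> R) : Prop :=
  forall x, a <= x <= b ->
    (fun y => (g y - g x) / (y - x)) @ within `[a, b] (x^') --> g' x.

Definition deriv_x (R : realType) (T : R) (g gx : R -> R -> R) : Prop :=
  forall t, 0 <= t <= T -> deriv_on 0 1 (fun x => g x t) (fun x => gx x t).

Definition deriv_t (R : realType) (T : R) (g gt : R -> R -> R) : Prop :=
  forall x, 0 <= x <= 1 -> deriv_on 0 T (g x) (gt x).

Definition supnorm (R : realType) (T : R) (g : R -> R) : R :=
  sup [set `|g t| | t in `[0, T]].

(* [g \_ D] is g on D and [point], convertible to 0 in R, outside D. *)
Definition L2 (R : realType) (g : R -> R) : Prop :=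
  g \_ (@I01 R) \in Lfun lebesgue_measure 2%:E.

Definition L2norm (R : realType) (g : R -> R) : R :=
  fine ('N[lebesgue_measure]_2%:E [EFin \o (g \_ (@I01 R))])%E.

Definition L2_DT (R : realType) (T : R) (g : R -> R -> R) : Prop :=
  (fun z : R * R => g z.1 z.2) \_ (DT T)
    \in Lfun (lebesgue_measure \x lebesgue_measure)%E 2%:E.

Definition L2norm_DT (R : realType) (T : R) (g : R -> R -> R) : R :=
  fine ('N[(lebesgue_measure \x lebesgue_measure)]_2%:E
          [EFin \o ((fun z : R * R => g z.1 z.2) \_ (DT T))])%E.

(* [g] is absolutely continuous on [0,1] with a.e. derivative [g'] (meant for
   g' integrable on [0,1], which is always the case below). *)
Definition ac_deriv (R : realType) (g g' : R -> R) : Prop :=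
  forall x, 0 <= x <= 1 ->
    g x = g 0 + (\int[lebesgue_measure]_(y in `[0, x]) g' y)%R.

(* Meaning of "g' in L_2(0,1)" for a continuous g: g is absolutely continuous
   and [g'], any representative of its a.e. derivative, is square integrable. *)
Definition L2_deriv (R : realType) (g g' : R -> R) : Prop :=
  L2 g' /\ ac_deriv g g'.

(* Same in the variable x on D_T: [gx] is square integrable on D_T and is the
   x-derivative of [g] along almost every line t = const. *)
Definition L2_deriv_x (R : realType) (T : R) (g gx : R -> R -> R) : Prop :=
  L2_DT T gx /\
  {ae lebesgue_measure, forall t : R,
     0 <= t <= T -> ac_deriv (fun x => g x t) (fun x => gx x t)}.

Definition lam (R : realType) (k : nat) : R := 2 * k%:R * pi.

Definition pc (R : realType) (beta : R) : R := (1 - beta) / (1 + beta).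
Definition qc (R : realType) (beta : R) : R := beta / (1 + beta).

(* uphalf (2j-1) = uphalf (2j) = j. *)
Definition Xb (R : realType) (beta : R) (k : nat) (x : R) : R :=
  if k == 0%N then pc beta * x + qc beta
  else if odd k then (pc beta * x + qc beta) * cos (lam R (uphalf k) * x)
  else sin (lam R (uphalf k) * x).

(* [c] is the sequence of coordinates (u_k) of [u] in the basis (X_k). *)
Definition B_expansion (R : realType) (T beta : R) (u : R -> R -> R)
    (c : nat -> R -> R) : Prop :=
  (forall k, cont_on 0 T (c k)) /\
  (forall x t, 0 <= x <= 1 -> 0 <= t <= T ->
     series (fun k => c k t * Xb beta k x) @ \oo --> u x t).

Definition B_norm (R : realType) (T : R) (c : nat -> R -> R) : \bar R :=
  ((supnorm T (c 0%N))%:E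
   + sqrte (\sum_(1 <= k <oo)
       ((lam R k ^+ 3 * supnorm T (c (k.*2).-1)) ^+ 2)%:E)
   + sqrte (\sum_(1 <= k <oo)
       ((lam R k ^+ 3 * supnorm T (c k.*2)) ^+ 2)%:E))%E.

(* {u,a} belongs to E_T^3 and has norm at most r.  The coordinates of u are
   unique, so the existential only names them; the bound by r < +oo contains
   the finiteness of the norm. *)
Definition in_ball (R : realType) (T beta r : R)
    (u : R -> R -> R) (a : R -> R) : Prop :=
  cont_on 0 T a /\
  exists c, B_expansion T beta u c /\
            (B_norm T c + (supnorm T a)%:E <= r%:E)%E.

Definition classical_solution (R : realType) (T beta delta1 delta2 : R)
    (phi psi : R -> R) (f : R -> R -> R) (h : R -> R)
    (u : R -> R -> R) (a : R -> R) : Prop :=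
  cont_DT T u /\ cont_on 0 T a /\
  exists ux uxx ut utt : R -> R -> R,
    [/\ deriv_x T u ux, deriv_x T ux uxx, cont_DT T uxx &
        [/\ deriv_t T u ut, deriv_t T ut utt & cont_DT T utt]] /\
    (forall x t, 0 <= x <= 1 -> 0 <= t <= T ->
       utt x t - uxx x t = a t * u x t + f x t) /\
    (forall x, 0 <= x <= 1 ->
       u x 0 + delta1 * u x T = phi x /\
       ut x 0 + delta2 * ut x T = psi x) /\
    (forall t, 0 <= t <= T ->
       [/\ u 0 t = beta * u 1 t,
           (\int[lebesgue_measure]_(x in `[0, 1]) u x t)%R = 0 &
           u (1 / 2) t = h t]).

Definition rho (R : realType) (d1 d2 : R) : R :=
  1 / (1 - (d1 + d2) + d1 * d2).

Definition Mc (R : realType) (d1 d2 : R) : R :=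
  1 + 2 * rho d1 d2 * (d1 + d2 + d1 * d2).

Definition rho1 (R : realType) (T d1 d2 : R) : R :=
  rho d1 d2 ^+ 2 *
    (d1 * (d2 / 2 + T / 2)
     + d2 * (1 / 2 + T / 2 + d2 * (1 / 4 + T / 2))
     + d1 * d2 * (1 / 2 + T / 2 + d2 * (1 / 2 + T / 2)))
  + T / 2 + d2 * (1 / 2 + T / 2).

Definition rho2 (R : realType) (T d1 d2 : R) : R :=
  rho d1 d2 ^+ 2 *
    (d1 * (1 / 2 + T / 2)
     + d1 * (1 / 4 + T / 2)
     + d2 * (d1 / 2 + T / 2)
     + d1 * d2 * (1 / 2 + T / 2 + d1 * (1 / 2 + T / 2)))
  + 1 / 2 + T / 2 + d1 * (1 / 2 + T / 2).

(* (\sum_(k >= 1) lambda_k^-2)^(1/2) *)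
Definition sum_lam (R : realType) : R :=
  Num.sqrt (limn (series (fun k => (lam R k.+1 ^+ 2)^-1))).

Definition A1 (R : realType) (T d1 d2 : R) (phi psi : R -> R)
    (f : R -> R -> R) : R :=
  2 / (1 + d1) * L2norm phi + 2 * T / (1 + d2) * L2norm psi
  + 2 * (1 + 3 * d1 + 3 * d2) / ((1 + d1) * (1 + d2)) * T * Num.sqrt T
    * L2norm_DT T f.

Definition B1 (R : realType) (T d1 d2 : R) : R :=
  (1 + 3 * d1 + 3 * d2) / ((1 + d1) * (1 + d2)) * T ^+ 2.

Definition A2 (R : realType) (T d1 d2 : R) (phi3 psi2 : R -> R)
    (fxx : R -> R -> R) : R :=
  4 * Num.sqrt 2 * rho d1 d2 * (1 + d2) * L2norm phi3
  + 4 * Num.sqrt 2 * rho d1 d2 * (1 + d1) * L2norm psi2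
  + 4 * Mc d1 d2 * Num.sqrt (2 * T) * L2norm_DT T fxx.

Definition B2 (R : realType) (T d1 d2 : R) : R := 2 * Mc d1 d2 * T.

Definition A3 (R : realType) (T beta d1 d2 : R) (phi2 phi3 psi1 psi2 : R -> R)
    (fx fxx : R -> R -> R) : R :=
  let p := pc beta in let q := qc beta in
  8 * rho d1 d2 * (1 + d2)
    * L2norm (fun x => phi3 x * (1 - q - p * x) - 3 * p * phi2 x)
  + 8 * rho d1 d2 * (1 + d1)
    * L2norm (fun x => psi2 x * (1 - q - p * x) - 2 * p * psi1 x)
  + 8 * Mc d1 d2 * Num.sqrt T
    * L2norm_DT T (fun x t => fxx x t * (1 - q - p * x) - 2 * p * fx x t)
  + 8 * rho1 T d1 d2 * L2norm phi3
  + 8 * rho2 T d1 d2 * L2norm psi2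
  + 8 * Mc d1 d2 ^+ 2 * T * Num.sqrt T * L2norm_DT T fxx.

Definition B3 (R : realType) (T d1 d2 : R) : R :=
  2 * Num.sqrt 2 * Mc d1 d2 * T
  + 2 * Num.sqrt 2 * Mc d1 d2 ^+ 2 * T ^+ 2.

Definition A4 (R : realType) (T d1 d2 : R) (phi3 psi2 : R -> R)
    (f fxx : R -> R -> R) (h h2 : R -> R) : R :=
  supnorm T (fun t => (h t)^-1) *
  (supnorm T (fun t => h2 t - f (1 / 2) t)
   + 1 / 2 * sum_lam R
     * (2 * Num.sqrt 2 * rho d1 d2 * (1 + d2) * L2norm phi3
        + 2 * Num.sqrt 2 * rho d1 d2 * (1 + d1) * L2norm psi2
        + 2 * Mc d1 d2 * Num.sqrt (2 * T) * L2norm_DT T fxx)).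

Definition B4 (R : realType) (T d1 d2 : R) (h : R -> R) : R :=
  1 / 2 * supnorm T (fun t => (h t)^-1) * sum_lam R * Mc d1 d2 * T.

Definition AT (R : realType) (T beta d1 d2 : R)
    (phi phi2 phi3 psi psi1 psi2 : R -> R) (f fx fxx : R -> R -> R)
    (h h2 : R -> R) : R :=
  A1 T d1 d2 phi psi f + A2 T d1 d2 phi3 psi2 fxx
  + A3 T beta d1 d2 phi2 phi3 psi1 psi2 fx fxx
  + A4 T d1 d2 phi3 psi2 f fxx h h2.

Definition BT (R : realType) (T d1 d2 : R) (h : R -> R) : R :=
  B1 T d1 d2 + B2 T d1 d2 + B3 T d1 d2 + B4 T d1 d2 h.

(* Main.v *)
Require Import Defs.
From HB Require Import structures.
From mathcomp Require Import all_boot all_order all_algebra.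
From mathcomp Require Import all_classical all_reals all_analysis.
From mathcomp Require Import measurable_realfun ring lra.

Set Implicit Arguments.
Unset Strict Implicit.
Unset Printing Implicit Defensive.
Import Order.TTheory GRing.Theory Num.Theory.
Import numFieldNormedType.Exports.

Local Open Scope classical_set_scope.
Local Open Scope ring_scope.

(* Expand u as the sum of y_k X_(2k-1) + z_k X_(2k) and project on the dual system
   2, 4 cos(lam_k x), 4 (1-q-px) sin(lam_k x).  The condition int u = 0 kills the
   mode X_0, the equation becomes

     y_k'' + lam_k^2 y_k = a y_k + f_(2k-1),
     z_k'' + lam_k^2 z_k = a z_k + f_(2k) - 2 p lam_k y_k

   with two nonlocal conditions in t for each mode, and u(1/2,t) = h(t) becomes
   a h = h'' - f(1/2,.) + 1/2 sum (-1)^k lam_k^2 y_k.  Thus a and the y_k form a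
   closed system, solved by a contraction in a on the ball |a| <= R; the z_k
   follow.  The smallness of T enters through M T R <= 1/4: since lam_k >= 4, the
   potential a enlarges the bound of each mode by a factor at most 16/15.  For
   uniqueness, the coefficients of any solution in the ball solve the same system.

   The constants A, B do not see the factor p of the coupling term
   2 p lam_k y_k.  When |p| > 1 it is controlled indirectly: |p| |phi(1/2)| is at
   most half the norm of phi''' (1-q-px) - 3 p phi'', whereas h, having constant
   sign, satisfies |phi(1/2)| = |h(0) + delta1 h(T)| >= (1 + delta1) / ||1/h||.
   So a large |p| makes ||1/h|| large and then B_4 R^2 < 1 makes T small; in the
   end 2 |p| M T <= 1/4. *)

(** * Calculus on a closed interval *)

(** Besides u(0,t) = beta u(1,t), the only condition in x is integral, and it hides a boundary
    condition: integrating the equation of any solution over [0,1], with int f = 0, gives u_x(0,t) =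
    u_x(1,t). This removes the boundary term from the cosine coefficients of u_xx; for the sine
    coefficients the weight 1-q-px turns the condition with beta into periodicity. For one mode, the
    determinant of the two nonlocal conditions is 1 + (delta1+delta2) cos(lam_k T) + delta1 delta2
    >= 1/rho, so there is no resonance, whatever k. The formula for a only encodes the second
    derivative of u(1/2,t) = h(t). The condition itself is recovered because v = u(1/2,.) - h solves
    v'' = a v with homogeneous nonlocal conditions, which forces v = 0 when T is small. The radius A
    + 2 is met by a budget: Bessel's inequality spends half of A_2 and half of A_3, the other halves
    pay for the factors 16/15 and for the coupling, and the bound of a exceeds A_4 by at most
    2/15. *)

Section Calculus.
Variable R : realType.
Implicit Types (a b x y e t : R) (g h : R -> R).

Lemma cont_onP a b g : cont_on a b g <->
  forall x, a <= x <= b -> forall e, 0 < e -> exists2 d : R, 0 < d &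
    forall y, a <= y <= b -> `|y - x| < d -> `|g y - g x| <= e.
Proof.
rewrite /cont_on subspace_continuousP; split => [H x xab e e0|H x /= xab].
  have /cvgrPdist_le/(_ e e0) := H x xab.
  case => d /= d0 Hd; exists d => // y yab yx.
  by rewrite distrC; apply: Hd => //=; rewrite distrC.
apply/cvgrPdist_le => e e0.
have [d d0 Hd] := H x xab e e0.
exists d => //= y /= yx yab; rewrite distrC; apply: Hd => //.
by rewrite distrC.
Qed.

Lemma deriv_onP a b g g' : deriv_on a b g g' <->
  forall x, a <= x <= b -> forall e, 0 < e -> exists2 d : R, 0 < d &
    forall y, a <= y <= b -> `|y - x| < d ->
      `|g y - g x - g' x * (y - x)| <= e * `|y - x|.
Proof.
split => H x xab.
  move=> e e0; have /cvgrPdist_le/(_ e e0) := H x xab.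
  rewrite /within /dnbhs /= => -[d /= d0 Hd]; exists d => // y yab yx.
  have [->|yx0] := eqVneq y x; first by rewrite !subrr mulr0 subrr normr0 mulr0.
  have /(_ y) := Hd; rewrite /ball_/= distrC => /(_ yx yx0).
  move=> Hq; have {}Hq := Hq yab.
  have n0 : 0 < `|y - x| by rewrite normr_gt0 subr_eq0.
  have -> : g y - g x - g' x * (y - x) =
            - ((g' x - (g y - g x) / (y - x)) * (y - x)).
    by field; rewrite subr_eq0.
  by rewrite normrN normrM ler_pM2r.
apply/cvgrPdist_le => e e0.
have [d d0 Hd] := H x xab e e0.
rewrite /within /dnbhs /=; exists d => //= y /=; rewrite distrC => yx yx0 yab.
have n0 : 0 < `|y - x| by rewrite normr_gt0 subr_eq0.
rewrite -(ler_pM2r n0) -normrM.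
have -> : (g' x - (g y - g x) / (y - x)) * (y - x) =
   - (g y - g x - g' x * (y - x)) by field; rewrite subr_eq0.
by rewrite normrN; exact: Hd.
Qed.

Lemma cont_on_cst a b (c : R) : cont_on a b (fun=> c).
Proof. by apply/cont_onP => x _ e e0; exists 1 => // y _ _; rewrite subrr normr0 ltW. Qed.

Lemma eq_cont_on a b g h : (forall x, a <= x <= b -> g x = h x) ->
  cont_on a b g -> cont_on a b h.
Proof.
move=> gh /cont_onP cg; apply/cont_onP => x xab e e0.
have [d d0 Hd] := cg x xab e e0; exists d => // y yab yx.
by rewrite -!gh//; exact: Hd.
Qed.

Lemma cont_onD a b g h : cont_on a b g -> cont_on a b h ->
  cont_on a b (fun x => g x + h x).
Proof.
move=> /subspace_continuousP cg /subspace_continuousP ch.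
by apply/subspace_continuousP => x xab; apply: cvgD; [exact: cg|exact: ch].
Qed.

Lemma cont_onN a b g : cont_on a b g -> cont_on a b (fun x => - g x).
Proof.
move=> /subspace_continuousP cg.
by apply/subspace_continuousP => x xab; apply: cvgN; exact: cg.
Qed.

Lemma cont_onB a b g h : cont_on a b g -> cont_on a b h ->
  cont_on a b (fun x => g x - h x).
Proof. by move=> cg ch; apply: cont_onD => //; exact: cont_onN. Qed.

Lemma cont_onM a b g h : cont_on a b g -> cont_on a b h ->
  cont_on a b (fun x => g x * h x).
Proof.
move=> /subspace_continuousP cg /subspace_continuousP ch.
by apply/subspace_continuousP => x xab; apply: cvgM; [exact: cg|exact: ch].
Qed.

Lemma cont_onZ a b (c : R) g : cont_on a b g -> cont_on a b (fun x => c * g x).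
Proof. by apply: cont_onM; exact: cont_on_cst. Qed.

Lemma cont_on_norm a b g : cont_on a b g -> cont_on a b (fun x => `|g x|).
Proof.
move=> /subspace_continuousP cg.
by apply/subspace_continuousP => x xab; apply: cvg_norm; exact: cg.
Qed.

Lemma cont_onV a b g : (forall x, a <= x <= b -> g x <> 0) ->
  cont_on a b g -> cont_on a b (fun x => (g x)^-1).
Proof.
move=> g0 /subspace_continuousP cg.
apply/subspace_continuousP => x xab; apply: cvgV; last exact: cg.
by apply/eqP; exact: g0.
Qed.

Lemma cont_on_sum a b (n m : nat) (G : nat -> R -> R) :
  (forall k, (n <= k < m)%N -> cont_on a b (G k)) ->
  cont_on a b (fun x => \sum_(n <= k < m) G k x).
Proof.
elim: m => [|m IH] H.
  apply: (eq_cont_on _ (@cont_on_cst a b 0)) => x _; rewrite big_geq//.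
have [nm|mn] := leqP n m; last first.
  by apply: (eq_cont_on _ (@cont_on_cst a b 0)) => x _; rewrite big_geq// ltnW.
apply: (@eq_cont_on _ _ (fun x => \sum_(n <= k < m) G k x + G m x)).
  by move=> x _; rewrite big_nat_recr.
apply: cont_onD; last by apply: H; rewrite nm ltnSn.
by apply: IH => k /andP[nk km]; apply: H; rewrite nk (ltn_trans km).
Qed.

Lemma sub_cont_on a b c d g : a <= c -> d <= b -> cont_on a b g -> cont_on c d g.
Proof.
move=> ac db /cont_onP cg; apply/cont_onP => x /andP[cx xd] e e0.
have [|r r0 Hr] := cg x _ e e0; first by apply/andP; split; lra.
exists r => // y /andP[cy yd]; apply: Hr; apply/andP; split; lra.
Qed.

Lemma sub_deriv_on a b c d g g' : a <= c -> d <= b ->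
  deriv_on a b g g' -> deriv_on c d g g'.
Proof.
move=> ac db /deriv_onP cg; apply/deriv_onP => x /andP[cx xd] e e0.
have [|r r0 Hr] := cg x _ e e0; first by apply/andP; split; lra.
exists r => // y /andP[cy yd]; apply: Hr; apply/andP; split; lra.
Qed.

Lemma deriv_on_cont a b g g' : deriv_on a b g g' -> cont_on a b g.
Proof.
move=> /deriv_onP dg; apply/cont_onP => x xab e e0.
have [d d0 Hd] := dg x xab 1 ltr01.
have K0 : 0 < `|g' x| + 1 by rewrite ltr_wpDl.
exists (Num.min d (e / (`|g' x| + 1))).
  by rewrite lt_min d0 divr_gt0.
move=> y yab; rewrite lt_min => /andP[yd ye].
have -> : g y - g x = (g y - g x - g' x * (y - x)) + g' x * (y - x) by ring.
rewrite (le_trans (ler_normD _ _))// normrM.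
move: ye; rewrite ltr_pdivlMr// => ye.
have := Hd y yab yd; move: ye; set u := `|y - x|; set v := `| _ - _ * _|.
move: (`|g' x|) => w; nra.
Qed.

Lemma eq_deriv_on a b g g' h h' :
  (forall x, a <= x <= b -> g x = h x) -> (forall x, a <= x <= b -> g' x = h' x) ->
  deriv_on a b g g' -> deriv_on a b h h'.
Proof.
move=> gh gh' /deriv_onP dg; apply/deriv_onP => x xab e e0.
have [d d0 Hd] := dg x xab e e0; exists d => // y yab yx.
by rewrite -!gh// -gh'//; exact: Hd.
Qed.

Lemma deriv_on_cst a b (c : R) : deriv_on a b (fun=> c) (fun=> 0).
Proof.
apply/deriv_onP => x _ e e0; exists 1 => // y _ _.
by rewrite subrr mul0r subrr normr0 mulr_ge0// ltW.
Qed.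

Lemma is_derive_deriv_on a b g g' :
  (forall x, is_derive x 1 g (g' x)) -> deriv_on a b g g'.
Proof.
move=> H; apply/deriv_onP => x _ e e0.
have [dgx gE] := H x.
have : (fun s => s^-1 *: ((g \o shift x) (s *: 1) - g x)) @ 0^' --> g' x.
  by rewrite -gE; exact: dgx.
move=> /cvgrPdist_le/(_ e e0); rewrite /dnbhs /within /= => -[d /= d0 Hd].
exists d => // y _ yx.
have [->|yx0] := eqVneq y x; first by rewrite !subrr mulr0 subrr normr0 mulr0.
have n0 : 0 < `|y - x| by rewrite normr_gt0 subr_eq0.
have := Hd (y - x); rewrite /ball_/= sub0r normrN subr_eq0 => /(_ yx yx0).
rewrite scaler1 subrK => {}Hd.
have -> : g y - g x - g' x * (y - x) =
            - ((g' x - (y - x)^-1 *: (g y - g x)) * (y - x)).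
  by rewrite /GRing.scale/=; field; rewrite subr_eq0.
by rewrite normrN normrM ler_pM2r.
Qed.

Lemma deriv_on_is_derive a b g g' x : deriv_on a b g g' -> a < x < b ->
  is_derive x 1 g (g' x).
Proof.
move=> /deriv_onP H /andP[ax xb].
have : (fun s => s^-1 *: ((g \o shift x) (s *: 1) - g x)) @ 0^' --> g' x.
  apply/cvgrPdist_le => e e0; have [|d d0 Hd] := H x _ e e0.
    by rewrite !ltW.
  rewrite /dnbhs /within /=; exists (Num.min d (Num.min (x - a) (b - x))).
    by rewrite /= !lt_min d0 !subr_gt0 ax.
  move=> s /=; rewrite sub0r normrN !lt_min => /andP[sd /andP[sa sb]] s0.
  have n0 : 0 < `|s| by rewrite normr_gt0.
  rewrite scaler1 -(ler_pM2r n0) -normrM /GRing.scale/=.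
  have -> : (g' x - s^-1 * (g (s + x) - g x)) * s =
    - (g (s + x) - g x - g' x * (s + x - x)) by field.
  rewrite normrN; have := Hd (s + x); rewrite addrK; apply => //.
  by move: sa sb; rewrite !ltr_norml => /andP[? ?] /andP[? ?]; apply/andP; split; lra.
move=> cv; split; first by apply/cvg_ex; exists (g' x).
exact: cvg_lim cv.
Qed.

Lemma mvt_on a b g g' x y : deriv_on a b g g' ->
  a <= x -> x < y -> y <= b ->
  exists2 c : R, x < c < y & g y - g x = g' c * (y - x).
Proof.
move=> dg ax xy yb.
have [c||c cxy E] := @MVT R g g' x y xy.
- rewrite in_itv/= => /andP[xc cy]; apply: (deriv_on_is_derive dg).
  by apply/andP; split; lra.
- exact: sub_cont_on ax yb (deriv_on_cont dg).
- by exists c => //; move: cxy; rewrite in_itv.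
Qed.

Lemma deriv_on_increasing a b g g' : deriv_on a b g g' ->
  (forall x, a <= x <= b -> 0 <= g' x) ->
  forall x y, a <= x -> x <= y -> y <= b -> g x <= g y.
Proof.
move=> dg g0 x y ax; rewrite le_eqVlt => /predU1P[->//|xy yb].
have [c /andP[xc cy] E] := mvt_on dg ax xy yb.
rewrite -subr_ge0 E mulr_ge0//; last by rewrite subr_ge0 ltW.
by apply: g0; apply/andP; split; lra.
Qed.

Lemma deriv_onD a b g g' h h' : deriv_on a b g g' -> deriv_on a b h h' ->
  deriv_on a b (fun x => g x + h x) (fun x => g' x + h' x).
Proof.
move=> dg dh x xab; under eq_fun do rewrite opprD addrACA mulrDl.
by apply: cvgD; [exact: dg|exact: dh].
Qed.

Lemma deriv_onZ a b c g g' : deriv_on a b g g' ->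
  deriv_on a b (fun x => c * g x) (fun x => c * g' x).
Proof.
move=> dg x xab; under eq_fun do rewrite -mulrBr -mulrA.
by apply: cvgM; [exact: cvg_cst|exact: dg].
Qed.
Arguments deriv_onZ {a b} c {g g'}.

Lemma deriv_onN a b g g' : deriv_on a b g g' ->
  deriv_on a b (fun x => - g x) (fun x => - g' x).
Proof.
by move=> dg; apply: (eq_deriv_on _ _ (deriv_onZ (-1) dg)) => x _; rewrite mulN1r.
Qed.

Lemma deriv_onB a b g g' h h' : deriv_on a b g g' -> deriv_on a b h h' ->
  deriv_on a b (fun x => g x - h x) (fun x => g' x - h' x).
Proof. by move=> dg /deriv_onN; exact: deriv_onD. Qed.

Lemma deriv_onM a b g g' h h' : deriv_on a b g g' -> deriv_on a b h h' ->
  deriv_on a b (fun x => g x * h x) (fun x => g' x * h x + g x * h' x).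
Proof.
move=> dg dh x xab.
rewrite (_ : (fun y => _) = (fun y => (g y - g x) / (y - x) * h y +
   g x * ((h y - h x) / (y - x)))); last first.
  by apply/funext => y; ring.
apply: cvgD; last by apply: cvgM; [exact: cvg_cst|exact: dh].
apply: cvgM; first exact: dg.
have /subspace_continuousP/(_ x xab) ch := deriv_on_cont dh.
apply: cvg_trans ch; apply: cvg_app => A; rewrite /within/= /dnbhs /within/=.
by move=> [e /= e0 He]; exists e => //= y ye _; exact: He.
Qed.

Lemma deriv_on_sum a b (n m : nat) (G G' : nat -> R -> R) :
  (forall k, (n <= k < m)%N -> deriv_on a b (G k) (G' k)) ->
  deriv_on a b (fun x => \sum_(n <= k < m) G k x) (fun x => \sum_(n <= k < m) G' k x).
Proof.
elim: m => [|m IH] H.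
  by apply: (eq_deriv_on _ _ (@deriv_on_cst a b 0)) => x _; rewrite big_geq.
have [nm|mn] := leqP n m; last first.
  by apply: (eq_deriv_on _ _ (@deriv_on_cst a b 0)) => x _; rewrite big_geq// ltnW.
apply: (@eq_deriv_on _ _ (fun x => \sum_(n <= k < m) G k x + G m x)
  (fun x => \sum_(n <= k < m) G' k x + G' m x)).
- by move=> x _; rewrite big_nat_recr.
- by move=> x _; rewrite big_nat_recr.
apply: deriv_onD; last by apply: H; rewrite nm ltnSn.
by apply: IH => k /andP[nk km]; apply: H; rewrite nk (ltn_trans km).
Qed.

(** Both J + P and J - P are nondecreasing. This plays the part of |int F| <= int G with an
    arbitrary primitive [J] of the majorant. *)
Lemma deriv_on_dominated a b P F J G : deriv_on a b P F -> deriv_on a b J G ->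
  (forall x, a <= x <= b -> `|F x| <= G x) ->
  forall x y, a <= x -> x <= y -> y <= b -> `|P y - P x| <= J y - J x.
Proof.
move=> dP dJ FG x y ax xy yb; rewrite ler_norml; apply/andP; split.
  have := deriv_on_increasing (deriv_onD dJ dP) _ ax xy yb.
  suff H : forall z, a <= z <= b -> 0 <= G z + F z by move=> /(_ H); lra.
  by move=> z /FG; rewrite ler_norml => /andP[]; lra.
have := deriv_on_increasing (deriv_onB dJ dP) _ ax xy yb.
suff H : forall z, a <= z <= b -> 0 <= G z - F z by move=> /(_ H); lra.
by move=> z /FG; rewrite ler_norml => /andP[]; lra.
Qed.

Lemma deriv_on_id a b : deriv_on a b (fun x => x) (fun=> 1).
Proof. by apply: is_derive_deriv_on => x; exact: is_derive_id. Qed.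

Lemma deriv_on_lipschitz a b g g' K : deriv_on a b g g' ->
  (forall x, a <= x <= b -> `|g' x| <= K) ->
  forall x y, a <= x <= b -> a <= y <= b -> `|g y - g x| <= K * `|y - x|.
Proof.
move=> dg gK.
have main : forall x y, a <= x -> x <= y -> y <= b -> `|g y - g x| <= K * `|y - x|.
  move=> x y ax xy yb; rewrite (ger0_norm (_ : 0 <= y - x)) ?subr_ge0//.
  rewrite mulrBr; apply: (deriv_on_dominated dg (deriv_onZ K (@deriv_on_id a b))) => //.
  by move=> z zab; rewrite mulr1; exact: gK.
move=> x y /andP[ax xb] /andP[ay yb]; case: (leP x y) => [xy|/ltW yx].
  exact: main.
by rewrite distrC (distrC y); exact: main.
Qed.

Lemma cont_on_max a b g : a <= b -> cont_on a b g ->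
  exists2 c : R, a <= c <= b & forall x, a <= x <= b -> g x <= g c.
Proof.
move=> ab cg; have [c cab H] := EVT_max ab cg.
by exists c; [move: cab; rewrite in_itv|move=> x xab; apply: H; rewrite in_itv].
Qed.

Lemma cont_on_bounded a b g : cont_on a b g ->
  exists2 K : R, 0 <= K & forall x, a <= x <= b -> `|g x| <= K.
Proof.
move=> cg; case: (leP a b) => ab; last first.
  by exists 0 => // x /andP[ax xb]; exfalso; move: ab; lra.
have [c cab H] := cont_on_max ab (cont_on_norm cg).
by exists `|g c|.
Qed.

Lemma supnorm_ge T g t : cont_on 0 T g -> 0 <= t <= T -> `|g t| <= supnorm T g.
Proof.
move=> cg tT.
have ub : has_ubound [set `|g s| | s in `[0, T]].
  have [K K0 HK] := cont_on_bounded cg; exists K => _ [s /= + <-].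
  by rewrite in_itv/= => sT; exact: HK.
by apply: (ub_le_sup ub); exists t => //=; rewrite in_itv.
Qed.

Lemma supnorm_le T g K : 0 <= T -> (forall t, 0 <= t <= T -> `|g t| <= K) ->
  supnorm T g <= K.
Proof.
move=> T0 gK; apply: ge_sup.
  by exists `|g 0|; exists 0 => //=; rewrite in_itv/= lexx.
by move=> _ [t /= + <-]; rewrite in_itv/= => tT; exact: gK.
Qed.

(** Holds for every [g], since [sup] defaults to 0 on a set without supremum. *)
Lemma supnorm_ge0 T g : 0 <= supnorm T g.
Proof.
have [H|H] := pselect (has_sup [set `|g t| | t in `[0, T]]); last first.
  by rewrite /supnorm sup_out.
case: H => [[z zE] ub]; apply: le_trans (ub_le_sup ub zE).
by case: zE => t _ <-.
Qed.

End Calculus.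
Arguments deriv_onZ {R a b} c {g g'}.

(** * Lebesgue integrals on a closed interval *)

Definition itg (R : realType) (a b : R) (g : R -> R) : R :=
  (\int[@lebesgue_measure R]_(x in `[a, b]) g x)%R.

Definition intb (R : realType) (a b : R) (g : R -> R) : Prop :=
  (@lebesgue_measure R).-integrable `[a, b] (EFin \o g).

Section Integral.
Variable R : realType.
Implicit Types (a b x y e t : R) (g h : R -> R).

Lemma cont_on_intb a b g : cont_on a b g -> intb a b g.
Proof. by move=> cg; apply: continuous_compact_integrable => //; exact: segment_compact. Qed.

Lemma intb_measurable a b g : intb a b g -> measurable_fun `[a, b] g.
Proof. by move=> /integrableP[/measurable_EFinP]. Qed.

Lemma eq_intb a b g h : (forall x, a <= x <= b -> g x = h x) -> intb a b g -> intb a b h.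
Proof.
move=> gh; apply: eq_integrable => //= x; rewrite inE/= in_itv/= => xab.
by rewrite gh.
Qed.

Lemma intbD a b g h : intb a b g -> intb a b h -> intb a b (fun x => g x + h x).
Proof.
move=> ig ih; rewrite /intb (_ : EFin \o _ = (EFin \o g) \+ (EFin \o h))//.
exact: integrableD.
Qed.

Lemma intbZ a b c g : intb a b g -> intb a b (fun x => c * g x).
Proof.
move=> ig; rewrite /intb (_ : EFin \o _ = (fun x => c%:E * (EFin \o g) x))%E//.
exact: integrableZl.
Qed.

Arguments intbZ {a b} c {g}.

Lemma intbN a b g : intb a b g -> intb a b (fun x => - g x).
Proof. by move=> /(intbZ (-1)); apply: eq_intb => x _; rewrite mulN1r. Qed.

Lemma intbB a b g h : intb a b g -> intb a b h -> intb a b (fun x => g x - h x).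
Proof. by move=> ig /intbN; exact: intbD. Qed.

Lemma intb_norm a b g : intb a b g -> intb a b (fun x => `|g x|).
Proof. by move=> ig; have := integrable_norm ig. Qed.

Lemma intbM_bounded a b g h K : intb a b g -> measurable_fun `[a, b] h ->
  (forall x, a <= x <= b -> `|h x| <= K) -> intb a b (fun x => h x * g x).
Proof.
move=> ig mh hK.
have igK : intb a b (fun x => K * `|g x|) by apply: intbZ; exact: intb_norm.
apply: le_integrable igK => //.
  apply/measurable_EFinP; apply: measurable_funM => //; exact: intb_measurable ig.
move=> x /=; rewrite in_itv/= => xab; rewrite lee_fin normrM.
have K0 : 0 <= K by apply: le_trans (hK x xab).
by rewrite normrM (ger0_norm K0) normr_id ler_wpM2r// hK.
Qed.

Lemma intbM_cont a b g h : intb a b g -> cont_on a b h -> intb a b (fun x => h x * g x).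
Proof.
move=> ig ch; have [K _ hK] := cont_on_bounded ch.
by apply: intbM_bounded hK => //; exact: intb_measurable (cont_on_intb ch).
Qed.

Lemma sub_intb a b c d g : a <= c -> d <= b -> intb a b g -> intb c d g.
Proof.
move=> ac db; apply: integrableS => //.
by move=> x /=; rewrite !in_itv/= => /andP[? ?]; apply/andP; split; lra.
Qed.

Lemma eq_itg a b g h : (forall x, a <= x <= b -> g x = h x) -> itg a b g = itg a b h.
Proof.
by move=> gh; apply: eq_Rintegral => x; rewrite inE/= in_itv/=; exact: gh.
Qed.

Lemma itgD a b g h : intb a b g -> intb a b h ->
  itg a b (fun x => g x + h x) = itg a b g + itg a b h.
Proof. by move=> ig ih; exact: RintegralD. Qed.

Lemma itgB a b g h : intb a b g -> intb a b h ->
  itg a b (fun x => g x - h x) = itg a b g - itg a b h.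
Proof. by move=> ig ih; exact: RintegralB. Qed.

Lemma itgZ a b c g : intb a b g -> itg a b (fun x => c * g x) = c * itg a b g.
Proof. by move=> ig; exact: RintegralZl. Qed.

Lemma itgN a b g : intb a b g -> itg a b (fun x => - g x) = - itg a b g.
Proof. by move=> ig; rewrite -mulN1r -itgZ//; apply: eq_itg => x _; rewrite mulN1r. Qed.

Lemma itg_cst a b c : a <= b -> itg a b (fun=> c) = c * (b - a).
Proof.
move=> ab; rewrite /itg Rintegral_cst//= lebesgue_measure_itv/= lte_fin.
by case: ltP => ba //=; rewrite (_ : b = a) ?subrr//; apply/eqP; rewrite eq_le ba ab.
Qed.

Lemma le_itg a b g h : intb a b g -> intb a b h ->
  (forall x, a <= x <= b -> g x <= h x) -> itg a b g <= itg a b h.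
Proof.
by move=> ig ih gh; apply: le_Rintegral => // x /=; rewrite in_itv; exact: gh.
Qed.

Lemma itg_ge0 a b g : (forall x, a <= x <= b -> 0 <= g x) -> 0 <= itg a b g.
Proof. by move=> g0; apply: Rintegral_ge0 => x /=; rewrite in_itv; exact: g0. Qed.

Lemma le_norm_itg a b g : intb a b g -> `|itg a b g| <= itg a b (fun x => `|g x|).
Proof. by move=> ig; exact: le_normr_Rintegral. Qed.

Lemma itg_bound a b g K : a <= b -> intb a b g ->
  (forall x, a <= x <= b -> `|g x| <= K) -> `|itg a b g| <= K * (b - a).
Proof.
move=> ab ig gK; rewrite -itg_cst//; apply: le_trans (le_norm_itg ig) _.
by apply: le_itg => //; [exact: intb_norm|apply: cont_on_intb; exact: cont_on_cst].
Qed.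

Lemma itg_split a x b g : a <= x -> x <= b -> intb a b g ->
  itg a b g = itg a x g + itg x b g.
Proof.
move=> ax xb ig.
have := @Rintegral_itvB R g (BLeft a) (BRight b) x ig.
rewrite !bnd_simp => /(_ ax xb).
rewrite Rintegral_itv_obnd_cbnd; last first.
  apply: integrableS ig => //= z /=; rewrite !in_itv/= => /andP[? ?].
  by apply/andP; split; lra.
by rewrite -/(itg a b g) -/(itg a x g) -/(itg x b g); lra.
Qed.

Lemma itg_point a g : itg a a g = 0.
Proof. by rewrite /itg set_itv1 Rintegral_set1. Qed.

Lemma deriv_on_itg a b g : cont_on a b g -> deriv_on a b (fun t => itg a t g) g.
Proof.
move=> cg; apply/deriv_onP => x /andP[ax xb] e e0.
have [|d d0 Hd] := (cont_onP _ _ _).1 cg x _ e e0; first by rewrite ax xb.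
exists d => // y /andP[ay yb] yx.
have ig := cont_on_intb cg.
have key u v : a <= u -> u <= v -> v <= b ->
  (forall z, u <= z <= v -> `|g z - g x| <= e) ->
  `|itg a v g - itg a u g - g x * (v - u)| <= e * (v - u).
  move=> au uv vb H.
  have iuv : intb u v g by apply: sub_intb ig.
  have icst : intb u v (fun=> g x) by apply: cont_on_intb; exact: cont_on_cst.
  rewrite (@itg_split a u v)//; last by apply: sub_intb ig.
  rewrite (_ : forall r s : R, r + s - r = s); last by move=> *; ring.
  rewrite -itg_cst// -itgB//.
  by apply: itg_bound => //; apply: intbB.
case: (leP x y) => xy.
  rewrite (ger0_norm (_ : 0 <= y - x)) ?subr_ge0//.
  apply: key => // z /andP[xz zy]; apply: Hd; first by apply/andP; split; lra.
  by move: yx; rewrite !ger0_norm ?subr_ge0//; lra.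
rewrite distrC (distrC y) (ger0_norm (_ : 0 <= x - y)); last by rewrite subr_ge0 ltW.
have -> : g x * (y - x) - (itg a y g - itg a x g) =
  itg a x g - itg a y g - g x * (x - y) by ring.
apply: key => //; first exact: ltW.
move=> z /andP[yz zx]; apply: Hd; first by apply/andP; split; lra.
by move: yx; rewrite !ler0_norm ?subr_le0//; lra.
Qed.

(** The difference of g and the integral function of g' has derivative 0, hence is Lipschitz with
    constant 0. *)
Lemma ftc2 a b g g' : a <= b -> cont_on a b g' -> deriv_on a b g g' ->
  itg a b g' = g b - g a.
Proof.
move=> ab cg' dg.
have dI := deriv_on_itg cg'.
have := @deriv_on_lipschitz _ _ _ _ _ 0 (deriv_onB dI dg).
have H x : a <= x <= b -> `|g' x - g' x| <= 0 by rewrite subrr normr0.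
move=> /(_ H a b); rewrite !lexx ab => /(_ isT isT).
by rewrite itg_point mul0r sub0r normr_le0 => /eqP; lra.
Qed.

End Integral.
Arguments itgZ {R a b} c {g}.
Arguments intbZ {R a b} c {g}.

(** * Uniform limits *)

Definition ucvg (R : realType) (X : Type) (A : set X) (G : nat -> X -> R)
    (g : X -> R) : Prop :=
  forall e : R, 0 < e -> exists N, forall n, (N <= n)%N ->
    forall x, A x -> `|G n x - g x| <= e.

Section Limits.
Variable R : realType.
Implicit Types (a b e t : R).

Lemma cauchy_lim (u : nat -> R) :
  (forall e, 0 < e -> exists N, forall m n, (N <= m)%N -> (N <= n)%N -> `|u m - u n| <= e) ->
  exists l : R, forall e, 0 < e -> exists N, forall n, (N <= n)%N -> `|u n - l| <= e.
Proof.
move=> cu; have cvu : cvg (u @ \oo).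
  apply: cauchy_cvg; apply/cauchy_exP => e e0.
  have e2 : 0 < e / 2 by rewrite divr_gt0.
  have [N HN] := cu _ e2; exists (u N); exists N => // n /= Nn.
  rewrite /ball/=; apply: le_lt_trans (HN _ _ _ Nn) _ => //.
  by rewrite ltr_pdivrMr// ltr_pMr// ltr1n.
exists (lim (u @ \oo)) => e e0.
have /cvgrPdist_le/(_ e e0)[N _ HN] := cvu.
by exists N => n Nn; rewrite distrC; exact: HN.
Qed.

Lemma le_lim_bound (u : nat -> R) (l c K : R) (N0 : nat) :
  (forall e, 0 < e -> exists N, forall n, (N <= n)%N -> `|u n - l| <= e) ->
  (forall n, (N0 <= n)%N -> `|u n - c| <= K) -> `|l - c| <= K.
Proof.
move=> ul uK; apply/ler_addgt0Pr => e e0.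
have [N HN] := ul e e0.
have {}HN := HN _ (leq_maxl N N0); have {}uK := uK _ (leq_maxr N N0).
move: HN uK; rewrite !ler_norml => /andP[? ?] /andP[? ?].
by apply/andP; split; lra.
Qed.

Lemma ucauchy_ucvg (X : Type) (A : set X) (G : nat -> X -> R) :
  (forall e, 0 < e -> exists N, forall m n, (N <= m)%N -> (N <= n)%N ->
     forall x, A x -> `|G m x - G n x| <= e) ->
  exists g, ucvg A G g.
Proof.
move=> cG; have H x : exists l : R, A x -> forall e, 0 < e ->
    exists N, forall n, (N <= n)%N -> `|G n x - l| <= e.
  have [Ax|nAx] := pselect (A x); last by exists 0.
  have [e e0|l Hl] := @cauchy_lim (fun n => G n x); last by exists l.
  by have [N HN] := cG e e0; exists N => m n Nm Nn; exact: HN.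
have [g Hg] := choice H; exists g => e e0.
have [N HN] := cG e e0; exists N => n Nn x Ax; rewrite distrC.
apply: (@le_lim_bound (fun m => G m x) (g x) (G n x) e N); first exact: Hg.
by move=> m Nm; exact: HN.
Qed.

Lemma ucvg_ucauchy (X : Type) (A : set X) (G : nat -> X -> R) g : ucvg A G g ->
  forall e, 0 < e -> exists N, forall m n, (N <= m)%N -> (N <= n)%N ->
     forall x, A x -> `|G m x - G n x| <= e.
Proof.
move=> Gg e e0; have e2 : 0 < e / 2 by rewrite divr_gt0.
have [N HN] := Gg _ e2; exists N => m n Nm Nn x Ax.
have := HN _ Nm x Ax; have := HN _ Nn x Ax.
by rewrite !ler_norml => /andP[? ?] /andP[? ?]; apply/andP; split; lra.
Qed.

Lemma within_continuous_unif (X : topologicalType) (A : set X) (g : X -> R) :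
  (forall e, 0 < e -> exists2 G : X -> R, {within A, continuous G} &
     forall x, A x -> `|G x - g x| <= e) ->
  {within A, continuous g}.
Proof.
move=> H; apply/subspace_continuousP => x Ax; apply/cvgrPdist_le => e e0.
have e3 : 0 < e / 3 by rewrite divr_gt0.
have [G /subspace_continuousP/(_ x Ax)/cvgrPdist_le/(_ _ e3) cG Gg] := H _ e3.
move: cG; rewrite !near_withinE; apply: filterS => y + Ay => /(_ Ay).
rewrite /from_subspace.
have := Gg x Ax; have := Gg y Ay.
rewrite !ler_norml => /andP[? ?] /andP[? ?] /andP[? ?].
by apply/andP; split; lra.
Qed.

Lemma cont_on_unif a b (G : nat -> R -> R) g : (forall n, cont_on a b (G n)) ->
  ucvg [set x | a <= x <= b] G g -> cont_on a b g.
Proof.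
move=> cG Gg; apply: within_continuous_unif => e e0.
have [N HN] := Gg e e0; exists (G N); first exact: cG.
by move=> x; rewrite /= in_itv/=; exact: HN.
Qed.

(** For large m the difference G m - G N is Lipschitz with a small constant; letting m tend to
    infinity transfers the first-order estimate of G N to g. *)
Lemma deriv_on_lim a b (G G' : nat -> R -> R) g g' :
  (forall n, deriv_on a b (G n) (G' n)) ->
  (forall x, a <= x <= b -> forall e, 0 < e ->
     exists N, forall n, (N <= n)%N -> `|G n x - g x| <= e) ->
  ucvg [set x | a <= x <= b] G' g' -> deriv_on a b g g'.
Proof.
move=> dG Gg Gg'; apply/deriv_onP => x xab e e0.
have e4 : 0 < e / 4 by rewrite divr_gt0.
have [N HN] := Gg' _ e4.
have [d d0 Hd] := (deriv_onP _ _ _ _).1 (dG N) x xab _ e4.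
exists d => // y yab yx.
have K m : (N <= m)%N -> `|(G m y - G m x) - (G N y - G N x)| <= e / 2 * `|y - x|.
  move=> Nm; have := @deriv_on_lipschitz R a b _ _ (e / 2) (deriv_onB (dG m) (dG N)).
  move=> /(_ _ x y xab yab); rewrite (_ : forall p q r s : R,
    p - q - (r - s) = (p - r) - (q - s)); last by move=> *; ring.
  apply => z zab; have := HN m Nm z zab; have := HN N (leqnn _) z zab.
  by rewrite !ler_norml => /andP[? ?] /andP[? ?]; apply/andP; split; lra.
have L : `|(g y - g x) - (G N y - G N x)| <= e / 2 * `|y - x|.
  apply: (@le_lim_bound (fun m => G m y - G m x) _ _ _ N); last exact: K.
  move=> r r0; have r2 : 0 < r / 2 by rewrite divr_gt0.
  have [N1 H1] := Gg y yab _ r2; have [N2 H2] := Gg x xab _ r2.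
  exists (maxn N1 N2) => n; rewrite geq_max => /andP[/H1 + /H2].
  by rewrite !ler_norml => /andP[? ?] /andP[? ?]; apply/andP; split; lra.
have D := Hd y yab yx.
have M : `|(G' N x - g' x) * (y - x)| <= e / 4 * `|y - x|.
  by rewrite normrM ler_wpM2r//; apply: HN.
move: L D M; move: (`|y - x|) => u; rewrite mulrBl !ler_norml.
move=> /andP[? ?] /andP[? ?] /andP[? ?]; apply/andP; split; lra.
Qed.

(** Uniform convergence of the first derivatives comes for free: G m - G n is small at a and b, so
    its derivative is small at some point between, and the second derivatives bound its variation
    from there. Thus u_x and u_t never need an estimate of their own. *)
Lemma deriv_on2_lim a b (G G1 G2 : nat -> R -> R) g g2 : a < b ->
  (forall n, deriv_on a b (G n) (G1 n)) ->
  (forall n, deriv_on a b (G1 n) (G2 n)) ->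
  (forall x, a <= x <= b -> forall e, 0 < e ->
     exists N, forall n, (N <= n)%N -> `|G n x - g x| <= e) ->
  ucvg [set x | a <= x <= b] G2 g2 ->
  exists g1, [/\ ucvg [set x | a <= x <= b] G1 g1, deriv_on a b g g1 & deriv_on a b g1 g2].
Proof.
move=> ab dG dG1 Gg Gg2.
suff [g1 Hg1] : exists g1, ucvg [set x | a <= x <= b] G1 g1.
  exists g1; split; [exact: Hg1|exact: deriv_on_lim Hg1|].
  apply: (deriv_on_lim dG1) => // x xab e e0.
  by have [N HN] := Hg1 e e0; exists N => n Nn; exact: HN.
apply: ucauchy_ucvg => e e0.
have ba0 : 0 < b - a by rewrite subr_gt0.
(* Four end point errors of this size add up to e / 2 * (b - a), which the mean value theorem
   divides by b - a. The other e / 2 is the variation over a length of at most b - a. *)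
have c1 : 0 < e / 8 * (b - a) by rewrite mulr_gt0// divr_gt0.
have c2 : 0 < e / 2 / (b - a) by rewrite !divr_gt0.
have aab : a <= a <= b by rewrite lexx ltW.
have bab : a <= b <= b by rewrite lexx ltW.
have [N1 H1] := Gg a aab _ c1; have [N2 H2] := Gg b bab _ c1.
have [N3 H3] := ucvg_ucauchy Gg2 c2.
exists (maxn N1 (maxn N2 N3)) => m n.
rewrite !geq_max => /and3P[m1 m2 m3] /and3P[n1 n2 n3] x xab.
have dE := deriv_onB (dG m) (dG n); have dE1 := deriv_onB (dG1 m) (dG1 n).
have [c /andP[ac cb] Ec] := mvt_on dE (lexx a) ab (lexx b).
have cab : a <= c <= b by rewrite !ltW.
have := deriv_on_lipschitz dE1 (fun z zab => H3 m n m3 n3 z zab) cab xab.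
have xc : `|x - c| <= b - a.
  by move: xab => /andP[? ?]; rewrite ler_norml; apply/andP; split; lra.
move=> K; have {}K : `|G1 m x - G1 n x - (G1 m c - G1 n c)| <= e / 2.
  apply: le_trans K _; rewrite -ler_pdivlMl// invf_div.
  by rewrite (_ : (b - a) / (e / 2) * (e / 2) = b - a)//; field; rewrite gt_eqF.
have Kc : `|G1 m c - G1 n c| <= e / 2.
  rewrite -(ler_pM2r ba0) -{1}(ger0_norm (ltW ba0)) -normrM -Ec.
  have := H1 _ m1; have := H1 _ n1; have := H2 _ m2; have := H2 _ n2.
  rewrite !ler_norml => /andP[? ?] /andP[? ?] /andP[? ?] /andP[? ?].
  by apply/andP; split; lra.
by move: K Kc; rewrite !ler_norml => /andP[? ?] /andP[? ?]; apply/andP; split; lra.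
Qed.

End Limits.

(** * Absolutely continuous and square integrable functions *)

Section Fubini.
Variable R : realType.
Implicit Types (a b x y e t : R) (g h : R -> R).
Local Notation mu := (@lebesgue_measure R).
Local Notation TR := (measurableTypeR R).

Lemma integral_itgE a b g : intb a b g ->
  (\int[mu]_(x in `[a, b]) (g x)%:E = (itg a b g)%:E)%E.
Proof.
by move=> ig; rewrite /itg /Rintegral fineK//; exact: integrable_fin_num ig.
Qed.

Lemma intb_patch a b g : intb a b g -> mu.-integrable setT (EFin \o (g \_ `[a, b])).
Proof.
by move=> ig; rewrite -restrict_EFin; apply/integrable_restrict => //; rewrite setTI.
Qed.

Lemma integral_patch a b g :
  (\int[mu]_x ((g \_ `[a, b]) x)%:E = \int[mu]_(x in `[a, b]) (g x)%:E)%E.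
Proof. by rewrite [RHS]integral_mkcond/=; apply: eq_integral => x _; rewrite restrict_EFin. Qed.

(** Fubini's theorem on the triangle a <= y <= s <= x, with h and g extended by 0. It is the source
    of the product rule for absolutely continuous functions. *)
Lemma itg_fubini a x g h : a <= x -> intb a x g -> intb a x h ->
  itg a x (fun s => h s * itg a s g) = itg a x (fun y => g y * itg y x h).
Proof.
move=> x0 ig ih.
pose G : TR -> R := g \_ `[a, x]; pose H : TR -> R := h \_ `[a, x].
have iG : mu.-integrable [set: TR] (EFin \o G) by exact: intb_patch.
have iH : mu.-integrable [set: TR] (EFin \o H) by exact: intb_patch.
have mG : measurable_fun [set: TR] G by move/integrableP : iG => [/measurable_EFinP].
have mH : measurable_fun [set: TR] H by move/integrableP : iH => [/measurable_EFinP].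
pose F (z : TR * TR) : R := if z.2 <= z.1 then H z.1 * G z.2 else 0.
have mF : measurable_fun [set: TR * TR] (EFin \o F).
  apply/measurable_EFinP; apply: measurable_fun_ifT => //.
  - apply: measurable_fun_ler; [exact: measurable_snd|exact: measurable_fst].
  - apply: measurable_funM.
    + exact: (measurableT_comp mH measurable_fst).
    + exact: (measurableT_comp mG measurable_snd).
have iF : (mu \x mu)%E.-integrable [set: TR * TR] (EFin \o F).
  apply/(integrable12ltyP _ _ mF).
  have fG : (\int[mu]_y `|(EFin \o G) y| < +oo)%E by move/integrableP : iG => [].
  have fH : (\int[mu]_y `|(EFin \o H) y| < +oo)%E by move/integrableP : iH => [].
  have mFs s : measurable_fun [set: TR] (fun y => (EFin \o F) (s, y)).
    exact: (measurableT_comp mF (measurable_pair1 s)).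
  apply: (@le_lt_trans _ _ (\int[mu]_s (`|(EFin \o H) s| * \int[mu]_y `|(EFin \o G) y|))%E).
    apply: ge0_le_integral => //.
    - by move=> s _; apply: integral_ge0.
    - apply: (measurable_fun_fubini_tonelli_F (abse \o (EFin \o F))) => //=.
      exact: measurableT_comp.
    - apply: emeasurable_funM; last exact: measurable_cst.
      by apply: measurableT_comp => //; exact/measurable_EFinP.
    - move=> s _; rewrite -ge0_integralZl//; last first.
        by apply: measurableT_comp => //; exact/measurable_EFinP.
      apply: ge0_le_integral => //.
      + exact: measurableT_comp.
      + apply: emeasurable_funM; first exact: measurable_cst.
        by apply: measurableT_comp => //; exact/measurable_EFinP.
      + move=> y _ /=; rewrite lee_fin /F/=; case: ifP => _.
          by rewrite normrM.
        by rewrite normr0 mulr_ge0.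
  rewrite ge0_integralZr//; last first.
  - exact: integral_ge0.
  - by apply: measurableT_comp => //; exact/measurable_EFinP.
  by rewrite lte_mul_pinfty// ?integral_ge0// ge0_fin_numE// integral_ge0.
have E := Fubini iF.
have L s : (\int[mu]_y (EFin \o F) (s, y) = (((fun s => h s * itg a s g) \_ `[a, x]) s)%:E)%E.
  rewrite patchE; case: ifPn => [|sx].
    rewrite inE/= in_itv/= => /andP[s0 sx].
    have is_ : intb a s g by apply: sub_intb ig.
    rewrite -itgZ// -integral_itgE; last exact: intbZ.
    rewrite -integral_patch; apply: eq_integral => y _ /=; congr EFin.
    rewrite /F/= /H /G !patchE.
    rewrite (_ : s \in _); last by rewrite inE/= in_itv/= s0.
    case: ifPn => ys; case: ifPn => yx.
    - rewrite (_ : y \in _)//; move: yx; rewrite !inE/= !in_itv/= ys => /andP[-> _]//.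
    - rewrite (_ : y \in _ = false) ?mulr0//; apply/negbTE; move: yx; apply: contra.
      by rewrite !inE/= !in_itv/= => /andP[-> /le_trans ->].
    - by exfalso; move: yx ys; rewrite inE/= in_itv/= => /andP[_ ->].
    - by [].
  rewrite integral0_eq// => y _ /=; rewrite /F/= /H patchE (negbTE sx) mul0r.
  by rewrite if_same.
have L' y : (\int[mu]_s (EFin \o F) (s, y) = (((fun y => g y * itg y x h) \_ `[a, x]) y)%:E)%E.
  rewrite patchE; case: ifPn => [|yx].
    rewrite inE/= in_itv/= => /andP[y0 yx].
    have is_ : intb y x h by apply: sub_intb ih.
    rewrite -itgZ// -integral_itgE; last exact: intbZ.
    rewrite -integral_patch; apply: eq_integral => s _ /=; congr EFin.
    rewrite /F/= /H /G !patchE.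
    rewrite (_ : y \in _); last by rewrite inE/= in_itv/= y0.
    case: ifPn => ys; case: ifPn => sx.
    - rewrite (_ : s \in _) 1?mulrC//; move: sx; rewrite !inE/= !in_itv/= ys => /andP[_ ->]//.
    - rewrite (_ : s \in _ = false) ?mul0r//; apply/negbTE; move: sx; apply: contra.
      by rewrite !inE/= !in_itv/= => /andP[_ ->]; rewrite (le_trans y0 ys).
    - by exfalso; move: sx ys; rewrite inE/= in_itv/= => /andP[->].
    - by [].
  rewrite integral0_eq// => s _ /=; rewrite /F/= /G patchE (negbTE yx) mulr0.
  by rewrite if_same.
move: E; under eq_integral do rewrite L.
under [in RHS]eq_integral do rewrite L'.
by rewrite !integral_patch /itg /Rintegral => ->.
Qed.

End Fubini.

(** [ac_deriv] together with the integrability that gives its integral a meaning. *)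
Definition AC (R : realType) (g g' : R -> R) : Prop :=
  intb 0 1 g' /\ forall x : R, 0 <= x <= 1 -> g x = g 0 + itg 0 x g'.

(** Working form of [L2]: plain integrability on the closed interval instead of membership in a
    space of functions cut off to the open one. *)
Definition L2b (R : realType) (g : R -> R) : Prop :=
  intb 0 1 g /\ intb 0 1 (fun x => g x ^+ 2).

Section AbsolutelyContinuous.
Variable R : realType.
Implicit Types (a b x y e t c : R) (g h : R -> R).
Local Notation mu := (@lebesgue_measure R).

Lemma AC_itg g g' x y : AC g g' -> 0 <= x -> x <= y -> y <= 1 ->
  itg x y g' = g y - g x.
Proof.
move=> [ig' gE] x0 xy y1.
have := gE y; rewrite y1 (le_trans x0 xy) => /(_ isT) ->.
have := gE x; rewrite x0 (le_trans xy y1) => /(_ isT) ->.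
rewrite (@itg_split R 0 x y)//; first by ring.
by apply: sub_intb ig'.
Qed.

Lemma AC_cont g g' : AC g g' -> cont_on 0 1 g.
Proof.
move=> [ig' gE]; apply: (@eq_cont_on R _ _ (fun x => g 0 + itg 0 x g')).
  by move=> x /gE ->.
apply: cont_onD; first exact: cont_on_cst.
have := @parameterized_integral_continuous R 0 1 g' ler01 ig'.
exact.
Qed.

Lemma deriv_on_AC g g' : deriv_on 0 1 g g' -> cont_on 0 1 g' -> AC g g'.
Proof.
move=> dg cg'; split; first exact: cont_on_intb.
move=> x /andP[x0 x1]; rewrite (@ftc2 _ _ _ g)//; first by ring.
- exact: sub_cont_on (lexx _) x1 cg'.
- exact: sub_deriv_on (lexx _) x1 dg.
Qed.

Lemma ACD g g' h h' : AC g g' -> AC h h' ->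
  AC (fun x => g x + h x) (fun x => g' x + h' x).
Proof.
move=> [ig gE] [ih hE]; split; first exact: intbD.
move=> x /[dup] /andP[x0 x1] x01; rewrite itgD; first by rewrite gE// hE//; ring.
- exact: sub_intb (lexx _) x1 ig.
- exact: sub_intb (lexx _) x1 ih.
Qed.

Lemma ACZ c g g' : AC g g' -> AC (fun x => c * g x) (fun x => c * g' x).
Proof.
move=> [ig gE]; split; first exact: intbZ.
move=> x /[dup] /andP[x0 x1] x01; rewrite itgZ; first by rewrite gE//; ring.
exact: sub_intb (lexx _) x1 ig.
Qed.

Lemma eq_AC g g' h h' : (forall x, 0 <= x <= 1 -> g x = h x) ->
  (forall x, 0 <= x <= 1 -> g' x = h' x) -> AC g g' -> AC h h'.
Proof.
move=> gh gh' [ig gE]; split; first exact: eq_intb gh' ig.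
move=> x /[dup] /andP[x0 x1] x01; rewrite -gh// gE// gh; last by rewrite lexx ler01.
congr (_ + _); apply: eq_itg => y /andP[y0 yx]; apply: gh'.
by rewrite y0 (le_trans yx).
Qed.

(** The inner integrals in [itg_fubini] are increments of g and of h, so its two sides are, up to
    boundary values, int g h' and int g' h. *)
Lemma ACM g g' h h' : AC g g' -> AC h h' ->
  AC (fun x => g x * h x) (fun x => g' x * h x + g x * h' x).
Proof.
move=> ACg ACh; have [ig gE] := ACg; have [ih hE] := ACh.
have cg := AC_cont ACg; have ch := AC_cont ACh.
have ig'h : intb 0 1 (fun x => g' x * h x).
  by apply: eq_intb (intbM_cont ig ch) => x _; rewrite mulrC.
have igh' : intb 0 1 (fun x => g x * h' x) by exact: intbM_cont ih cg.
split; first exact: intbD.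
move=> x /[dup] /andP[x0 x1] x01.
have sx k : intb 0 1 k -> intb 0 x k by exact: sub_intb (lexx _) x1.
rewrite itgD; [|exact: sx..].
have E1 : itg 0 x (fun s => h' s * itg 0 s g') =
          itg 0 x (fun s => g s * h' s) - g 0 * itg 0 x h'.
  rewrite -itgZ; last exact: sx.
  rewrite -itgB; [|exact: sx|by apply: intbZ; exact: sx].
  apply: eq_itg => s /andP[s0 sx']; rewrite (AC_itg ACg)//; first by ring.
  exact: le_trans sx' x1.
have E2 : itg 0 x (fun y => g' y * itg y x h') =
          h x * itg 0 x g' - itg 0 x (fun y => g' y * h y).
  rewrite -itgZ; last exact: sx.
  rewrite -itgB; [|by apply: intbZ; exact: sx|exact: sx].
  by apply: eq_itg => s /andP[s0 sx']; rewrite (AC_itg ACh)//; ring.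
have := itg_fubini x0 (sx _ ig) (sx _ ih).
rewrite E1 E2 (AC_itg ACg)// (AC_itg ACh)//; lra.
Qed.

(** On an interval of finite length square integrability gives integrability, as |g| <= 1 + g^2. *)
Lemma intb_L2b g : measurable_fun `[0 : R, 1] g -> intb 0 1 (fun x => g x ^+ 2) -> L2b g.
Proof.
move=> mg ig2; split=> //.
have i1 : intb 0 1 (fun x => 1 + g x ^+ 2).
  by apply: intbD => //; apply: cont_on_intb; exact: cont_on_cst.
apply: le_integrable i1 => //; first exact/measurable_EFinP.
move=> x _ /=; rewrite lee_fin (ger0_norm (_ : 0 <= 1 + _)); last first.
  by rewrite addr_ge0// sqr_ge0.
rewrite -real_normK ?num_real//; have := sqr_ge0 (`|g x| - 1 / 2).
move: (`|g x|) => r; rewrite sqrrB; nra.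
Qed.

Lemma cont_on_L2b g : cont_on 0 1 g -> L2b g.
Proof.
move=> cg; split; apply: cont_on_intb => //.
by under eq_fun do rewrite expr2; exact: cont_onM.
Qed.

Lemma L2bD g h : L2b g -> L2b h -> L2b (fun x => g x + h x).
Proof.
move=> [ig ig2] [ih ih2]; apply: intb_L2b.
  by apply: measurable_funD; exact: intb_measurable.
have i2 : intb 0 1 (fun x => 2 * g x ^+ 2 + 2 * h x ^+ 2).
  by apply: intbD; apply: intbZ.
apply: le_integrable i2 => //.
  apply/measurable_EFinP; apply: measurable_funX.
  by apply: measurable_funD; exact: intb_measurable.
move=> x _ /=; rewrite lee_fin ger0_norm ?sqr_ge0//.
rewrite ger0_norm; last by rewrite addr_ge0// mulr_ge0// sqr_ge0.
have := sqr_ge0 (g x - h x); nra.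
Qed.

Lemma L2bM_cont g h : L2b g -> cont_on 0 1 h -> L2b (fun x => h x * g x).
Proof.
move=> [ig ig2] ch; split; first exact: intbM_cont.
have ch2 : cont_on 0 1 (fun x => h x ^+ 2).
  by under eq_fun do rewrite expr2; exact: cont_onM.
by apply: eq_intb (intbM_cont ig2 ch2) => x _; rewrite exprMn.
Qed.

Lemma intb_oo a b g : mu.-integrable `]a, b[ (EFin \o g) -> intb a b g.
Proof.
move=> ig; have mg : measurable_fun `[a, b] (EFin \o g).
  by apply: (@emeasurable_fun_itv_cc R a b false true); move/integrableP : ig => [].
apply/integrableP; split => //.
rewrite -integral_itv_obnd_cbnd; last first.
  apply: measurableT_comp => //; apply: measurable_funS mg => //.
  by move=> x /=; rewrite !in_itv/= => /andP[/ltW -> ->].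
rewrite -integral_itv_bndo_bndc; last first.
  apply: measurableT_comp => //; apply: measurable_funS mg => //.
  by move=> x /=; rewrite !in_itv/= => /andP[/ltW -> /ltW ->].
by move/integrableP : ig => [].
Qed.

Lemma itg_oo a b g : intb a b g ->
  (\int[mu]_(x in `]a, b[) (g x)%:E = (itg a b g)%:E)%E.
Proof.
move=> ig; rewrite -integral_itgE//.
have mg : measurable_fun `[a, b] (EFin \o g) by move/integrableP : ig => [].
rewrite integral_itv_bndo_bndc; last first.
  apply: measurable_funS mg => //.
  by move=> x /=; rewrite !in_itv/= => /andP[/ltW -> /ltW ->].
rewrite integral_itv_obnd_cbnd//; apply: measurable_funS mg => //.
by move=> x /=; rewrite !in_itv/= => /andP[/ltW -> ->].
Qed.

Lemma L2_L2b g : L2 g -> L2b g.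
Proof.
move=> Lg; have i2 := Lfun2_integrable_sqr Lg.
have mg : measurable_fun `[0 : R, 1] g.
  apply: (@measurable_fun_itv_cc R 0 1 false true).
  have /set_mem/= mg := sub_Lfun_mfun Lg.
  by apply/(measurable_restrictT g (measurable_itv _)); exact: mg.
apply: intb_L2b => //; apply: intb_oo; apply/integrable_mkcond => //.
apply: eq_integrable i2 => //= x _.
rewrite restrict_EFin /= /I01; congr EFin; rewrite !patchE.
by case: ifPn => // _; rewrite expr0n.
Qed.

Lemma L2normE g : intb 0 1 (fun x => g x ^+ 2) ->
  L2norm g = Num.sqrt (itg 0 1 (fun x => g x ^+ 2)).
Proof.
move=> i2; rewrite /L2norm unlock /=.
rewrite (_ : (\int[_]_x _)%E = (itg 0 1 (fun x => g x ^+ 2))%:E); last first.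
  rewrite -itg_oo// [RHS]integral_mkcond; apply: eq_integral => x _.
  rewrite restrict_EFin patchE /= patchE; case: ifPn => _.
    by rewrite powR_mulrn// real_normK// num_real.
  by rewrite normr0 powR0// pnatr_eq0.
by rewrite poweR_EFin/= powR12_sqrt// itg_ge0// => x _; exact: sqr_ge0.
Qed.

Lemma L2norm_sqr g : intb 0 1 (fun x => g x ^+ 2) ->
  L2norm g ^+ 2 = itg 0 1 (fun x => g x ^+ 2).
Proof.
by move=> i2; rewrite L2normE// sqr_sqrtr// itg_ge0// => x _; exact: sqr_ge0.
Qed.

Lemma L2norm_ge0 g : 0 <= L2norm g.
Proof. by rewrite /L2norm fine_ge0// Lnorm_ge0. Qed.

(** Cauchy-Schwarz against the constant 1, obtained by integrating (|g| - c)^2 >= 0 where c is the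
    mean of |g|. *)
Lemma itg_norm_le_L2norm g : L2b g -> itg 0 1 (fun x => `|g x|) <= L2norm g.
Proof.
move=> [ig ig2]; set c := itg _ _ _.
have c0 : 0 <= c by apply: itg_ge0.
rewrite L2normE// -(ger0_norm c0) -sqrtr_sqr ler_wsqrtr//.
have := @itg_ge0 R 0 1 (fun x => g x ^+ 2 - (2 * c * `|g x| - c ^+ 2)).
have in_ := intb_norm ig.
have icst : intb 0 1 (fun=> c ^+ 2) by apply: cont_on_intb; exact: cont_on_cst.
have H x : (0 : R) <= x <= 1 -> 0 <= g x ^+ 2 - (2 * c * `|g x| - c ^+ 2).
  rewrite -real_normK ?num_real// => _; have := sqr_ge0 (`|g x| - c).
  by rewrite sqrrB; move: (`|g x|) => r; rewrite mulr2n; lra.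
move=> /(_ H); rewrite itgB//; last by apply: intbB => //; exact: intbZ.
rewrite itgB//; last exact: intbZ.
by rewrite itgZ// itg_cst// -/c subr0 mulr1; lra.
Qed.

End AbsolutelyContinuous.

(** * The trigonometric system *)

Section Trigonometric.
Variable R : realType.
Implicit Types (a b x y e t c l : R) (g h d : R -> R).

Lemma deriv_on_sinZ a b l : deriv_on a b (fun x => sin (l * x)) (fun x => l * cos (l * x)).
Proof.
apply: is_derive_deriv_on => x.
have H : is_derive x 1 (fun y => l * y) l.
  by apply: is_derive_eq; rewrite /GRing.scale/= mulr1.
by apply: is_derive_eq; rewrite /GRing.scale/= mulrC.
Qed.

Lemma deriv_on_cosZ a b l : deriv_on a b (fun x => cos (l * x)) (fun x => - l * sin (l * x)).
Proof.
apply: is_derive_deriv_on => x.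
have H : is_derive x 1 (fun y => l * y) l.
  by apply: is_derive_eq; rewrite /GRing.scale/= mulr1.
by apply: is_derive_eq; rewrite /GRing.scale/= mulrC mulrN mulNr.
Qed.

Lemma cont_on_sinZ a b l : cont_on a b (fun x => sin (l * x)).
Proof. exact: deriv_on_cont (@deriv_on_sinZ a b l). Qed.

Lemma cont_on_cosZ a b l : cont_on a b (fun x => cos (l * x)).
Proof. exact: deriv_on_cont (@deriv_on_cosZ a b l). Qed.

Lemma cont_on_id a b : cont_on a b (fun x : R => x).
Proof. exact: deriv_on_cont (@deriv_on_id R a b). Qed.

Lemma cos_le1_norm x : `|cos x| <= 1.
Proof. by rewrite ler_norml cos_geN1 cos_le1. Qed.

Lemma lam0 : lam R 0 = 0.
Proof. by rewrite /lam mulr0 mul0r. Qed.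

Lemma lamS k : lam R k.+1 = lam R k + lam R 1.
Proof. by rewrite /lam -[in LHS]natr1; ring. Qed.

Lemma lam_ge k : (0 < k)%N -> 4 <= lam R k.
Proof.
move=> k0; have := pi_ge2 R; have : 1 <= k%:R :> R by rewrite ler1n.
rewrite /lam => ? ?; nra.
Qed.

Lemma lam_gt0 k : (0 < k)%N -> 0 < lam R k.
Proof. by move=> /lam_ge; apply: lt_le_trans. Qed.

Lemma cos_lam k : cos (lam R k) = 1.
Proof.
elim: k => [|k IH]; first by rewrite lam0 cos0.
have -> : lam R k.+1 = lam R k + pi *+ 2 by rewrite lamS /lam mulr2n; ring.
by rewrite cosD2pi.
Qed.

Lemma sin_lam k : sin (lam R k) = 0.
Proof.
elim: k => [|k IH]; first by rewrite lam0 sin0.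
have -> : lam R k.+1 = lam R k + pi *+ 2 by rewrite lamS /lam mulr2n; ring.
by rewrite sinD2pi.
Qed.

Lemma itg_cosZ l : l != 0 -> sin l = 0 -> itg 0 1 (fun x => cos (l * x)) = 0.
Proof.
move=> l0 sl.
rewrite (@ftc2 R 0 1 (fun x => l^-1 * sin (l * x)))//.
- by rewrite mulr1 mulr0 sin0 sl mulr0 subrr.
- exact: cont_on_cosZ.
- apply: (eq_deriv_on _ _ (deriv_onZ l^-1 (@deriv_on_sinZ 0 1 l))) => // x _.
  by rewrite mulKf.
Qed.

Lemma sinB_lam j k : sin (lam R j - lam R k) = 0.
Proof. by rewrite sinB !sin_lam !mul0r mulr0 subrr. Qed.

Lemma lam_inj j k : lam R j = lam R k -> j = k.
Proof.
rewrite /lam => /(mulIf (lt0r_neq0 (pi_gt0 R))) /mulfI.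
by move=> /(_ _)/eqP; rewrite eqr_nat pnatr_eq0 => /(_ isT)/eqP.
Qed.

Lemma itg_trig_mul j k : (0 < j)%N -> (0 < k)%N ->
  itg 0 1 (fun x => cos (lam R j * x) * cos (lam R k * x)) = (if j == k then 1 / 2 else 0) /\
  itg 0 1 (fun x => sin (lam R j * x) * sin (lam R k * x)) = (if j == k then 1 / 2 else 0).
Proof.
move=> j0 k0; have lj := lam_gt0 j0; have lk := lam_gt0 k0.
have ic l : intb 0 1 (fun x => cos (l * x)) by apply: cont_on_intb; exact: cont_on_cosZ.
set Im := itg 0 1 (fun x => cos ((lam R j - lam R k) * x)).
set Ip := itg 0 1 (fun x => cos ((lam R j + lam R k) * x)).
have Ip0 : Ip = 0.
  rewrite /Ip itg_cosZ//; first by rewrite gt_eqF// addr_gt0.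
  by rewrite sinD !sin_lam !mul0r mulr0 addr0.
have ImE : Im = (if j == k then 1 else 0).
  rewrite /Im; case: eqVneq => [->|jk].
    rewrite subrr (@eq_itg _ _ _ _ (fun=> 1)); last by move=> x _; rewrite mul0r cos0.
    by rewrite itg_cst// subr0 mulr1.
  rewrite itg_cosZ//; last exact: sinB_lam.
  by rewrite subr_eq0; apply: contra_neq jk; exact: lam_inj.
split.
  rewrite (@eq_itg _ _ _ _ (fun x => 1 / 2 * cos ((lam R j - lam R k) * x) +
      1 / 2 * cos ((lam R j + lam R k) * x))); last first.
    by move=> x _; rewrite mulrBl mulrDl cosB cosD; field.
  rewrite itgD; [|exact: intbZ..]; rewrite !itgZ// -/Im -/Ip Ip0 ImE.
  by case: ifP => _; ring.
rewrite (@eq_itg _ _ _ _ (fun x => 1 / 2 * cos ((lam R j - lam R k) * x) +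
    - (1 / 2) * cos ((lam R j + lam R k) * x))); last first.
  by move=> x _; rewrite mulrBl mulrDl cosB cosD; field.
rewrite itgD; [|exact: intbZ..]; rewrite !itgZ// -/Im -/Ip Ip0 ImE.
by case: ifP => _; ring.
Qed.

Lemma itg_cos_lam k : (0 < k)%N -> itg 0 1 (fun x => cos (lam R k * x)) = 0.
Proof. by move=> k0; rewrite itg_cosZ ?sin_lam// gt_eqF// lam_gt0. Qed.

(** Induction on the remainder r of g after projection on w_1, ..., w_N: each projection lowers the
    squared norm by 2 c_k^2 and keeps the coefficients of higher index. The factor 1/2 is the
    squared norm of w_k. *)
Lemma bessel (w : nat -> R -> R) g N : (forall k, cont_on 0 1 (w k)) ->
  (forall j k, (0 < j)%N -> (0 < k)%N ->
     itg 0 1 (fun x => w j x * w k x) = (if j == k then 1 / 2 else 0)) ->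
  L2b g ->
  \sum_(1 <= k < N.+1) (itg 0 1 (fun x => g x * w k x)) ^+ 2 <=
    1 / 2 * itg 0 1 (fun x => g x ^+ 2).
Proof.
move=> cw ow Lg.
have im r k : L2b r -> intb 0 1 (fun x => r x * w k x).
  by move=> [ir _]; apply: eq_intb (intbM_cont ir (cw k)) => x _; rewrite mulrC.
suff [r [Lr [rm r2]]] : exists r, L2b r /\
    (forall m, (N < m)%N ->
       itg 0 1 (fun x => r x * w m x) = itg 0 1 (fun x => g x * w m x)) /\
    itg 0 1 (fun x => r x ^+ 2) = itg 0 1 (fun x => g x ^+ 2) -
      2 * \sum_(1 <= k < N.+1) (itg 0 1 (fun x => g x * w k x)) ^+ 2.
  have : 0 <= itg 0 1 (fun x => r x ^+ 2) by apply: itg_ge0 => x _; exact: sqr_ge0.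
  by rewrite r2; lra.
elim: N => [|N [r [Lr [rm r2]]]].
  by exists g; split => //; split => //; rewrite big_geq// mulr0 subr0.
set m := N.+1; set a := 2 * itg 0 1 (fun x => g x * w m x).
exists (fun x => r x + - a * w m x).
have cam : cont_on 0 1 (fun x => - a * w m x) by exact: cont_onZ.
split; first by apply: L2bD => //; exact: cont_on_L2b.
have iww j k : intb 0 1 (fun x => w j x * w k x).
  by apply: cont_on_intb; exact: cont_onM.
split=> [k mk|].
  rewrite (@eq_itg _ _ _ _ (fun x => r x * w k x + - a * (w m x * w k x))); last first.
    by move=> x _; ring.
  rewrite itgD; [|exact: im|exact: intbZ].
  rewrite itgZ// ow//; last exact: leq_ltn_trans mk.
  by rewrite ltn_eqF// mulr0 addr0 rm// ltnW.
rewrite (@eq_itg _ _ _ _ (fun x => r x ^+ 2 + (- 2 * a * (r x * w m x) +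
    a ^+ 2 * (w m x * w m x)))); last by move=> x _; ring.
have [_ ir2] := Lr.
rewrite itgD//; last by apply: intbD; apply: intbZ => //; exact: im.
rewrite itgD; [|by apply: intbZ; exact: im|exact: intbZ].
rewrite !itgZ//; last exact: im.
rewrite ow// eqxx rm// r2 [in RHS]big_nat_recr//= -/m.
by rewrite /a; field.
Qed.

Lemma bessel_cos g N : L2b g ->
  \sum_(1 <= k < N.+1) (itg 0 1 (fun x => g x * cos (lam R k * x))) ^+ 2 <=
    1 / 2 * itg 0 1 (fun x => g x ^+ 2).
Proof.
apply: (@bessel (fun k x => cos (lam R k * x))); first by move=> k; exact: cont_on_cosZ.
by move=> j k j0 k0; have [] := itg_trig_mul j0 k0.
Qed.

Lemma bessel_sin g N : L2b g ->
  \sum_(1 <= k < N.+1) (itg 0 1 (fun x => g x * sin (lam R k * x))) ^+ 2 <=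
    1 / 2 * itg 0 1 (fun x => g x ^+ 2).
Proof.
apply: (@bessel (fun k x => sin (lam R k * x))); first by move=> k; exact: cont_on_sinZ.
by move=> j k j0 k0; have [] := itg_trig_mul j0 k0.
Qed.

End Trigonometric.

(** * Completeness of the trigonometric system among continuous functions *)

Section Completeness.
Variable R : realType.
Implicit Types (a b x y e t c l : R) (g h d : R -> R).

(** The product formulas rewrite P cos(lam_k x) and P sin(lam_k x) as combinations of frequencies
    k-1, k and k+1, so each power of P is absorbed by the induction hypothesis taken at all
    frequencies at once. *)
Lemma itg_trig_poly d A B C (n : nat) : cont_on 0 1 d ->
  (forall k, itg 0 1 (fun x => d x * cos (lam R k * x)) = 0) ->
  (forall k, itg 0 1 (fun x => d x * sin (lam R k * x)) = 0) ->
  forall k,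
  itg 0 1 (fun x => d x * (A + B * cos (lam R 1 * x) + C * sin (lam R 1 * x)) ^+ n
                    * cos (lam R k * x)) = 0 /\
  itg 0 1 (fun x => d x * (A + B * cos (lam R 1 * x) + C * sin (lam R 1 * x)) ^+ n
                    * sin (lam R k * x)) = 0.
Proof.
move=> cd dc ds.
set P := fun x => A + B * cos (lam R 1 * x) + C * sin (lam R 1 * x).
have cP : cont_on 0 1 P.
  apply: cont_onD; first apply: cont_onD; first exact: cont_on_cst.
    by apply: cont_onZ; exact: cont_on_cosZ.
  by apply: cont_onZ; exact: cont_on_sinZ.
have cdP m : cont_on 0 1 (fun x => d x * P x ^+ m).
  elim: m => [|m IH]; first by apply: eq_cont_on cd => x _; rewrite expr0 mulr1.
  by apply: eq_cont_on (cont_onM IH cP) => x _; rewrite exprSr mulrA.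
have icos m k : intb 0 1 (fun x => d x * P x ^+ m * cos (lam R k * x)).
  by apply: cont_on_intb; apply: cont_onM => //; exact: cont_on_cosZ.
have isin m k : intb 0 1 (fun x => d x * P x ^+ m * sin (lam R k * x)).
  by apply: cont_on_intb; apply: cont_onM => //; exact: cont_on_sinZ.
rewrite -/(P _).
elim: n => [k|n IH k].
  by split; [rewrite -[RHS](dc k)|rewrite -[RHS](ds k)]; apply: eq_itg => x _;
    rewrite expr0 mulr1.
have Ic k' := (IH k').1; have Is k' := (IH k').2.
have cos1S k' x : cos (lam R 1 * x) * cos (lam R k'.+1 * x) =
    1 / 2 * (cos (lam R k'.+2 * x) + cos (lam R k' * x)).
  rewrite [lam R k'.+2]lamS (_ : lam R k' = lam R k'.+1 - lam R 1); last first.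
    by rewrite lamS; ring.
  by rewrite !mulrDl !mulNr !cosD !cosN !sinN; field.
have sin1S k' x : sin (lam R 1 * x) * sin (lam R k'.+1 * x) =
    1 / 2 * (cos (lam R k' * x) - cos (lam R k'.+2 * x)).
  rewrite [lam R k'.+2]lamS (_ : lam R k' = lam R k'.+1 - lam R 1); last first.
    by rewrite lamS; ring.
  by rewrite !mulrDl !mulNr !cosD !cosN !sinN; field.
have sincos k' x : sin (lam R 1 * x) * cos (lam R k'.+1 * x) =
    1 / 2 * (sin (lam R k'.+2 * x) - sin (lam R k' * x)).
  rewrite [lam R k'.+2]lamS (_ : lam R k' = lam R k'.+1 - lam R 1); last first.
    by rewrite lamS; ring.
  by rewrite !mulrDl !mulNr !sinD !cosN !sinN; field.
have cossin k' x : cos (lam R 1 * x) * sin (lam R k'.+1 * x) =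
    1 / 2 * (sin (lam R k'.+2 * x) + sin (lam R k' * x)).
  rewrite [lam R k'.+2]lamS (_ : lam R k' = lam R k'.+1 - lam R 1); last first.
    by rewrite lamS; ring.
  by rewrite !mulrDl !mulNr !sinD !cosN !sinN; field.
(* Five terms: A contributes one and B and C two each. The case k = 0 is padded with zero
   coefficients. *)
have lin5 (g0 g1 g2 g3 g4 : R -> R) (a0 a1 a2 a3 a4 : R) :
    intb 0 1 g0 -> intb 0 1 g1 -> intb 0 1 g2 -> intb 0 1 g3 -> intb 0 1 g4 ->
    itg 0 1 g0 = 0 -> itg 0 1 g1 = 0 -> itg 0 1 g2 = 0 -> itg 0 1 g3 = 0 -> itg 0 1 g4 = 0 ->
    itg 0 1 (fun x => a0 * g0 x + (a1 * g1 x + (a2 * g2 x + (a3 * g3 x + a4 * g4 x)))) = 0.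
  move=> i0 i1 i2 i3 i4 E0 E1 E2 E3 E4.
  do 4 (rewrite itgD; [|by repeat (apply: intbD || apply: intbZ)..]).
  by rewrite !itgZ// E0 E1 E2 E3 E4 !mulr0 !addr0.
case: k => [|k]; split.
- rewrite (@eq_itg _ _ _ _ (fun x => A * (d x * P x ^+ n * cos (lam R 0 * x)) +
    (B * (d x * P x ^+ n * cos (lam R 1 * x)) + (C * (d x * P x ^+ n * sin (lam R 1 * x)) +
    (0 * (d x * P x ^+ n * sin (lam R 1 * x)) + 0 * (d x * P x ^+ n * sin (lam R 1 * x))))))).
    by apply: lin5.
  by move=> x _; rewrite lam0 mul0r cos0 exprS {1}/P; ring.
- rewrite (@eq_itg _ _ _ _ (fun=> 0)); first by rewrite itg_cst// mul0r.
  by move=> x _; rewrite lam0 mul0r sin0 mulr0.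
- rewrite (@eq_itg _ _ _ _ (fun x => A * (d x * P x ^+ n * cos (lam R k.+1 * x)) +
    (B / 2 * (d x * P x ^+ n * cos (lam R k.+2 * x)) +
    (B / 2 * (d x * P x ^+ n * cos (lam R k * x)) +
    (C / 2 * (d x * P x ^+ n * sin (lam R k.+2 * x)) +
     - C / 2 * (d x * P x ^+ n * sin (lam R k * x))))))).
    by apply: lin5.
  move=> x _; rewrite exprS {1}/P.
  transitivity (d x * P x ^+ n * (A * cos (lam R k.+1 * x) +
    B * (cos (lam R 1 * x) * cos (lam R k.+1 * x)) +
    C * (sin (lam R 1 * x) * cos (lam R k.+1 * x)))); first by ring.
  by rewrite cos1S sincos; field.
- rewrite (@eq_itg _ _ _ _ (fun x => A * (d x * P x ^+ n * sin (lam R k.+1 * x)) +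
    (B / 2 * (d x * P x ^+ n * sin (lam R k.+2 * x)) +
    (B / 2 * (d x * P x ^+ n * sin (lam R k * x)) +
    (C / 2 * (d x * P x ^+ n * cos (lam R k * x)) +
     - C / 2 * (d x * P x ^+ n * cos (lam R k.+2 * x))))))).
    by apply: lin5.
  move=> x _; rewrite exprS {1}/P.
  transitivity (d x * P x ^+ n * (A * sin (lam R k.+1 * x) +
    B * (cos (lam R 1 * x) * sin (lam R k.+1 * x)) +
    C * (sin (lam R 1 * x) * sin (lam R k.+1 * x)))); first by ring.
  by rewrite cossin sin1S; field.
Qed.

Lemma bernoulli_ge c n : 0 <= c -> 1 + n%:R * c <= (1 + c) ^+ n.
Proof.
move=> c0; elim: n => [|n IH]; first by rewrite mul0r addr0 expr0.
rewrite exprS -natr1; have : 0 <= n%:R :> R by [].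
move: (n%:R : R) IH => m; move: ((1 + c) ^+ n) => z; nra.
Qed.

Lemma cos_le_pi x y : 0 <= x -> x <= y -> y <= pi -> cos y <= cos x.
Proof.
move=> x0 xy yp; rewrite leNgt ltr_cos ?in_itv/= -?leNgt//.
  by rewrite yp (le_trans x0).
by rewrite x0 (le_trans xy).
Qed.

(** Monotonicity of cos on [0, pi] settles s <= 1/2; larger s reduce to 1 - s by periodicity, as lam
    1 = 2 pi. *)
Lemma cos_peak t s : 0 < t -> t <= 1 / 2 -> t <= s -> s <= 1 - t ->
  cos (lam R 1 * s) <= cos (lam R 1 * t).
Proof.
move=> t0 t2 ts s1; have p0 := pi_gt0 R.
have main u : t <= u -> u <= 1 / 2 -> cos (lam R 1 * u) <= cos (lam R 1 * t).
  by move=> tu u2; apply: cos_le_pi; rewrite /lam; nra.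
have [s2|s2] := leP s (1 / 2); first exact: main.
have -> : lam R 1 * s = lam R 1 - lam R 1 * (1 - s) by ring.
rewrite cosB cos_lam sin_lam mul0r addr0 mul1r; apply: main; lra.
Qed.

(* The trigonometric polynomials P ^+ n, with P > 1 near x0 and |P| <= 1 away
   from it, concentrate at x0, yet all of them are orthogonal to d. *)
Lemma trig_complete_interior d : cont_on 0 1 d ->
  (forall k, itg 0 1 (fun x => d x * cos (lam R k * x)) = 0) ->
  (forall k, itg 0 1 (fun x => d x * sin (lam R k * x)) = 0) ->
  forall x0, 0 < x0 < 1 -> d x0 <= 0.
Proof.
move=> cd dc ds x0 /andP[x00 x01]; rewrite leNgt; apply/negP => d0.
have [K K0 dK] := cont_on_bounded cd.
have e0 : 0 < d x0 / 2 by rewrite divr_gt0.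
have [|r r0 Hr] := (cont_onP _ _ _).1 cd x0 _ _ e0; first by rewrite !ltW.
(* The window |x - x0| <= t lies in [0,1] and keeps d above d x0 / 2; t <= 1/2 is the half period on
   which the cosine peak decreases. *)
pose t := Num.min (r / 2) (Num.min (1 / 2) (Num.min x0 (1 - x0))).
have t0 : 0 < t by rewrite !lt_min x00 subr_gt0 x01 !divr_gt0.
have tr : t < r.
  by rewrite (le_lt_trans (_ : t <= r / 2))// ?ge_min ?lexx// ltr_pdivrMr// ltr_pMr// ltr1n.
have t2 : t <= 1 / 2 by rewrite !ge_min lexx orbT.
have tx : t <= x0 by rewrite !ge_min lexx !orbT.
have tx1 : t <= 1 - x0 by rewrite !ge_min lexx !orbT.
pose c := cos (lam R 1 * (t / 2)) - cos (lam R 1 * t).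
have c0 : 0 < c.
  rewrite subr_gt0 (@ltr_cos R); have p0 := pi_gt0 R; rewrite /lam ?in_itv/=.
  - by nra.
  - apply/andP; split; nra.
  - apply/andP; split; nra.
pose A := 1 - cos (lam R 1 * t).
pose B := cos (lam R 1 * x0). pose C := sin (lam R 1 * x0).
pose P x := A + B * cos (lam R 1 * x) + C * sin (lam R 1 * x).
have PE x : P x = 1 - cos (lam R 1 * t) + cos (lam R 1 * `|x - x0|).
  rewrite /P /A /B /C; have -> : cos (lam R 1 * `|x - x0|) = cos (lam R 1 * (x - x0)).
    case: (leP x0 x) => xx; first by rewrite ger0_norm// subr_ge0.
    by rewrite ltr0_norm ?subr_lt0// mulrN cosN.
  by rewrite mulrBr cosB; ring.
have p0 := pi_gt0 R.
have P_in x : `|x - x0| <= t -> 1 <= P x.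
  move=> xt; rewrite PE -addrA lerDl addrC subr_ge0.
  by apply: cos_le_pi; rewrite /lam; have := normr_ge0 (x - x0); nra.
have P_half x : `|x - x0| <= t / 2 -> 1 + c <= P x.
  move=> xt; rewrite PE /c.
  suff : cos (lam R 1 * (t / 2)) <= cos (lam R 1 * `|x - x0|) by lra.
  by apply: cos_le_pi; rewrite /lam; have := normr_ge0 (x - x0); nra.
have P_out x : 0 <= x <= 1 -> t < `|x - x0| -> `|P x| <= 1.
  move=> /andP[? ?] xt; have := @cos_peak t `|x - x0| t0 t2 (ltW xt).
  have -> : `|x - x0| <= 1 - t by rewrite ler_norml; apply/andP; split; lra.
  move=> /(_ isT); have := cos_geN1 (lam R 1 * `|x - x0|).
  have := cos_le1 (lam R 1 * t).
  by rewrite ler_norml PE => ? ? ?; apply/andP; split; lra.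
have d_in x : 0 <= x <= 1 -> `|x - x0| <= t -> d x0 / 2 <= d x.
  move=> x01' xt; have := Hr x x01' (le_lt_trans xt tr).
  by rewrite ler_norml => /andP[]; lra.
have cP : cont_on 0 1 P.
  apply: cont_onD; first apply: cont_onD; first exact: cont_on_cst.
    by apply: cont_onZ; exact: cont_on_cosZ.
  by apply: cont_onZ; exact: cont_on_sinZ.
have idP n : intb 0 1 (fun x => d x * P x ^+ n).
  apply: cont_on_intb; elim: n => [|n IH].
    by apply: eq_cont_on cd => x _; rewrite expr0 mulr1.
  by apply: eq_cont_on (cont_onM IH cP) => x _; rewrite exprSr mulrA.
have lo n x : 0 <= x <= 1 -> - K <= d x * P x ^+ n.
  move=> x01'; have [xt|xt] := leP `|x - x0| t.
    rewrite (@le_trans _ _ 0)// ?oppr_le0// mulr_ge0//.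
      by rewrite (le_trans _ (d_in x x01' xt))// ltW.
    by rewrite exprn_ge0// (le_trans ler01)// P_in.
  have : `|d x * P x ^+ n| <= K.
    rewrite normrM normrX; apply: le_trans (_ : K * 1 <= K); last by rewrite mulr1.
    by apply: ler_pM; rewrite ?exprn_ge0 ?dK// exprn_ile1// P_out.
  by rewrite ler_norml => /andP[].
have hi n x : x0 - t / 2 <= x <= x0 + t / 2 -> d x0 / 2 * (1 + c) ^+ n <= d x * P x ^+ n.
  move=> /andP[xl xr]; have xt : `|x - x0| <= t / 2.
    by rewrite ler_norml; apply/andP; split; lra.
  have xt' : `|x - x0| <= t by apply: le_trans xt _; lra.
  have x01' : 0 <= x <= 1 by apply/andP; split; lra.
  apply: ler_pM; [exact: ltW|by rewrite exprn_ge0// addr_ge0// ltW|exact: d_in|].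
  by apply: lerXn2r; rewrite ?nnegrE ?P_half//;
    [rewrite addr_ge0// ltW|rewrite (le_trans ler01)// P_in].
(* The integral of d P^n over [0,1] vanishes. The centre, of width t, contributes at least the
   left-hand side; the rest, of length 1 - t, contributes at least -K per unit of length. *)
have bound n : d x0 / 2 * (1 + c) ^+ n * t <= K.
  have := (@itg_trig_poly d A B C n cd dc ds 0).1.
  rewrite (@eq_itg _ _ _ _ (fun x => d x * P x ^+ n)); last first.
    by move=> x _; rewrite lam0 mul0r cos0 mulr1.
  rewrite (@itg_split R 0 (x0 - t / 2) 1)//; [|lra|lra].
  rewrite (@itg_split R (x0 - t / 2) (x0 + t / 2) 1); [|lra|lra|]; last first.
    by apply: sub_intb (idP n) => //; lra.
  have sub a b : 0 <= a -> b <= 1 -> intb a b (fun x => d x * P x ^+ n).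
    by move=> a0' b1; apply: sub_intb (idP n).
  have cstK a b z : intb a b (fun=> z) by apply: cont_on_intb; exact: cont_on_cst.
  have I1 : - K * (x0 - t / 2) <= itg 0 (x0 - t / 2) (fun x => d x * P x ^+ n).
    rewrite -{1}(subr0 (x0 - t / 2)) -itg_cst; last by lra.
    apply: le_itg => //; first by apply: sub; lra.
    by move=> x /andP[? ?]; apply: lo; apply/andP; split; lra.
  have I3 : - K * (1 - (x0 + t / 2)) <= itg (x0 + t / 2) 1 (fun x => d x * P x ^+ n).
    rewrite -itg_cst; last by lra.
    apply: le_itg => //; first by apply: sub; lra.
    by move=> x /andP[? ?]; apply: lo; apply/andP; split; lra.
  have I2 : d x0 / 2 * (1 + c) ^+ n * t <=
      itg (x0 - t / 2) (x0 + t / 2) (fun x => d x * P x ^+ n).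
    rewrite [X in _ * X <= _](_ : t = x0 + t / 2 - (x0 - t / 2)); last by field.
    rewrite -itg_cst; last by lra.
    apply: le_itg => //; first by apply: sub; lra.
    by move=> x xx; apply: hi.
  move: I1 I2 I3; nra.
have q0 : 0 < d x0 / 2 * t * c by rewrite !mulr_gt0.
(* By Bernoulli's inequality (1 + c)^n >= 1 + n c, and this n makes n c alone large enough to
   contradict [bound]. *)
pose n := (Num.truncn (K / (d x0 / 2 * t * c))).+1.
have nK : K < n%:R * (d x0 / 2 * t * c).
  by rewrite -ltr_pdivrMr// truncnS_gt.
have := bound n; have := @bernoulli_ge c n (ltW c0).
have w0 : 0 < d x0 / 2 * t by rewrite mulr_gt0.
move: nK w0; move: (d x0 / 2) => u; move: (n%:R : R) ((1 + c) ^+ n) => m z.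
move=> nK w0 bz bK; have : u * t * (1 + m * c) <= u * t * z by rewrite ler_pM2l.
lra.
Qed.

(** The one-sided statement is applied to d and to -d; the two end points follow by continuity. *)
Lemma trig_complete d : cont_on 0 1 d ->
  (forall k, itg 0 1 (fun x => d x * cos (lam R k * x)) = 0) ->
  (forall k, itg 0 1 (fun x => d x * sin (lam R k * x)) = 0) ->
  forall x, 0 <= x <= 1 -> d x = 0.
Proof.
move=> cd dc ds.
have ii (g : R -> R) : cont_on 0 1 g -> intb 0 1 (fun x => d x * g x).
  by move=> cg; apply: cont_on_intb; exact: cont_onM.
have Nd (g : R -> R) : cont_on 0 1 g -> itg 0 1 (fun x => d x * g x) = 0 ->
    itg 0 1 (fun x => - d x * g x) = 0.
  move=> cg E; rewrite (@eq_itg _ _ _ _ (fun x => - (d x * g x))); last by move=> x _; ring.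
  by rewrite itgN ?E ?oppr0//; exact: ii.
have din x : 0 < x < 1 -> d x = 0.
  move=> x01; apply/eqP; rewrite eq_le; apply/andP; split.
    exact: trig_complete_interior x01.
  rewrite -oppr_le0; apply: (@trig_complete_interior (fun x => - d x)) x01.
  - exact: cont_onN.
  - by move=> k; apply: Nd => //; exact: cont_on_cosZ.
  - by move=> k; apply: Nd => //; exact: cont_on_sinZ.
move=> x x01; apply/eqP; rewrite -normr_le0; apply/ler_addgt0Pl => e e0.
have [r r0 Hr] := (cont_onP _ _ _).1 cd x x01 e e0.
pose m := Num.min (r / 2) (1 / 4).
have m0 : 0 < m by rewrite lt_min !divr_gt0.
have mr : m < r.
  by rewrite (le_lt_trans (_ : m <= r / 2))// ?ge_min ?lexx// ltr_pdivrMr// ltr_pMr// ltr1n.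
have m4 : m <= 1 / 4 by rewrite !ge_min lexx orbT.
have [y y01 yx] : exists2 y, 0 < y < 1 & `|y - x| = m.
  move: x01 => /andP[? ?]; have [x2|x2] := leP x (1 / 2).
    exists (x + m); first by apply/andP; split; lra.
    by rewrite addrAC subrr add0r gtr0_norm.
  exists (x - m); first by apply/andP; split; lra.
  by rewrite addrAC subrr add0r normrN gtr0_norm.
rewrite addr0; have := Hr y; rewrite yx din// sub0r normrN; apply => //.
by move: y01 => /andP[? ?]; rewrite !ltW.
Qed.

End Completeness.

(** * Oscillators with nonlocal conditions *)

(* z stands for y': this is y'' + l^2 y = F with two nonlocal conditions. *)
Definition mode_eq (R : realType) (T l d1 d2 : R) (F : R -> R) (ph ps : R)
    (y z : R -> R) : Prop :=
  [/\ deriv_on 0 T y z, deriv_on 0 T z (fun t => F t - l ^+ 2 * y t),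
      y 0 + d1 * y T = ph & z 0 + d2 * z T = ps].

Section LinearMode.
Variables (R : realType) (T l d1 d2 : R).
Hypotheses (T0 : 0 < T) (l0 : 0 < l) (d10 : 0 <= d1) (d20 : 0 <= d2).
Hypothesis (d12 : d1 + d2 < 1 + d1 * d2).
Implicit Types (t : R) (F G J y z : R -> R).

(** Determinant of the two nonlocal conditions, as a linear system in y(0) and y'(0), for the free
    oscillator of frequency l. *)
Let detT := 1 + (d1 + d2) * cos (l * T) + d1 * d2.

Lemma rho_gt0 : 0 < rho d1 d2.
Proof. by rewrite /rho divr_gt0//; move: d12; lra. Qed.

Lemma Mc_ge1 : 1 <= Mc d1 d2.
Proof.
have r0 := ltW rho_gt0; rewrite /Mc lerDl mulr_ge0//; first exact: mulr_ge0.
by rewrite !addr_ge0// mulr_ge0.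
Qed.

(** The worst case is cos(l T) = -1; this is where the constant [rho] comes from. *)
Let detT_ge : (rho d1 d2)^-1 <= detT.
Proof.
rewrite /rho invf_div divr1 /detT.
have := cos_geN1 (l * T); move: (cos _) d10 d20 => C; nra.
Qed.

Let rhoV_gt0 : 0 < (rho d1 d2)^-1.
Proof. by rewrite invr_gt0 rho_gt0. Qed.

Let detT_gt0 : 0 < detT.
Proof. exact: lt_le_trans detT_ge. Qed.

Let sc t : sin (l * t) ^+ 2 = 1 - cos (l * t) ^+ 2.
Proof. exact: sin2cos2. Qed.

(** Variation of constants: A and B are the integrals of F against cos and sin, and a free
    oscillation is added to meet the nonlocal conditions. *)
Lemma mode_exists F ph ps : cont_on 0 T F ->
  exists y z, mode_eq T l d1 d2 F ph ps y z.
Proof.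
move=> cF.
pose A t := itg 0 t (fun s => cos (l * s) * F s).
pose B t := itg 0 t (fun s => sin (l * s) * F s).
have dA : deriv_on 0 T A (fun s => cos (l * s) * F s).
  by apply: deriv_on_itg; apply: cont_onM => //; exact: cont_on_cosZ.
have dB : deriv_on 0 T B (fun s => sin (l * s) * F s).
  by apply: deriv_on_itg; apply: cont_onM => //; exact: cont_on_sinZ.
have A0 : A 0 = 0 by rewrite /A itg_point.
have B0 : B 0 = 0 by rewrite /B itg_point.
have dc := @deriv_on_cosZ R 0 T l; have ds := @deriv_on_sinZ R 0 T l.
pose C := cos (l * T); pose S := sin (l * T).
pose P := l^-1 * (S * A T - C * B T); pose P1 := C * A T + S * B T.
(* Cramer's rule for y(0) = e and y'(0) = g. P and P1 are the values at T of the particular solution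
   and of its derivative. *)
pose e := ((ph - d1 * P) * (1 + d2 * C) - (ps - d2 * P1) * d1 * S / l) / detT.
pose g := ((ps - d2 * P1) * (1 + d1 * C) + (ph - d1 * P) * d2 * l * S) / detT.
have ln0 : l != 0 by rewrite gt_eqF.
have dn0 : detT != 0 by rewrite gt_eqF.
exists (fun t => l^-1 * (sin (l * t) * A t - cos (l * t) * B t) +
                 (e * cos (l * t) + g / l * sin (l * t))).
exists (fun t => cos (l * t) * A t + sin (l * t) * B t +
                 (g * cos (l * t) - e * l * sin (l * t))).
split.
- apply: (eq_deriv_on _ _ (deriv_onD (deriv_onZ l^-1 (deriv_onB (deriv_onM ds dA)
    (deriv_onM dc dB))) (deriv_onD (deriv_onZ e dc) (deriv_onZ (g / l) ds)))) => // t _.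
  by field.
- apply: (eq_deriv_on _ _ (deriv_onD (deriv_onD (deriv_onM dc dA) (deriv_onM ds dB))
    (deriv_onB (deriv_onZ g dc) (deriv_onZ (e * l) ds)))) => // t _.
  have E := sc t; move: E; move: (sin _) (cos _) (A t) (B t) (F t) => s c a b f E.
  transitivity (l * (c * b - s * a) - l * (g * s + e * l * c) + f * (c ^+ 2 + s ^+ 2)).
    by ring.
  by rewrite E; field.
- rewrite !mulr0 sin0 cos0 A0 B0 -/C -/S !mul0r !mulr0 subrr mulr0 add0r mulr1 addr0 -/P.
  have E := sc T; rewrite -/C -/S in E.
  rewrite (_ : e + d1 * (P + (e * C + g / l * S)) =
    e * (1 + d1 * C) + g * (d1 * S / l) + d1 * P); last by ring.
  rewrite /e /g; apply: (mulIf dn0).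
  rewrite (_ : (_ + _) * detT = (ph - d1 * P) * (1 + (d1 + d2) * C + d1 * d2 * (C ^+ 2 + S ^+ 2))
     + d1 * P * detT); last by field; rewrite ln0 dn0.
  by rewrite E /detT -/C; ring.
- rewrite !mulr0 sin0 cos0 A0 B0 -/C -/S !mul0r !mulr0 subr0 addr0 add0r mulr1 -/P1.
  have E := sc T; rewrite -/C -/S in E.
  rewrite (_ : g + d2 * (P1 + (g * C - e * l * S)) =
    g * (1 + d2 * C) - e * (d2 * l * S) + d2 * P1); last by ring.
  rewrite /e /g; apply: (mulIf dn0).
  rewrite (_ : (_ + _) * detT = (ps - d2 * P1) * (1 + (d1 + d2) * C + d1 * d2 * (C ^+ 2 + S ^+ 2))
     + d2 * P1 * detT); last by field; rewrite ln0 dn0.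
  by rewrite E /detT -/C; ring.
Qed.

Lemma deriv_on_affine_comp (w : R -> R) (w' : R -> R) t :
  (forall x : R, is_derive x (1 : R) w (w' x)) ->
  deriv_on 0 T (fun s => w (l * (t - s))) (fun s => - l * w' (l * (t - s))).
Proof.
move=> dw; apply: is_derive_deriv_on => x.
have H : is_derive x (1 : R) (fun s : R => l * (t - s)) (- l).
  by apply: is_derive_eq; rewrite /GRing.scale/=; ring.
rewrite mulrC.
exact: (@is_derive1_comp R w (fun s : R => l * (t - s)) x _ _ (dw _) H).
Qed.

(** The solution is a free evolution plus a Duhamel term of size at most I / l. The nonlocal
    conditions bound the free part by the data and by the Duhamel terms at T, which adds rho (d1 +
    d2 + 2 d1 d2) I / l; the constant [Mc] exceeds the resulting total by rho (d1 + d2). *)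
Lemma mode_bound F G J ph ps y z : mode_eq T l d1 d2 F ph ps y z ->
  deriv_on 0 T J G -> (forall t, 0 <= t <= T -> `|F t| <= G t) ->
  forall t, 0 <= t <= T ->
  `|y t| <= rho d1 d2 * (1 + d2) * `|ph| + rho d1 d2 * (1 + d1) * `|ps| / l
            + Mc d1 d2 / l * (J T - J 0).
Proof.
move=> [dy dz yph zps] dJ FG t tT; set I := J T - J 0.
have ln0 : l != 0 by rewrite gt_eqF.
have T00 : 0 <= T by exact: ltW.
have GJ u : 0 <= u <= T -> J u - J 0 <= I.
  move=> /andP[u0 uT]; rewrite lerB//.
  apply: (deriv_on_increasing dJ) => // x xT.
  exact: le_trans (normr_ge0 _) (FG x xT).
(* Duhamel's formula: Z(u) = y(u) and Z(0) is the free evolution. *)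
have duh u : 0 <= u <= T ->
    `|y u - (y 0 * cos (l * u) + z 0 / l * sin (l * u))| <= I / l /\
    `|z u - (- l * y 0 * sin (l * u) + z 0 * cos (l * u))| <= I.
  move=> /andP[u0 uT].
  have dc := @deriv_on_affine_comp cos (fun x => - sin x) u _.
  have ds := @deriv_on_affine_comp sin cos u _.
  have {}dc := dc (fun x => is_derive_cos x); have {}ds := ds (fun x => is_derive_sin x).
  have dZ : deriv_on 0 T (fun s => y s * cos (l * (u - s)) + l^-1 * (z s * sin (l * (u - s))))
      (fun s => l^-1 * (F s * sin (l * (u - s)))).
    apply: (eq_deriv_on _ _ (deriv_onD (deriv_onM dy dc)
      (deriv_onZ l^-1 (deriv_onM dz ds)))) => // s _.
    by field.
  have dW : deriv_on 0 T (fun s => - l * (y s * sin (l * (u - s))) + z s * cos (l * (u - s)))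
      (fun s => F s * cos (l * (u - s))).
    apply: (eq_deriv_on _ _ (deriv_onD (deriv_onZ (- l) (deriv_onM dy ds))
      (deriv_onM dz dc))) => // s _.
    by ring.
  split.
    have := deriv_on_dominated dZ (deriv_onZ l^-1 dJ) _ (lexx _) u0 uT.
    rewrite subrr subr0 !mulr0 sin0 cos0 mulr0 mulr0 mulr1 addr0.
    rewrite (_ : l^-1 * (z 0 * sin (l * u)) = z 0 / l * sin (l * u)); last by ring.
    move=> H; apply: le_trans (H _) _.
      move=> s sT; rewrite normrM ger0_norm ?invr_ge0 ?(ltW l0)//.
      rewrite ler_pM2l ?invr_gt0// normrM (le_trans _ (FG s sT))//.
      by rewrite ler_piMr// sin_max.
    by rewrite -mulrBr mulrC ler_pM2r ?invr_gt0// GJ// u0.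
  have := deriv_on_dominated dW dJ _ (lexx _) u0 uT.
  rewrite subrr subr0 !mulr0 sin0 cos0 mulr0 mulr0 mulr1 add0r mulrA.
  move=> H; apply: le_trans (H _) _; last by rewrite GJ// u0.
  move=> s sT; rewrite normrM (le_trans _ (FG s sT))//.
  by rewrite ler_piMr// cos_le1_norm.
have TT : 0 <= T <= T by rewrite T00 lexx.
have [aT bT] := duh T TT; have [at_ _] := duh t tT.
set C := cos (l * T) in aT bT; set S := sin (l * T) in aT bT.
set c := cos (l * t) in at_; set s := sin (l * t) in at_.
set al := y T - _ in aT; set be := z T - _ in bT.
have E := sc T; rewrite -/C -/S in E.
(* Cramer's rule evaluated at time t: the addition formulas collapse the cofactors to c + d2 cos(l
   (T - t)) and s - d1 sin(l (T - t)), whence the factors 1 + d2 and 1 + d1. *)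
have key : detT * (y 0 * c + z 0 / l * s) =
   (ph - d1 * al) * (c + d2 * cos (l * (T - t))) +
   (ps - d2 * be) / l * (s - d1 * sin (l * (T - t))).
  rewrite (mulrBr l T t) cosB sinB -/C -/S -/c -/s -yph -zps /al /be /detT -/C.
  have -> : d1 * d2 = d1 * d2 * (C ^+ 2 + S ^+ 2) by rewrite E; ring.
  by field.
have I0 : 0 <= I by apply: le_trans bT.
have n1 : `|c + d2 * cos (l * (T - t))| <= 1 + d2.
  apply: le_trans (ler_normD _ _) _; apply: lerD; first exact: cos_le1_norm.
  by rewrite normrM (ger0_norm d20) ler_piMr// cos_le1_norm.
have n2 : `|s - d1 * sin (l * (T - t))| <= 1 + d1.
  apply: le_trans (ler_normB _ _) _; apply: lerD; first exact: sin_max.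
  by rewrite normrM (ger0_norm d10) ler_piMr// sin_max.
have n3 : `|ph - d1 * al| <= `|ph| + d1 * (I / l).
  apply: le_trans (ler_normB _ _) _; rewrite lerD2l normrM (ger0_norm d10).
  exact: ler_wpM2l.
have n4 : `|(ps - d2 * be) / l| <= (`|ps| + d2 * I) / l.
  rewrite normrM normfV (gtr0_norm l0) ler_pM2r ?invr_gt0//.
  apply: le_trans (ler_normB _ _) _; rewrite lerD2l normrM (ger0_norm d20).
  exact: ler_wpM2l.
have K : `|y 0 * c + z 0 / l * s| <= rho d1 d2 *
    ((`|ph| + d1 * (I / l)) * (1 + d2) + (`|ps| + d2 * I) / l * (1 + d1)).
  have r0 := rho_gt0.
  rewrite -(ler_pM2l rhoV_gt0) mulKf ?gt_eqF//.
  apply: le_trans (_ : detT * `|y 0 * c + z 0 / l * s| <= _).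
    by rewrite ler_wpM2r.
  rewrite -{1}(gtr0_norm detT_gt0) -normrM key.
  apply: le_trans (ler_normD _ _) _.
  by rewrite !normrM -[`|_| * `|l^-1|]normrM; apply: lerD; apply: ler_pM.
have r0 := rho_gt0.
have -> : y t = (y t - (y 0 * c + z 0 / l * s)) + (y 0 * c + z 0 / l * s) by ring.
apply: le_trans (ler_normD _ _) _; apply: le_trans (lerD at_ K) _.
rewrite /Mc; have il0 : 0 <= I / l by rewrite divr_ge0// ltW.
have il1 : 0 <= rho d1 d2 * (I / l) * (d1 + d2).
  by apply: mulr_ge0; [apply: mulr_ge0 => //; exact: ltW|exact: addr_ge0].
rewrite -subr_ge0 (_ : _ - _ = rho d1 d2 * (I / l) * (d1 + d2))//.
by field.
Qed.

End LinearMode.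

(** * Banach's fixed point theorem for continuous functions on [0,T] *)

Section Contraction.
Variable R : realType.
Implicit Types (t D e : R) (g h : R -> R).

Lemma exprn_small (q K e : R) : 0 <= q -> q < 1 -> 0 <= K -> 0 < e ->
  exists n, K * q ^+ n <= e.
Proof.
move=> q0 q1 K0 e0.
have nq : `|q| < 1 by rewrite ger0_norm.
have K1 : 0 < K + 1 by rewrite ltr_wpDl.
have e1 : 0 < e / (K + 1) by rewrite divr_gt0.
have /cvgrPdist_le/(_ _ e1)[N _ HN] := cvg_expr nq.
exists N; have := HN N (leqnn _); rewrite sub0r normrN ger0_norm ?exprn_ge0//.
rewrite ler_pdivlMr// mulrDr mulr1 mulrC => H; apply: le_trans H.
by rewrite lerDl exprn_ge0.
Qed.

(** Picard iteration from 0, with uniform estimates on [0,T] in place of a complete metric space.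
    Functions are total, so the fixed point equation is asserted on [0,T] only. *)
Lemma contraction_cont T (Phi : (R -> R) -> R -> R) (r q : R) : 0 <= r ->
  0 <= q -> q < 1 ->
  (forall g, cont_on 0 T g -> (forall t, 0 <= t <= T -> `|g t| <= r) ->
     cont_on 0 T (Phi g) /\ (forall t, 0 <= t <= T -> `|Phi g t| <= r)) ->
  (forall g h D, cont_on 0 T g -> (forall t, 0 <= t <= T -> `|g t| <= r) ->
     cont_on 0 T h -> (forall t, 0 <= t <= T -> `|h t| <= r) -> 0 <= D ->
     (forall t, 0 <= t <= T -> `|g t - h t| <= D) ->
     forall t, 0 <= t <= T -> `|Phi g t - Phi h t| <= q * D) ->
  exists g, [/\ cont_on 0 T g, (forall t, 0 <= t <= T -> `|g t| <= r) &
     forall t, 0 <= t <= T -> Phi g t = g t].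
Proof.
move=> r0 q0 q1 PhiK PhiL.
pose u n := iter n Phi (fun=> 0).
have uK n : cont_on 0 T (u n) /\ (forall t, 0 <= t <= T -> `|u n t| <= r).
  elim: n => [|n [IH1 IH2]]; last exact: PhiK.
  by split=> [|t _]; [exact: cont_on_cst|rewrite normr0].
have uB n k t : 0 <= t <= T -> `|u (n + k)%N t - u n t| <= r * q ^+ n.
  elim: n t => [|n IH] t tT.
    by rewrite add0n expr0 mulr1 /u subr0; exact: (uK k).2.
  have [c1 b1] := uK (n + k)%N; have [c2 b2] := uK n.
  rewrite addSn /u 2!iterS -/(u _) -/(u _) exprS mulrCA.
  apply: PhiL => //; exact: mulr_ge0 (exprn_ge0 _ _).
have [g ug] : exists g, ucvg [set t | 0 <= t <= T] u g.
  apply: ucauchy_ucvg => e e0.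
  have e2 : 0 < e / 2 by rewrite divr_gt0.
  have [N HN] := exprn_small q0 q1 r0 e2.
  exists N => m n Nm Nn t tT.
  have := uB N (m - N)%N t tT; have := uB N (n - N)%N t tT.
  rewrite !subnKC// !ler_norml => /andP[? ?] /andP[? ?].
  by apply/andP; split; lra.
have cg : cont_on 0 T g by apply: cont_on_unif ug => n; exact: (uK n).1.
have gr t : 0 <= t <= T -> `|g t| <= r.
  move=> tT; rewrite -(subr0 (g t)); apply: (@le_lim_bound R (u^~ t) _ 0 r 0).
    by move=> e e0; have [N HN] := ug e e0; exists N => n Nn; exact: HN.
  by move=> n _; rewrite subr0; exact: (uK n).2.
exists g; split => // t tT; apply/eqP; rewrite -subr_eq0 -normr_le0.
apply/ler_addgt0Pl => e e0; rewrite addr0.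
have e2 : 0 < e / 2 by rewrite divr_gt0.
have [N HN] := ug _ e2.
have H1 : `|Phi g t - Phi (u N) t| <= q * (e / 2).
  apply: PhiL => //; [exact: (uK N).1|exact: (uK N).2|exact: ltW|].
  by move=> s sT; rewrite distrC; exact: HN.
have H2 : `|u N.+1 t - g t| <= e / 2 by apply: HN.
have -> : Phi g t - g t = (Phi g t - Phi (u N) t) + (u N.+1 t - g t).
  by rewrite /u iterS -/(u N); ring.
apply: le_trans (ler_normD _ _) _; apply: le_trans (lerD H1 H2) _; nra.
Qed.

End Contraction.

(** * Oscillators with a small potential *)

Section PotentialMode.
Variables (R : realType) (T l d1 d2 : R).
Hypotheses (T0 : 0 < T) (l0 : 0 < l) (d10 : 0 <= d1) (d20 : 0 <= d2).
Hypothesis (d12 : d1 + d2 < 1 + d1 * d2).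
Variables (a : R -> R) (r : R).
Hypotheses (ca : cont_on 0 T a) (ar : forall t, 0 <= t <= T -> `|a t| <= r).
Hypothesis (small : Mc d1 d2 * T * r / l <= 1 / 16).
Implicit Types (t : R) (F G J y z : R -> R).

Let r0 : 0 <= r.
Proof. by apply: le_trans (ar (_ : 0 <= 0 <= T)) => //; rewrite lexx ltW. Qed.

(** The source is split because its parts are measured differently: a y in the sup norm, at a cost
    of M T / l, and the data through a primitive of a majorant. *)
Lemma mode_bound_add F1 F2 G J (s ph ps : R) y z :
  mode_eq T l d1 d2 (fun t => F1 t + F2 t) ph ps y z ->
  (forall t, 0 <= t <= T -> `|F1 t| <= s) ->
  deriv_on 0 T J G -> (forall t, 0 <= t <= T -> `|F2 t| <= G t) ->
  forall t, 0 <= t <= T ->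
  `|y t| <= rho d1 d2 * (1 + d2) * `|ph| + rho d1 d2 * (1 + d1) * `|ps| / l
            + Mc d1 d2 / l * (J T - J 0) + Mc d1 d2 * T / l * s.
Proof.
move=> my F1s dJ F2G t tT.
have dJs : deriv_on 0 T (fun t => s * t + J t) (fun t => s + G t).
  apply: (eq_deriv_on _ _ (deriv_onD (deriv_onZ s (@deriv_on_id R 0 T)) dJ)) => // u _.
  by rewrite mulr1.
apply: le_trans (mode_bound T0 l0 d10 d20 d12 my dJs _ tT) _.
  move=> u uT; apply: le_trans (ler_normD _ _) _; apply: lerD; [exact: F1s|exact: F2G].
by rewrite le_eqVlt; apply/orP; left; apply/eqP; field; rewrite gt_eqF.
Qed.

(** At a point where |y| is maximal, a y is treated as a source: max |y| <= D + max |y| / 16. The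
    nonlocal conditions couple t = 0 with t = T, so the term is absorbed over the whole interval
    rather than by Gronwall's lemma. *)
Lemma potential_bound F G J (ph ps D : R) y z :
  mode_eq T l d1 d2 (fun t => a t * y t + F t) ph ps y z ->
  deriv_on 0 T J G -> (forall t, 0 <= t <= T -> `|F t| <= G t) ->
  rho d1 d2 * (1 + d2) * `|ph| + rho d1 d2 * (1 + d1) * `|ps| / l
            + Mc d1 d2 / l * (J T - J 0) <= D ->
  forall t, 0 <= t <= T -> `|y t| <= 16 / 15 * D.
Proof.
move=> my dJ FG hD.
have [dy _ _ _] := my.
have [c cT ymax] := cont_on_max (ltW T0) (cont_on_norm (deriv_on_cont dy)).
have B := mode_bound_add my (_ : forall t, 0 <= t <= T -> _ <= r * `|y c|) dJ FG.
have {}B := B _ c cT.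
have {}B : `|y c| <= D + Mc d1 d2 * T / l * (r * `|y c|).
  apply: le_trans (B _) _; last by rewrite lerD2r.
  by move=> t tT; rewrite normrM; apply: ler_pM => //; [exact: ar|exact: ymax].
have K : Mc d1 d2 * T / l * (r * `|y c|) <= 1 / 16 * `|y c|.
  rewrite (_ : _ * (r * _) = Mc d1 d2 * T * r / l * `|y c|); last by ring.
  by rewrite ler_wpM2r.
move=> t tT; apply: le_trans (ymax t tT) _.
by move: B K; move: (`|y c|) (Mc _ _ * _ / _ * _) => Y X; lra.
Qed.

(** Fixed point of g |-> solution with source a g + F. The radius satisfies D + (16/15 D) / 16 =
    16/15 D. The solution map S is merely chosen; its Lipschitz constant 1/16 comes from the fact
    that the difference of two outputs solves a mode equation with zero data. *)
Lemma potential_exists F G J (ph ps : R) : cont_on 0 T F ->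
  deriv_on 0 T J G -> (forall t, 0 <= t <= T -> `|F t| <= G t) ->
  exists y z, mode_eq T l d1 d2 (fun t => a t * y t + F t) ph ps y z.
Proof.
move=> cF dJ FG.
have H g : exists yz : (R -> R) * (R -> R), cont_on 0 T g ->
    mode_eq T l d1 d2 (fun t => a t * g t + F t) ph ps yz.1 yz.2.
  have [cg|ncg] := pselect (cont_on 0 T g); last by exists (fun=> 0, fun=> 0).
  have [|y [z yz]] := @mode_exists R T l d1 d2 l0 d10 d20 d12 (fun t => a t * g t + F t) ph ps.
    by apply: cont_onD => //; exact: cont_onM.
  by exists (y, z).
have [S HS] := choice H.
set D := rho d1 d2 * (1 + d2) * `|ph| + rho d1 d2 * (1 + d1) * `|ps| / l
            + Mc d1 d2 / l * (J T - J 0).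
have rho0 := rho_gt0 d12; have M1 := Mc_ge1 d10 d20 d12.
have M0 : 0 <= Mc d1 d2 by apply: le_trans M1.
have D0 : 0 <= D.
  have J0 : 0 <= J T - J 0.
    rewrite subr_ge0; apply: (deriv_on_increasing dJ) => //; last exact: ltW.
    by move=> t tT; apply: le_trans (FG t tT).
  have p2 : 0 <= 1 + d2 by exact: addr_ge0.
  have p1 : 0 <= 1 + d1 by exact: addr_ge0.
  have li : 0 <= l^-1 by rewrite invr_ge0 ltW.
  have rh := ltW rho0.
  apply: addr_ge0; first apply: addr_ge0.
  - by apply: mulr_ge0 => //; exact: mulr_ge0.
  - by do 2 (apply: mulr_ge0 => //); exact: mulr_ge0.
  - by apply: mulr_ge0 => //; exact: mulr_ge0.
have [g [cg gr Eg]] : exists g, [/\ cont_on 0 T g,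
    (forall t, 0 <= t <= T -> `|g t| <= 16 / 15 * D) &
     forall t, 0 <= t <= T -> (S g).1 t = g t].
  apply: (@contraction_cont R T (fun g => (S g).1) (16 / 15 * D) (1 / 16)) => //.
  - by apply: mulr_ge0.
  - by lra.
  - move=> g cg gr; have mg := HS g cg; have [dy _ _ _] := mg.
    split; first exact: deriv_on_cont dy.
    move=> t tT; apply: le_trans (mode_bound_add (s := r * (16 / 15 * D)) mg _ dJ FG tT) _.
      by move=> u uT; rewrite normrM; apply: ler_pM => //; [exact: ar|exact: gr].
    rewrite -/D (_ : Mc d1 d2 * T / l * _ = Mc d1 d2 * T * r / l * (16 / 15 * D)); last by ring.
    have : Mc d1 d2 * T * r / l * (16 / 15 * D) <= 1 / 16 * (16 / 15 * D).
      by rewrite ler_wpM2r// mulr_ge0.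
    by move: (_ / l * _) => X; lra.
  - move=> g h E cg gr ch hr E0 gh t tT.
    have [dg dg2 g3 g4] := HS g cg; have [dh dh2 h3 h4] := HS h ch.
    have md : mode_eq T l d1 d2 (fun t => a t * (g t - h t) + 0) 0 0
       (fun t => (S g).1 t - (S h).1 t) (fun t => (S g).2 t - (S h).2 t).
      split; first exact: deriv_onB.
      - by apply: (eq_deriv_on _ _ (deriv_onB dg2 dh2)) => // u _; ring.
      - by rewrite -[RHS](subrr ph) -{1}g3 -h3; ring.
      - by rewrite -[RHS](subrr ps) -{1}g4 -h4; ring.
    have dz := @deriv_on_cst R 0 T 0.
    apply: le_trans (mode_bound_add (s := r * E) md _ dz _ tT) _.
    + by move=> u uT; rewrite normrM; apply: ler_pM => //; [exact: ar|exact: gh].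
    + by move=> u _; rewrite normr0.
    + rewrite normr0 subrr !mulr0 mul0r !add0r.
      rewrite (_ : _ * (r * E) = Mc d1 d2 * T * r / l * E); last by ring.
      by rewrite ler_wpM2r.
have [dy dz yp zp] := HS g cg.
exists (S g).1, (S g).2; split => //.
by apply: (eq_deriv_on _ _ dz) => // t tT; rewrite Eg.
Qed.

End PotentialMode.

(** The difference y1 - y2 solves a mode equation with potential a, source (a - b) y2 and zero data.
    With a = b this gives uniqueness. *)
Lemma potential_lipschitz (R : realType) (T l d1 d2 : R) (a b F : R -> R) (r ph ps D Z : R)
    (y1 z1 y2 z2 : R -> R) : 0 < T -> 0 < l -> 0 <= d1 -> 0 <= d2 ->
  d1 + d2 < 1 + d1 * d2 ->
  (forall t, 0 <= t <= T -> `|a t| <= r) -> Mc d1 d2 * T * r / l <= 1 / 16 ->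
  mode_eq T l d1 d2 (fun t => a t * y1 t + F t) ph ps y1 z1 ->
  mode_eq T l d1 d2 (fun t => b t * y2 t + F t) ph ps y2 z2 ->
  (forall t, 0 <= t <= T -> `|a t - b t| <= D) ->
  (forall t, 0 <= t <= T -> `|y2 t| <= Z) ->
  forall t, 0 <= t <= T -> `|y1 t - y2 t| <= 16 / 15 * (Mc d1 d2 * T / l * (D * Z)).
Proof.
move=> T0 l0 d10 d20 d12 ar small [dy1 dz1 y1p z1p] [dy2 dz2 y2p z2p] abD y2Z.
have md : mode_eq T l d1 d2 (fun t => a t * (y1 t - y2 t) + (a t - b t) * y2 t) 0 0
     (fun t => y1 t - y2 t) (fun t => z1 t - z2 t).
  split; first exact: deriv_onB.
  - by apply: (eq_deriv_on _ _ (deriv_onB dz1 dz2)) => // u _; ring.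
  - by rewrite -[RHS](subrr ph) -{1}y1p -y2p; ring.
  - by rewrite -[RHS](subrr ps) -{1}z1p -z2p; ring.
apply: (potential_bound T0 l0 d10 d20 d12 ar small md
  (deriv_onZ (D * Z) (@deriv_on_id R 0 T))).
  move=> t tT; rewrite mulr1 normrM; apply: ler_pM => //; [exact: abD|exact: y2Z].
rewrite normr0 !mulr0 mul0r !add0r le_eqVlt; apply/orP; left; apply/eqP.
by field; rewrite gt_eqF.
Qed.

(** * Decay of the coefficients *)

Section FourierDecay.
Variable R : realType.
Implicit Types (x y t l : R) (g h : R -> R).

Lemma AC_cosZ l : @AC R (fun x => cos (l * x)) (fun x => - l * sin (l * x)).
Proof.
apply: deriv_on_AC; first exact: deriv_on_cosZ.
by apply: cont_onZ; exact: cont_on_sinZ.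
Qed.

Lemma AC_sinZ l : @AC R (fun x => sin (l * x)) (fun x => l * cos (l * x)).
Proof.
apply: deriv_on_AC; first exact: deriv_on_sinZ.
by apply: cont_onZ; exact: cont_on_cosZ.
Qed.

Lemma intb_cos g l : intb 0 1 g -> intb 0 1 (fun x => g x * cos (l * x)).
Proof.
move=> ig; apply: eq_intb (intbM_cont ig (@cont_on_cosZ R 0 1 l)) => x _.
by rewrite mulrC.
Qed.

Lemma intb_sin g l : intb 0 1 g -> intb 0 1 (fun x => g x * sin (l * x)).
Proof.
move=> ig; apply: eq_intb (intbM_cont ig (@cont_on_sinZ R 0 1 l)) => x _.
by rewrite mulrC.
Qed.

Lemma itg_cos_parts g g' k : AC g g' ->
  lam R k * itg 0 1 (fun x => g x * cos (lam R k * x)) =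
  - itg 0 1 (fun x => g' x * sin (lam R k * x)).
Proof.
move=> ACg; have [ig gE] := ACg; have ig0 := cont_on_intb (AC_cont ACg).
have := AC_itg (ACM ACg (AC_sinZ (lam R k))) (lexx 0) ler01 (lexx 1).
rewrite mulr1 mulr0 sin_lam sin0 !mulr0 subrr itgD; last 2 first.
- exact: intb_sin.
- by apply: eq_intb (intbZ (lam R k) (intb_cos (lam R k) ig0)) => x _; ring.
rewrite -itgZ; last exact: intb_cos.
rewrite (@eq_itg R 0 1 (fun x => g x * (_ * _)) (fun x => lam R k * (g x * cos (lam R k * x)))).
  by lra.
by move=> x _; ring.
Qed.

(** Unlike in [itg_cos_parts], where the sine vanishes at 0 and 1, the cosine equals 1 at both ends.
    The boundary term g 1 - g 0 survives, and it is here that the boundary conditions on the data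
    are consumed. *)
Lemma itg_sin_parts g g' k : AC g g' -> 
  lam R k * itg 0 1 (fun x => g x * sin (lam R k * x)) =
  itg 0 1 (fun x => g' x * cos (lam R k * x)) - (g 1 - g 0).
Proof.
move=> ACg; have [ig gE] := ACg; have ig0 := cont_on_intb (AC_cont ACg).
have := AC_itg (ACM ACg (AC_cosZ (lam R k))) (lexx 0) ler01 (lexx 1).
rewrite mulr1 mulr0 cos_lam cos0 !mulr1 itgD; last 2 first.
- exact: intb_cos.
- by apply: eq_intb (intbZ (- lam R k) (intb_sin (lam R k) ig0)) => x _; ring.
rewrite (@eq_itg R 0 1 (fun x => g x * (_ * _)) (fun x => - lam R k * (g x * sin (lam R k * x)))).
  rewrite itgZ; last exact: intb_sin.
  by lra.
by move=> x _; ring.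
Qed.

Lemma itg_cos_parts2 g g1 g2 k : AC g g1 -> AC g1 g2 -> g1 0 = g1 1 ->
  lam R k ^+ 2 * itg 0 1 (fun x => g x * cos (lam R k * x)) =
  - itg 0 1 (fun x => g2 x * cos (lam R k * x)).
Proof.
move=> A1 A2 bc; rewrite expr2 -mulrA (itg_cos_parts k A1) mulrN (itg_sin_parts k A2).
by rewrite bc subrr subr0.
Qed.

Lemma itg_cos_parts3 g g1 g2 g3 k : AC g g1 -> AC g1 g2 -> AC g2 g3 -> g1 0 = g1 1 ->
  lam R k ^+ 3 * itg 0 1 (fun x => g x * cos (lam R k * x)) =
  itg 0 1 (fun x => g3 x * sin (lam R k * x)).
Proof.
move=> A1 A2 A3 bc; rewrite exprS -mulrA (itg_cos_parts2 k A1 A2 bc) mulrN.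
by rewrite (itg_cos_parts k A3) opprK.
Qed.

Lemma itg_sin_parts2 g g1 g2 k : AC g g1 -> AC g1 g2 -> g 0 = g 1 ->
  lam R k ^+ 2 * itg 0 1 (fun x => g x * sin (lam R k * x)) =
  - itg 0 1 (fun x => g2 x * sin (lam R k * x)).
Proof.
move=> A1 A2 bc; rewrite expr2 -mulrA (itg_sin_parts k A1) bc subrr subr0.
exact: itg_cos_parts.
Qed.

Lemma itg_sin_parts3 g g1 g2 g3 k : AC g g1 -> AC g1 g2 -> AC g2 g3 ->
  g 0 = g 1 -> g2 0 = g2 1 ->
  lam R k ^+ 3 * itg 0 1 (fun x => g x * sin (lam R k * x)) =
  - itg 0 1 (fun x => g3 x * cos (lam R k * x)).
Proof.
move=> A1 A2 A3 bc bc2; rewrite exprS -mulrA (itg_sin_parts2 k A1 A2 bc) mulrN.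
by rewrite (itg_sin_parts k A3) bc2 subrr subr0.
Qed.

End FourierDecay.

(* Lb x is the weight 1 - q - p x; the dual system of (X_k) is 2,
   4 cos (lam k x) and 4 Lb x sin (lam k x). *)
Definition Lb (R : realType) (beta x : R) : R := 1 - qc beta - pc beta * x.

Definition codd (R : realType) (g : R -> R) (k : nat) : R :=
  4 * itg 0 1 (fun x => g x * cos (lam R k * x)).

Definition ceven (R : realType) (beta : R) (g : R -> R) (k : nat) : R :=
  4 * itg 0 1 (fun x => Lb beta x * g x * sin (lam R k * x)).

Section Coefficients.
Variables (R : realType) (beta : R).
Hypothesis beta_neqN1 : beta <> -1.
Implicit Types (x y t l : R) (g h : R -> R).
Local Notation p := (pc beta).
Local Notation q := (qc beta).
Local Notation L := (Lb beta).

Let b1 : 1 + beta != 0.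
Proof. by apply/eqP => b; apply: beta_neqN1; move: b; lra. Qed.

Lemma p_2q : p + 2 * q = 1.
Proof. by rewrite /pc /qc; field. Qed.

Lemma Lb_refl x : L (1 - x) = p * x + q.
Proof. by rewrite /Lb; have := p_2q; lra. Qed.

(** The purpose of the weight: L 0 = 1 / (1 + beta) and L 1 = beta / (1 + beta), so L g takes equal
    values at the ends. *)
Lemma Lb_bc g : g 0 = beta * g 1 -> L 0 * g 0 = L 1 * g 1.
Proof. by rewrite /Lb /pc /qc => ->; field. Qed.

Lemma deriv_on_Lb a b : deriv_on a b L (fun=> - p).
Proof.
apply: (eq_deriv_on _ _ (deriv_onD (@deriv_on_cst R a b (1 - q))
  (deriv_onZ (- p) (@deriv_on_id R a b)))) => x _; rewrite /Lb; ring.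
Qed.

Lemma cont_on_Lb a b : cont_on a b L.
Proof. exact: deriv_on_cont (@deriv_on_Lb a b). Qed.

Lemma AC_Lb : AC L (fun=> - p).
Proof. by apply: deriv_on_AC; [exact: deriv_on_Lb|exact: cont_on_cst]. Qed.

(** L is affine with slope -p, so the Leibniz rule gives (L g)'' = L g'' - 2 p g' and (L g)''' = L
    g''' - 3 p g''. These are the combinations that appear in A_3. *)
Lemma AC_LbM g g1 : AC g g1 -> AC (fun x => L x * g x) (fun x => L x * g1 x - p * g x).
Proof.
by move=> A1; apply: (eq_AC _ _ (ACM AC_Lb A1)) => // x _; ring.
Qed.

Lemma AC_LbM2 g g1 g2 : AC g g1 -> AC g1 g2 ->
  AC (fun x => L x * g1 x - p * g x) (fun x => L x * g2 x - 2 * p * g1 x).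
Proof.
move=> A1 A2; apply: (eq_AC _ _ (ACD (AC_LbM A2) (ACZ (- p) A1))) => // x _; ring.
Qed.

Lemma AC_LbM3 g1 g2 g3 : AC g1 g2 -> AC g2 g3 ->
  AC (fun x => L x * g2 x - 2 * p * g1 x) (fun x => L x * g3 x - 3 * p * g2 x).
Proof.
move=> A1 A2; apply: (eq_AC _ _ (ACD (AC_LbM A2) (ACZ (- (2 * p)) A1))) => // x _; ring.
Qed.

(** The 8 is 4^2, from the factor 4 of the dual system, times the 1/2 of Bessel's inequality; its
    square root is the 2 sqrt 2 of the later bounds. *)
Lemma sum_sqr4 (N : nat) (u v : nat -> R) (B : R) :
  (forall k, (0 < k)%N -> u k ^+ 2 = 16 * v k ^+ 2) ->
  \sum_(1 <= k < N.+1) v k ^+ 2 <= 1 / 2 * B ->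
  \sum_(1 <= k < N.+1) u k ^+ 2 <= 8 * B.
Proof.
move=> uv vB; rewrite (@eq_big_nat _ _ _ 1 N.+1 _ (fun k => 16 * v k ^+ 2)); last first.
  by move=> k /andP[k0 _]; exact: uv.
by rewrite -mulr_sumr; lra.
Qed.

Lemma codd3_bound g g1 g2 g3 N : AC g g1 -> AC g1 g2 -> AC g2 g3 -> L2b g3 ->
  g1 0 = g1 1 ->
  \sum_(1 <= k < N.+1) (lam R k ^+ 3 * codd g k) ^+ 2 <= 8 * itg 0 1 (fun x => g3 x ^+ 2).
Proof.
move=> A1 A2 A3 Lg bc; apply: sum_sqr4 (bessel_sin N Lg) => k k0.
by rewrite -(itg_cos_parts3 k A1 A2 A3 bc) /codd; ring.
Qed.

Lemma codd2_bound g g1 g2 N : AC g g1 -> AC g1 g2 -> L2b g2 -> g1 0 = g1 1 ->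
  \sum_(1 <= k < N.+1) (lam R k ^+ 2 * codd g k) ^+ 2 <= 8 * itg 0 1 (fun x => g2 x ^+ 2).
Proof.
move=> A1 A2 Lg bc; apply: sum_sqr4 (bessel_cos N Lg) => k k0.
rewrite -[X in 16 * X]sqrrN -(itg_cos_parts2 k A1 A2 bc) /codd; ring.
Qed.

Lemma codd1_bound g g1 N : AC g g1 -> L2b g1 ->
  \sum_(1 <= k < N.+1) (lam R k * codd g k) ^+ 2 <= 8 * itg 0 1 (fun x => g1 x ^+ 2).
Proof.
move=> A1 Lg; apply: sum_sqr4 (bessel_sin N Lg) => k k0.
rewrite -[X in 16 * X]sqrrN -(itg_cos_parts k A1) /codd; ring.
Qed.

Lemma ceven3_bound g g1 g2 g3 N : AC g g1 -> AC g1 g2 -> AC g2 g3 ->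
  L2b (fun x => L x * g3 x - 3 * p * g2 x) ->
  g 0 = beta * g 1 -> g1 0 = g1 1 -> g2 0 = beta * g2 1 ->
  \sum_(1 <= k < N.+1) (lam R k ^+ 3 * ceven beta g k) ^+ 2 <=
    8 * itg 0 1 (fun x => (L x * g3 x - 3 * p * g2 x) ^+ 2).
Proof.
move=> A1 A2 A3 Lg bc bc1 bc2; apply: sum_sqr4 (bessel_cos N Lg) => k k0.
rewrite -[X in 16 * X]sqrrN.
rewrite -(itg_sin_parts3 k (AC_LbM A1) (AC_LbM2 A1 A2) (AC_LbM3 A2 A3)).
- by rewrite /ceven; ring.
- exact: Lb_bc.
- by rewrite (Lb_bc bc2) bc1.
Qed.

Lemma ceven2_bound g g1 g2 N : AC g g1 -> AC g1 g2 ->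
  L2b (fun x => L x * g2 x - 2 * p * g1 x) ->
  g 0 = beta * g 1 ->
  \sum_(1 <= k < N.+1) (lam R k ^+ 2 * ceven beta g k) ^+ 2 <=
    8 * itg 0 1 (fun x => (L x * g2 x - 2 * p * g1 x) ^+ 2).
Proof.
move=> A1 A2 Lg bc; apply: sum_sqr4 (bessel_sin N Lg) => k k0.
rewrite -[X in 16 * X]sqrrN.
rewrite -(itg_sin_parts2 k (AC_LbM A1) (AC_LbM2 A1 A2)); last exact: Lb_bc.
by rewrite /ceven; ring.
Qed.

Lemma ceven1_bound g g1 N : AC g g1 -> L2b (fun x => L x * g1 x - p * g x) ->
  g 0 = beta * g 1 ->
  \sum_(1 <= k < N.+1) (lam R k * ceven beta g k) ^+ 2 <=
    8 * itg 0 1 (fun x => (L x * g1 x - p * g x) ^+ 2).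
Proof.
move=> A1 Lg bc; apply: sum_sqr4 (bessel_cos N Lg) => k k0.
have := itg_sin_parts k (AC_LbM A1); rewrite (Lb_bc bc) subrr subr0 => <-.
by rewrite /ceven; ring.
Qed.

End Coefficients.

(** * Functions on the rectangle *)

Section SquareIntegrableDT.
Variables (R : realType) (T : R).
Hypothesis T0 : 0 < T.
Implicit Types (x y t : R) (g h : R -> R -> R) (Q : R -> R).
Local Notation mu := (@lebesgue_measure R).
Local Notation TR := (measurableTypeR R).

Definition onDT g : TR * TR -> R := (fun z : R * R => g z.1 z.2) \_ (DT T).

Definition sq_DT g : Prop := measurable_fun [set: TR * TR] (onDT g) /\
  ((\int[(mu \x mu)%E]_z (onDT g z ^+ 2)%:E)%E < +oo)%E.

Lemma L2_DT_sq g : L2_DT T g -> sq_DT g.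
Proof.
move=> Lg; split; first by have /set_mem := sub_Lfun_mfun Lg.
have /integrableP[_] := Lfun2_integrable_sqr Lg.
by under eq_integral do rewrite /= ger0_norm ?sqr_ge0//.
Qed.

Lemma onDTE g x t : onDT g (x, t) =
  if (0 <= x <= 1) && (0 <= t <= T) then g x t else 0.
Proof.
rewrite /onDT patchE; case: ifPn => [|/negP H].
  by rewrite inE/= /DT/= !in_itv/= => -[-> ->].
case: ifPn => // /andP[x01 tT]; exfalso; apply: H; rewrite inE/=.
by rewrite /DT/= !in_itv.
Qed.

Lemma L2norm_DT_sqr g : sq_DT g ->
  (\int[(mu \x mu)%E]_z (onDT g z ^+ 2)%:E = (L2norm_DT T g ^+ 2)%:E)%E.
Proof.
move=> [mg fg]; rewrite /L2norm_DT unlock /=.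
under [in RHS]eq_integral => z _ do
  rewrite -/(onDT g z) powR_mulrn// real_normK ?num_real//.
have I0 : (0 <= \int[(mu \x mu)%E]_z (onDT g z ^+ 2)%:E)%E.
  by apply: integral_ge0 => z _; rewrite lee_fin sqr_ge0.
set J := (\int[_]_z _)%E in fg I0 *; rewrite -/J.
have JE : J = (fine J)%:E by rewrite fineK// ge0_fin_numE.
rewrite JE poweR_EFin/= powR12_sqrt ?fine_ge0// sqr_sqrtr ?fine_ge0//.
Qed.

(** Extended real valued, since the square integral along a line t = const may be infinite for t in
    a null set. *)
Definition slice_sq g (t : TR) : \bar R := (\int[mu]_x (onDT g (x, t) ^+ 2)%:E)%E.

Lemma sq_DT_slice g t : sq_DT g -> 0 <= t <= T -> slice_sq g t != +oo%E ->
  L2b (g^~ t) /\ slice_sq g t = (itg 0 1 (fun x => g x t ^+ 2))%:E.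
Proof.
move=> [mg fg] tT Hfin.
have ms : measurable_fun [set: TR] (fun x : TR => onDT g (x, t)).
  exact: (measurableT_comp mg (measurable_pair2 t)).
have gE : (fun x : TR => onDT g (x, t)) = (g^~ t) \_ `[0, 1].
  apply/funext => x; rewrite onDTE tT andbT patchE.
  case: ifPn => x01; first by rewrite mem_set//= in_itv.
  by rewrite memNset//= in_itv/=; exact/negP.
have mgt : measurable_fun `[0 : R, 1] (g^~ t).
  by apply/(measurable_restrictT (g^~ t) (measurable_itv _)); rewrite -gE.
have HE : (slice_sq g t = \int[mu]_(x in `[0%R, 1%R]) (g x t ^+ 2)%:E)%E.
  rewrite /slice_sq [RHS]integral_mkcond; apply: eq_integral => x _.
  rewrite restrict_EFin/= patchE onDTE tT andbT.
  case: ifPn => x01; first by rewrite mem_set//= in_itv.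
  by rewrite memNset ?expr0n//= in_itv/=; exact/negP.
have i2 : intb 0 1 (fun x => g x t ^+ 2).
  apply/integrableP; split; first by apply/measurable_EFinP; exact: measurable_funX.
  under eq_integral do rewrite /= ger0_norm ?sqr_ge0//.
  by rewrite -HE ltey.
by split; [exact: intb_L2b|rewrite HE integral_itgE].
Qed.

Lemma slice_sq_facts g : sq_DT g ->
  [/\ forall t, (0 <= slice_sq g t)%E, measurable_fun [set: TR] (slice_sq g) &
      (\int[mu]_t slice_sq g t = (L2norm_DT T g ^+ 2)%:E)%E].
Proof.
move=> sg; have [mg fg] := sg.
have msq : measurable_fun [set: TR * TR] (fun z => (onDT g z ^+ 2)%:E).
  by apply/measurable_EFinP; exact: measurable_funX.
split.
- by move=> t; apply: integral_ge0 => x _; rewrite lee_fin sqr_ge0.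
- apply: (@measurable_fun_fubini_tonelli_G _ _ TR TR R mu (fun z => (onDT g z ^+ 2)%:E)) => //.
  by move=> z; rewrite lee_fin sqr_ge0.
- rewrite -L2norm_DT_sqr//; apply/esym.
  apply: (@fubini_tonelli2 _ _ TR TR R mu mu (fun z => (onDT g z ^+ 2)%:E)) => //.
  by move=> z; rewrite lee_fin sqr_ge0.
Qed.

Lemma sq_DT_ae g : sq_DT g -> {ae mu, forall t : R, 0 <= t <= T -> L2b (g^~ t)}.
Proof.
move=> sg; have [H0 mH E] := slice_sq_facts sg.
have iH : mu.-integrable [set: TR] (slice_sq g).
  apply/integrableP; split => //.
  under eq_integral do rewrite gee0_abs//.
  by rewrite E ltry.
have := integrable_ae measurableT iH.
case=> N [mN N0 HN]; exists N; split => // t nt; apply: HN => Ht; apply: nt => tT.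
have {}Ht := Ht I; apply: (sq_DT_slice sg tT _).1.
by apply/eqP => Eoo; move: Ht; rewrite Eoo.
Qed.

(** Bessel's inequality is available along almost every line only; Tonelli's theorem integrates it
    in t. *)
Lemma DT_itg_bound g Q : sq_DT g -> cont_on 0 T Q ->
  (forall t, 0 <= t <= T -> 0 <= Q t) ->
  {ae mu, forall t : R, 0 <= t <= T ->
     Q t <= 8 * itg 0 1 (fun x => g x t ^+ 2)} ->
  itg 0 T Q <= 8 * L2norm_DT T g ^+ 2.
Proof.
move=> sg cQ Q0 ae; have [H0 mH E] := slice_sq_facts sg.
rewrite -lee_fin EFinM -E -integral_itgE; last exact: cont_on_intb.
have step : (\int[mu]_(t in `[0%R, T]) (8%:E * slice_sq g t) <= 8%:E * \int[mu]_t slice_sq g t)%E.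
  rewrite ge0_integralZl//; last exact: measurable_funTS.
  by rewrite lee_wpmul2l// ge0_subset_integral.
apply: le_trans step.
have mQ : measurable_fun `[0, T] Q by exact: intb_measurable (cont_on_intb cQ).
apply: ae_ge0_le_integral => //.
- exact/measurable_EFinP.
- by move=> t _; rewrite mule_ge0.
- by apply: measurable_funeM; exact: measurable_funTS.
case: ae => N [mN N0 HN]; exists N; split => // t nt; apply: HN => Ht; apply: nt.
rewrite /= in_itv/= => tT; have {}Ht := Ht tT.
(* On a line where the slice is infinite the majorant is infinite and the bound is trivial. *)
have [Hoo|Hfin] := eqVneq (slice_sq g t) +oo%E.
  by rewrite Hoo mulry gtr0_sg// mul1e leey.
by have [_ ->] := sq_DT_slice sg tT Hfin; rewrite -EFinM lee_fin.
Qed.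

Lemma cont_DTP g : cont_DT T g <-> forall x t, 0 <= x <= 1 -> 0 <= t <= T ->
  forall e : R, 0 < e -> exists2 d : R, 0 < d & forall x' t', 0 <= x' <= 1 -> 0 <= t' <= T ->
    `|x' - x| < d -> `|t' - t| < d -> `|g x' t' - g x t| <= e.
Proof.
rewrite /cont_DT subspace_continuousP; split => [H x t x01 tT e e0|H [x t] /= [x01 tT]].
  have xt : DT T (x, t) by rewrite /DT/= !in_itv.
  have /cvgrPdist_le/(_ e e0) := H (x, t) xt.
  rewrite near_withinE => -[[A B] /= [[d1 /= d10 Ad1] [d2 /= d20 Bd2]] AB].
  exists (Num.min d1 d2); first by rewrite lt_min d10.
  move=> x' t' x'01 t'T; rewrite !lt_min => /andP[xd1 _] /andP[_ td2].
  rewrite distrC; have := AB (x', t'); apply; last by rewrite /DT/= !in_itv.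
  by split => /=; [apply: Ad1|apply: Bd2] => /=; rewrite distrC.
move: x01 tT; rewrite /= !in_itv/= => x01 tT.
apply/cvgrPdist_le => e e0; have [d d0 Hd] := H x t x01 tT e e0.
rewrite near_withinE; exists (ball x d, ball t d).
  by split; exact: nbhsx_ballx.
move=> [x' t'] /= [xd td]; rewrite /DT/= !in_itv/= => -[x'01 t'T].
by rewrite distrC; apply: Hd => //; rewrite distrC.
Qed.

Lemma cont_DT_x g t : cont_DT T g -> 0 <= t <= T -> cont_on 0 1 (g^~ t).
Proof.
move=> /cont_DTP cg tT; apply/cont_onP => x x01 e e0.
have [d d0 Hd] := cg x t x01 tT e e0; exists d => // y y01 yx.
by apply: Hd => //; rewrite subrr normr0.
Qed.

Lemma cont_DT_t g x : cont_DT T g -> 0 <= x <= 1 -> cont_on 0 T (g x).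
Proof.
move=> /cont_DTP cg x01; apply/cont_onP => t tT e e0.
have [d d0 Hd] := cg x t x01 tT e e0; exists d => // y y01 yx.
by apply: Hd => //; rewrite subrr normr0.
Qed.

Lemma compact_DT : compact (DT T).
Proof. by apply: compact_setX; exact: segment_compact. Qed.

Lemma cont_DT_bounded g : cont_DT T g ->
  exists2 K : R, 0 <= K & forall x t, 0 <= x <= 1 -> 0 <= t <= T -> `|g x t| <= K.
Proof.
move=> cg; have D0 : DT T !=set0.
  by exists (0, 0); rewrite /DT/= !in_itv/= !lexx ler01 ltW.
have cn : {within DT T, continuous (fun z : R * R => `|g z.1 z.2|)}.
  move: cg => /subspace_continuousP cg; apply/subspace_continuousP => z zD.
  by apply: cvg_norm; exact: cg.
have [c cD Hc] := compact_EVT_max D0 compact_DT cn.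
exists `|g c.1 c.2| => // x t x01 tT; apply: (Hc (x, t)).
by rewrite inE /DT/= !in_itv.
Qed.

(** The modulus of continuity in t is made uniform in x by the compactness of [0,1], which is what
    differentiation under an integral in x requires. *)
Lemma cont_DT_equi g : cont_DT T g -> forall t, 0 <= t <= T ->
  forall e : R, 0 < e -> exists2 d : R, 0 < d & forall x t', 0 <= x <= 1 -> 0 <= t' <= T ->
    `|t' - t| < d -> `|g x t' - g x t| <= e.
Proof.
move=> /cont_DTP cg t tT e e0.
have /compact_near_coveringP/near_covering_withinP cov := @segment_compact R 0 1.
have [d /= d0 Hd] : \forall t' \near nbhs t, `[0, 1] `<=`
    (fun x => 0 <= t' <= T -> `|g x t' - g x t| <= e).
  apply: cov => x; rewrite /= in_itv/= => x01.
  have e2 : 0 < e / 2 by rewrite divr_gt0.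
  have [d d0 Hd] := cg x t x01 tT _ e2.
  exists (ball x d, ball t d); first by split; exact: nbhsx_ballx.
  move=> [x' t'] /= [xd td]; rewrite in_itv/= => x'01 t'T.
  have := Hd x' t' x'01 t'T; rewrite distrC => /(_ xd); rewrite (distrC t') => /(_ td).
  have := Hd x' t x'01 tT; rewrite subrr normr0 (distrC x') => /(_ xd d0).
  rewrite !ler_norml => /andP[? ?] /andP[? ?]; apply/andP; split; lra.
exists d => // x t' x01 t'T td; have := Hd t'; rewrite /= distrC => /(_ td x).
by apply => //=; rewrite in_itv.
Qed.

Lemma cont_DTD g h : cont_DT T g -> cont_DT T h -> cont_DT T (fun x t => g x t + h x t).
Proof.
move=> /subspace_continuousP cg /subspace_continuousP ch.
by apply/subspace_continuousP => z zD; apply: cvgD; [exact: cg|exact: ch].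
Qed.

Lemma cont_DTM g h : cont_DT T g -> cont_DT T h -> cont_DT T (fun x t => g x t * h x t).
Proof.
move=> /subspace_continuousP cg /subspace_continuousP ch.
by apply/subspace_continuousP => z zD; apply: cvgM; [exact: cg|exact: ch].
Qed.

Lemma cont_on_DT_x (w : R -> R) : cont_on 0 1 w -> cont_DT T (fun x _ => w x).
Proof.
move=> /cont_onP cw; apply/cont_DTP => x t x01 tT e e0.
have [d d0 Hd] := cw x x01 e e0; exists d => // x' t' x'01 _ xd _; exact: Hd.
Qed.

Lemma cont_on_DT_t (w : R -> R) : cont_on 0 T w -> cont_DT T (fun _ t => w t).
Proof.
move=> /cont_onP cw; apply/cont_DTP => x t x01 tT e e0.
have [d d0 Hd] := cw t tT e e0; exists d => // x' t' _ tT' _ td; exact: Hd.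
Qed.

Lemma cont_DT_unif (G : nat -> R -> R -> R) g : (forall n, cont_DT T (G n)) ->
  (forall e : R, 0 < e -> exists N, forall n, (N <= n)%N ->
     forall x t, 0 <= x <= 1 -> 0 <= t <= T -> `|G n x t - g x t| <= e) ->
  cont_DT T g.
Proof.
move=> cG Gg; apply: within_continuous_unif => e e0.
have [N HN] := Gg e e0; exists (fun z : R * R => G N z.1 z.2); first exact: cG.
by move=> [x t]; rewrite /DT/= !in_itv/= => -[x01 tT]; exact: HN.
Qed.

(* g is a pointwise limit of functions that are locally constant in x. *)
Lemma cont_DT_measurable g : cont_DT T g -> measurable_fun [set: TR * TR] (onDT g).
Proof.
move=> cg.
(* Cells of width 1 / n.+1. The cell j = n.+1 contains only x = 1, and [minn] keeps every grid point
   inside [0,1]. *)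
pose I n j : set R := [set x | 0 <= x <= 1 /\ j%:R <= n.+1%:R * x < j.+1%:R].
pose K n j : TR -> R := (g ((minn j n.+1)%:R / n.+1%:R)) \_ `[0, T].
pose G n (z : TR * TR) : R := \sum_(0 <= j < n.+2) (\1_(I n j) z.1 * K n j z.2).
have mI n j : measurable (I n j : set TR).
  rewrite (_ : I n j = `[0, 1] `&` `[j%:R / n.+1%:R, j.+1%:R / n.+1%:R[); last first.
    apply/seteqP; split => x; rewrite /I/= !in_itv/=.
      by move=> [-> /andP[H1 H2]]; rewrite ler_pdivrMr// ltr_pdivlMr// mulrC H1.
    move=> [-> /andP[]]; rewrite ler_pdivrMr// ltr_pdivlMr// mulrC => -> ->; by [].
  by apply: measurableI.
have mK n j : measurable_fun [set: TR] (K n j).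
  apply/(measurable_restrictT _ (measurable_itv _)).
  apply: intb_measurable; apply: cont_on_intb; apply: cont_DT_t => //.
  by rewrite divr_ge0// ler_pdivrMr// mul1r ler_nat geq_minr.
have mG n : measurable_fun [set: TR * TR] (G n).
  apply: measurable_sum => j; apply: measurable_funM.
    exact: (measurableT_comp (measurable_indic (mI n j)) measurable_fst).
  exact: (measurableT_comp (mK n j) measurable_snd).
apply: (measurable_fun_cvg mG) => -[x t] _; rewrite onDTE.
case: ifPn => [/andP[x01 tT]|xt]; last first.
  rewrite (_ : (fun n => G n (x, t)) = fun=> 0); first exact: cvg_cst.
  apply/funext => n; rewrite /G big1// => j _ /=; rewrite indicE /K patchE.
  move: xt; rewrite negb_and => /orP[xn|tn].
    by rewrite memNset ?mul0r// => -[x01 _]; rewrite x01 in xn.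
  by rewrite [X in if X then _ else _]memNset ?mulr0//= in_itv/=; exact/negP.
apply/cvgrPdist_le => e e0.
have [d d0 Hd] := (cont_DTP g).1 cg x t x01 tT e e0.
have [N _ HN] := near_infty_natSinv_lt (PosNum d0).
exists N => // n /HN /= nd; rewrite distrC.
pose j0 := Num.trunc (n.+1%:R * x).
have nx0 : 0 <= n.+1%:R * x by rewrite mulr_ge0//; case/andP: x01.
have /andP[j1 j2] := truncn_itv nx0; rewrite -/j0 in j1 j2.
have j0n : (j0 < n.+2)%N.
  rewrite /j0 truncn_lt_nat// (@le_lt_trans _ _ n.+1%:R) ?ltr_nat//.
  by rewrite -[leRHS]mulr1 ler_pM2l//; case/andP: x01.
have -> : G n (x, t) = g (j0%:R / n.+1%:R) t.
  rewrite /G big_mkord (bigD1 (Ordinal j0n))//= big1 ?addr0; last first.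
    move=> j jj0; rewrite indicE memNset ?mul0r// => -[_ /truncn_def jE].
    by move/negP: jj0; apply; apply/eqP/val_inj; rewrite /= -jE.
  rewrite indicE mem_set; last by split => //; apply/andP.
  by rewrite /K patchE mem_set ?mul1r /= ?in_itv//= (minn_idPl _).
apply: Hd => //.
- rewrite divr_ge0//= ler_pdivrMr// mul1r.
  by apply: le_trans j1 _; rewrite -[leRHS]mulr1 ler_pM2l//; case/andP: x01.
- apply: le_lt_trans nd; have m0 : 0 < n.+1%:R :> R by [].
  have -> : j0%:R / n.+1%:R - x = (j0%:R - n.+1%:R * x) / n.+1%:R.
    by rewrite mulrBl mulrAC divff ?mul1r// gt_eqF.
  rewrite normrM normfV (gtr0_norm m0) ler_piMl ?invr_ge0//.
  by rewrite ler_norml; move: j1 j2; rewrite -[j0.+1%:R]natr1 => ? ?; apply/andP; split; lra.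
- by rewrite subrr normr0.
Qed.

(** (g w - c h)^2 <= 2 K^2 g^2 + 2 (c H)^2 with K and H bounds of w and h, and the rectangle has
    finite measure. *)
Lemma sq_DT_weight g h (w : R -> R) (c : R) : sq_DT g -> cont_on 0 1 w -> cont_DT T h ->
  sq_DT (fun x t => g x t * w x - c * h x t).
Proof.
move=> [mg fg] cw ch.
have cw' : cont_DT T (fun x _ => w x) by exact: cont_on_DT_x.
have mw := cont_DT_measurable cw'; have mh := cont_DT_measurable ch.
have [K K0 wK] := cont_on_bounded cw; have [H H0 hH] := cont_DT_bounded ch.
have E z : onDT (fun x t => g x t * w x - c * h x t) z =
    onDT g z * onDT (fun x _ => w x) z - c * onDT h z.
  by case: z => x t; rewrite !onDTE; case: ifP => // _; rewrite !mulr0 subrr.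
have m : measurable_fun [set: TR * TR] (onDT (fun x t => g x t * w x - c * h x t)).
  rewrite (_ : onDT _ = (fun z => onDT g z * onDT (fun x _ => w x) z - c * onDT h z)).
    by apply: measurable_funB; [exact: measurable_funM|exact: measurable_funM].
  by apply/funext => z; exact: E.
split => //.
pose B : R := 2 * (c * H) ^+ 2.
have m1 : measurable_fun [set: TR * TR] (onDT (fun _ _ => 1)).
  by apply: cont_DT_measurable; apply: cont_on_DT_x; exact: cont_on_cst.
have fin1 : ((\int[(mu \x mu)%E]_z (onDT (fun _ _ => 1) z)%:E)%E < +oo)%E.
  have mD : measurable (DT T : set (TR * TR)) by exact: measurableX.
  rewrite (_ : (\int[_]_z _)%E = (\int[(mu \x mu)%E]_z (\1_(DT T) z)%:E)%E); last first.
    apply: eq_integral => z _; rewrite /onDT patchE indicE.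
    by case: ifPn.
  rewrite integral_indic// setIT /DT.
  have E1 : mu `[0 : R, 1] = 1%:E by rewrite lebesgue_measure_itv/= lte_fin ltr01 oppr0 adde0.
  have E2 : mu `[0 : R, T] = T%:E by rewrite lebesgue_measure_itv/= lte_fin T0 oppr0 adde0.
  have PE := @product_measure1E _ _ TR TR R mu mu `[0 : R, 1] `[0 : R, T]
    (measurable_itv _) (measurable_itv _).
  have {}PE := etrans PE (f_equal2 (fun x y : \bar R => (x * y)%E) E1 E2).
  refine (eq_ind_r (fun z => (z < +oo)%E) _ PE).
  by rewrite /= -EFinM ltry.
have o0 z : 0 <= onDT (fun _ _ => 1) z by case: z => x t; rewrite onDTE; case: ifP.
have mg2 : measurable_fun [set: TR * TR] (fun z => (onDT g z ^+ 2)%:E).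
  by apply/measurable_EFinP; exact: measurable_funX.
have fin2 : ((2 * K ^+ 2)%:E * (\int[(mu \x mu)%E]_z (onDT g z ^+ 2)%:E) +
   B%:E * (\int[(mu \x mu)%E]_z (onDT (fun _ _ => 1) z)%:E) < +oo)%E.
  apply: lte_add_pinfty; apply: lte_mul_pinfty => //; rewrite lee_fin.
  - by rewrite mulr_ge0// sqr_ge0.
  - by rewrite mulr_ge0// sqr_ge0.
apply: le_lt_trans fin2.
rewrite -!ge0_integralZl//; last 5 first.
- exact/measurable_EFinP.
- by move=> z _; rewrite lee_fin.
- by rewrite lee_fin mulr_ge0// sqr_ge0.
- by move=> z _; rewrite lee_fin sqr_ge0.
- by rewrite lee_fin mulr_ge0// sqr_ge0.
rewrite -ge0_integralD//; last 4 first.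
- by move=> z _; rewrite -EFinM lee_fin mulr_ge0 ?sqr_ge0// mulr_ge0// sqr_ge0.
- by apply: measurable_funeM.
- by move=> z _; rewrite -EFinM lee_fin mulr_ge0// mulr_ge0// sqr_ge0.
- by apply: measurable_funeM; exact/measurable_EFinP.
apply: ge0_le_integral => //.
- by move=> z _; rewrite lee_fin sqr_ge0.
- by apply/measurable_EFinP; exact: measurable_funX.
- apply: emeasurable_funD; apply: measurable_funeM => //; exact/measurable_EFinP.
move=> -[x t] _; rewrite -!EFinM -EFinD lee_fin !onDTE.
case: ifPn => [/andP[x01 tT]|_]; last by rewrite expr0n/= !mulr0 addr0.
have wx := wK x x01; have hx := hH x t x01 tT.
have w2 : w x ^+ 2 <= K ^+ 2 by rewrite -(real_normK (num_real (w x))) lerXn2r ?nnegrE.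
have h2 : h x t ^+ 2 <= H ^+ 2 by rewrite -(real_normK (num_real (h x t))) lerXn2r ?nnegrE.
have a1 : g x t ^+ 2 * w x ^+ 2 <= g x t ^+ 2 * K ^+ 2 by rewrite ler_wpM2l// sqr_ge0.
have a2 : c ^+ 2 * h x t ^+ 2 <= c ^+ 2 * H ^+ 2 by rewrite ler_wpM2l// sqr_ge0.
have := sqr_ge0 (g x t * w x + c * h x t); rewrite /B; move: a1 a2.
rewrite mulr1 => ? ? ?.
suff : 2 * (g x t ^+ 2 * w x ^+ 2) + 2 * (c ^+ 2 * h x t ^+ 2) -
  (g x t * w x - c * h x t) ^+ 2 >= 0 by rewrite exprMn; lra.
rewrite (_ : _ - _ = (g x t * w x + c * h x t) ^+ 2)//; ring.
Qed.

End SquareIntegrableDT.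

(** * Weighted l2 sums *)

Section FiniteSums.
Variable R : realType.
Implicit Types (a b : nat -> R).

(** Norm of the terms of index 1 to n. Bounds uniform in n stand for l2 norms, so no summability has
    to be carried along. *)
Definition l2n (a : nat -> R) (n : nat) : R := Num.sqrt (\sum_(1 <= k < n.+1) a k ^+ 2).

Lemma sum_sqr_ge0 a m n : 0 <= \sum_(m <= k < n) a k ^+ 2.
Proof. by apply: sumr_ge0 => k _; exact: sqr_ge0. Qed.

Lemma l2n_ge0 a n : 0 <= l2n a n.
Proof. exact: sqrtr_ge0. Qed.

Lemma l2n_sqr a n : l2n a n ^+ 2 = \sum_(1 <= k < n.+1) a k ^+ 2.
Proof. by rewrite sqr_sqrtr// sum_sqr_ge0. Qed.

(** The form s^2 A - 2 s t C + t^2 B is a sum of squares; s = B and t = C give B (A B - C^2) >=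
    0. *)
Lemma sum_cauchy_schwarz a b m n :
  (\sum_(m <= k < n) a k * b k) ^+ 2 <=
  (\sum_(m <= k < n) a k ^+ 2) * (\sum_(m <= k < n) b k ^+ 2).
Proof.
have A0 := sum_sqr_ge0 a m n; have B0 := sum_sqr_ge0 b m n.
set A := \sum_(m <= k < n) a k ^+ 2 in A0 *; set B := \sum_(m <= k < n) b k ^+ 2 in B0 *.
set C := \sum_(m <= k < n) a k * b k.
have H s t : 0 <= s ^+ 2 * A - 2 * s * t * C + t ^+ 2 * B.
  rewrite (_ : _ + _ = \sum_(m <= k < n) (s * a k - t * b k) ^+ 2) ?sum_sqr_ge0//.
  rewrite /A /B /C !mulr_sumr -sumrB -big_split/=; apply: eq_bigr => k _; ring.
have [C0|Cn0] := eqVneq C 0; first by rewrite C0 expr0n mulr_ge0.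
have [B00|Bp] := eqVneq B 0.
  (* If B = 0 while C <> 0, this choice would give the form the value -1. *)
  have := H 1 ((A + 1) / (2 * C)); rewrite B00.
  rewrite (_ : _ + _ = - 1) ?lerN10//; first by rewrite oppr_ge0 ler10.
  by field; rewrite Cn0.
have {}Bp : 0 < B by rewrite lt_def Bp.
have := H B C; rewrite (_ : _ + _ = B * (A * B - C ^+ 2)); last by ring.
by rewrite pmulr_rge0// subr_ge0.
Qed.

Lemma l2n_cauchy_schwarz a b n : \sum_(1 <= k < n.+1) a k * b k <= l2n a n * l2n b n.
Proof.
rewrite (le_trans (ler_norm _))// -sqrtr_sqr /l2n -sqrtrM ?sum_sqr_ge0//.
by rewrite ler_wsqrtr// sum_cauchy_schwarz.
Qed.

Lemma l2nD a b n : l2n (fun k => a k + b k) n <= l2n a n + l2n b n.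
Proof.
rewrite -(@ler_pXn2r _ 2)// ?nnegrE ?addr_ge0 ?l2n_ge0// sqrrD !l2n_sqr.
have -> : \sum_(1 <= k < n.+1) (a k + b k) ^+ 2 = \sum_(1 <= k < n.+1) a k ^+ 2 +
   2 * (\sum_(1 <= k < n.+1) a k * b k) + \sum_(1 <= k < n.+1) b k ^+ 2.
  by rewrite mulr_sumr -!big_split/=; apply: eq_bigr => k _; ring.
have := l2n_cauchy_schwarz a b n; rewrite mulr2n; lra.
Qed.

Lemma l2nZ (c : R) a n : l2n (fun k => c * a k) n = `|c| * l2n a n.
Proof.
rewrite /l2n -sqrtr_sqr -sqrtrM ?sqr_ge0// mulr_sumr.
by congr Num.sqrt; apply: eq_bigr => k _; rewrite exprMn.
Qed.

Lemma le_l2n a b n : (forall k, (0 < k)%N -> `|a k| <= `|b k|) -> l2n a n <= l2n b n.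
Proof.
move=> ab; rewrite ler_wsqrtr// !big_nat; apply: ler_sum => k /andP[k0 _].
by rewrite -(real_normK (num_real (a k))) -(real_normK (num_real (b k))) lerXn2r ?nnegrE// ab.
Qed.

Lemma l2n_le a n (B : R) : 0 <= B -> \sum_(1 <= k < n.+1) a k ^+ 2 <= B ^+ 2 -> l2n a n <= B.
Proof. by move=> B0 aB; rewrite -(ger0_norm B0) -sqrtr_sqr ler_wsqrtr. Qed.

(** Telescoping, from 1 / (m+1)^2 <= 1 / m - 1 / (m+1). *)
Lemma sum_inv_sqr n j : (0 < n)%N ->
  \sum_(n.+1 <= k < n.+1 + j) (k%:R ^+ 2 : R)^-1 <= n%:R^-1 - (n + j)%:R^-1.
Proof.
move=> n0; elim: j => [|j IH]; first by rewrite !addn0 big_geq// subrr.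
rewrite addnS big_nat_recr/= ?leq_addr//.
apply: le_trans (lerD IH (lexx _)) _.
rewrite addSn addnS -lerBrDl; set m := (n + j)%N.
have m0 : 0 < m%:R :> R by rewrite ltr0n /m addn_gt0 n0.
rewrite -natr1; move: (m%:R : R) m0 => z z0.
have -> : n%:R^-1 - (z + 1)^-1 - (n%:R^-1 - z^-1) = (z * (z + 1))^-1.
  rewrite (_ : forall w : R, w - (z + 1)^-1 - (w - z^-1) = z^-1 - (z + 1)^-1).
    by field; rewrite (gt_eqF z0) gt_eqF// addr_gt0.
  by move=> w; ring.
rewrite lef_pV2 ?posrE ?mulr_gt0 ?exprn_gt0 ?addr_gt0//; nra.
Qed.

Lemma lam_sqr_le k : (0 < k)%N -> (lam R k ^+ 2)^-1 <= 16^-1 * (k%:R ^+ 2)^-1.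
Proof.
move=> k0; rewrite -invfM lef_pV2 ?posrE ?exprn_gt0 ?lam_gt0//; last first.
  by rewrite mulr_gt0// exprn_gt0// ltr0n.
rewrite /lam; have := pi_ge2 R; have : 0 < k%:R :> R by rewrite ltr0n.
move: (k%:R : R) (@pi R) => z w z0 w2.
have w4 : 4 <= w ^+ 2 by nra.
rewrite (_ : (2 * z * w) ^+ 2 = z ^+ 2 * (4 * w ^+ 2)); last by ring.
by rewrite mulrC ler_pM2l ?exprn_gt0//; lra.
Qed.

Lemma lam_tail (e : R) : 0 < e -> exists N, (0 < N)%N /\
  forall m, \sum_(N <= k < m) (lam R k ^+ 2)^-1 <= e.
Proof.
move=> e0; pose N := (Num.trunc e^-1).+1.
have N0 : N%:R^-1 <= e.
  rewrite invf_ple ?posrE ?ltr0n//; apply: ltW; exact: truncnS_gt.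
exists N.+1; split => // m; have [mN|Nm] := leqP m N.+1; first by rewrite big_geq// ltW.
apply: (@le_trans _ _ (\sum_(N.+1 <= k < m) (k%:R ^+ 2 : R)^-1)).
  rewrite !big_nat; apply: ler_sum => k /andP[Nk _].
  have k0 : (0 < k)%N by exact: leq_trans Nk.
  apply: le_trans (lam_sqr_le k0) _; rewrite ler_piMl ?invr_ge0 ?sqr_ge0//.
  by rewrite invf_le1// ler1n.
rewrite -(subnKC (ltnW Nm)); apply: le_trans (@sum_inv_sqr N _ _) _ => //.
by apply: le_trans N0; rewrite lerBlDr lerDl invr_ge0.
Qed.

(** The lower bound comes from the first term alone, as 2 pi <= 8. It serves to extract a bound on T
    from B_4, where [sum_lam] is a factor. *)
Lemma sum_lam_facts : [/\ 1 / 8 <= sum_lam R &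
  forall n, l2n (fun k => (lam R k)^-1) n <= sum_lam R].
Proof.
pose u k := (lam R k.+1 ^+ 2)^-1.
have uE n : series u n = \sum_(1 <= k < n.+1) (lam R k)^-1 ^+ 2.
  by rewrite /series/= big_add1/=; apply: eq_bigr => k _; rewrite /u exprVn.
have nd : nondecreasing_seq (series u).
  apply/nondecreasing_seqP => n; rewrite /series/= big_nat_recr//= lerDl.
  by rewrite invr_ge0 sqr_ge0.
have cu : cvgn (series u).
  apply: nondecreasing_is_cvgn => //.
  have [N [N0 HN]] := lam_tail ltr01.
  exists (\sum_(1 <= k < N) (lam R k ^+ 2)^-1 + 1) => _ [n _ <-]; rewrite uE.
  under eq_bigr do rewrite exprVn.
  have [nN|Nn] := leqP n.+1 N.
    apply: ler_wpDr => //; rewrite [leRHS](@big_cat_nat _ _ _ n.+1)//= lerDl.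
    by apply: sumr_ge0 => k _; rewrite invr_ge0 sqr_ge0.
  by rewrite (@big_cat_nat _ _ _ N)//=; [rewrite lerD2l|exact: ltnW].
have bnd n : series u n <= limn (series u) by exact: nondecreasing_cvgn_le.
split=> [|n]; last by rewrite /l2n /sum_lam ler_wsqrtr// -uE.
have := bnd 1%N; rewrite /series/= big_nat1 /u /sum_lam -/(series u) => H.
rewrite -(ger0_norm (_ : 0 <= 1 / 8 :> R)) ?divr_ge0// -sqrtr_sqr ler_wsqrtr//.
apply: le_trans H; rewrite -[leLHS]invrK lef_pV2 ?posrE ?exprn_gt0 ?lam_gt0//.
rewrite (_ : ((1 / 8) ^+ 2)^-1 = 8 ^+ 2); last by field.
rewrite lerXn2r ?nnegrE ?(ltW (lam_gt0 _ _))// /lam.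
by have := pihalf_lt2 R; lra.
Qed.

Lemma sum_lam_cauchy a n : \sum_(1 <= k < n.+1) (lam R k)^-1 * a k <= sum_lam R * l2n a n.
Proof.
apply: le_trans (l2n_cauchy_schwarz _ _ _) _.
by rewrite ler_wpM2r ?l2n_ge0//; have [_] := sum_lam_facts.
Qed.

Lemma sum_lam_ge0 : 0 <= sum_lam R.
Proof. exact: sqrtr_ge0. Qed.

End FiniteSums.

(** * Square sums of time integrals of coefficients *)

Section TimeIntegrals.
Variables (R : realType) (T : R).
Hypothesis T0 : 0 < T.
Implicit Types (g : R -> R -> R).

Lemma itg_sqr_le (u : R -> R) : cont_on 0 T u ->
  itg 0 T (fun t => `|u t|) ^+ 2 <= T * itg 0 T (fun t => u t ^+ 2).
Proof.
move=> cu; set c := itg 0 T (fun t => `|u t|).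
have in_ : intb 0 T (fun t => `|u t|) by apply: cont_on_intb; exact: cont_on_norm.
have iu2 : intb 0 T (fun t => u t ^+ 2).
  by apply: cont_on_intb; under eq_fun do rewrite expr2; exact: cont_onM.
have icst : intb 0 T (fun=> c ^+ 2) by apply: cont_on_intb; exact: cont_on_cst.
have H : 0 <= itg 0 T (fun t => T ^+ 2 * u t ^+ 2 - (2 * c * T * `|u t| - c ^+ 2)).
  apply: itg_ge0 => t _; rewrite -(real_normK (num_real (u t))).
  by have := sqr_ge0 (T * `|u t| - c); rewrite sqrrB mulr2n; move: `|u t| => r; lra.
have i1 : intb 0 T (fun t => T ^+ 2 * u t ^+ 2) by exact: intbZ.
have i2 : intb 0 T (fun t => 2 * c * T * `|u t|) by exact: intbZ.
have E : itg 0 T (fun t => 2 * c * T * `|u t| - c ^+ 2) = 2 * c * T * c - c ^+ 2 * T.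
  by rewrite itgB// itgZ// itg_cst ?(ltW T0)// subr0.
move: H; rewrite itgB//; last exact: intbB.
rewrite E itgZ// => H.
rewrite -(ler_pM2l T0); move: H; move: (itg _ _ _) => I; lra.
Qed.

Lemma cont_on_itg g : cont_DT T g -> cont_on 0 T (fun t => itg 0 1 (g^~ t)).
Proof.
move=> cg; apply/cont_onP => t tT e e0.
have [d d0 Hd] := cont_DT_equi cg tT e0; exists d => // t' t'T td.
have ig s : 0 <= s <= T -> intb 0 1 (g^~ s).
  by move=> sT; apply: cont_on_intb; exact: (cont_DT_x cg sT).
have <- := itgB (ig _ t'T) (ig _ tT).
have -> : e = e * (1 - 0) by rewrite subr0 mulr1.
apply: itg_bound => //; first by apply: intbB; exact: ig.
by move=> x x01; exact: Hd.
Qed.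

(** Cauchy-Schwarz in time costs a factor T and Bessel's inequality a factor 8; 2 sqrt(2 T) is the
    square root of 8 T. *)
Lemma itg_abs_bound g (u : nat -> R -> R) n : sq_DT T g ->
  (forall k, cont_on 0 T (u k)) ->
  {ae @lebesgue_measure R, forall t : R, 0 <= t <= T ->
     \sum_(1 <= k < n.+1) u k t ^+ 2 <= 8 * itg 0 1 (fun x => g x t ^+ 2)} ->
  l2n (fun k => itg 0 T (fun t => `|u k t|)) n <= 2 * Num.sqrt (2 * T) * L2norm_DT T g.
Proof.
move=> sg cu ae.
have cu2 k : cont_on 0 T (fun t => u k t ^+ 2).
  by under eq_fun do rewrite expr2; exact: cont_onM.
have N0 : 0 <= L2norm_DT T g by rewrite /L2norm_DT fine_ge0// Lnorm_ge0.
apply: l2n_le; first by rewrite mulr_ge0// mulr_ge0// sqrtr_ge0.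
have cQ : cont_on 0 T (fun t => \sum_(1 <= k < n.+1) u k t ^+ 2).
  by apply: cont_on_sum => k _; exact: cu2.
have H := DT_itg_bound sg cQ (fun t _ => sum_sqr_ge0 (u^~ t) 1 n.+1) ae.
rewrite exprMn exprMn sqr_sqrtr ?mulr_ge0 ?(ltW T0)//.
rewrite (_ : 2 ^+ 2 * (2 * T) * _ = T * (8 * L2norm_DT T g ^+ 2)); last by ring.
apply: (@le_trans _ _ (T * itg 0 T (fun t => \sum_(1 <= k < n.+1) u k t ^+ 2))); last first.
  by rewrite ler_pM2l.
have -> : itg 0 T (fun t => \sum_(1 <= k < n.+1) u k t ^+ 2) =
   \sum_(1 <= k < n.+1) itg 0 T (fun t => u k t ^+ 2).
  elim: (n) => [|m IH].
    rewrite big_geq// (@eq_itg _ _ _ _ (fun=> 0)) ?itg_cst ?mul0r ?(ltW T0)//.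
    by move=> t _; rewrite big_geq.
  rewrite big_nat_recr//= -IH -itgD; last 2 first.
  - by apply: cont_on_intb; apply: cont_on_sum => k _; exact: cu2.
  - by apply: cont_on_intb; exact: cu2.
  by apply: eq_itg => t _; rewrite big_nat_recr.
rewrite mulr_sumr; apply: ler_sum => k _; exact: itg_sqr_le.
Qed.

End TimeIntegrals.

(** * The basis X_k and its dual system *)

Definition Xo (R : realType) (beta : R) (k : nat) (x : R) : R :=
  (pc beta * x + qc beta) * cos (lam R k * x).

(** The mode X_0 is left out: it is the only one with nonzero integral, so the condition int u = 0
    excludes it. *)
Definition Xsum (R : realType) (beta : R) (co ce : nat -> R) (n : nat) (x : R) : R :=
  \sum_(1 <= k < n.+1) (co k * Xo beta k x + ce k * sin (lam R k * x)).

Section Biorthogonality.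
Variables (R : realType) (beta : R).
Hypothesis beta_neqN1 : beta <> -1.
Implicit Types (x y t l : R) (g h : R -> R).
Local Notation p := (pc beta).
Local Notation q := (qc beta).
Local Notation L := (Lb beta).

Lemma cont_on_refl g : cont_on 0 1 g -> cont_on 0 1 (fun x => g (1 - x)).
Proof.
move=> /cont_onP cg; apply/cont_onP => x /andP[x0 x1] e e0.
have [|d d0 Hd] := cg (1 - x) _ e e0; first by apply/andP; split; lra.
exists d => // y /andP[y0 y1] yx; apply: Hd; first by apply/andP; split; lra.
by rewrite (_ : 1 - y - (1 - x) = - (y - x)) ?normrN//; ring.
Qed.

Lemma itg_refl g : cont_on 0 1 g -> itg 0 1 (fun x => g (1 - x)) = itg 0 1 g.
Proof.
move=> cg; rewrite /itg [RHS]Rintegration_by_substitution_onem ?ler01 ?lexx//.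
by rewrite /unstable.onem subrr.
Qed.

(** All the biorthogonality relations rest on the reflection x |-> 1 - x: it fixes the cosines,
    negates the sines, and exchanges p x + q with L x, whose sum is 1. *)
Lemma itg_sym g : cont_on 0 1 g ->
  itg 0 1 g = 1 / 2 * itg 0 1 (fun x => g x + g (1 - x)).
Proof.
move=> cg; rewrite itgD; [|exact: cont_on_intb|apply: cont_on_intb; exact: cont_on_refl].
by rewrite itg_refl//; field.
Qed.

Lemma cos_lam_refl k x : cos (lam R k * (1 - x)) = cos (lam R k * x).
Proof. by rewrite mulrBr mulr1 cosB cos_lam sin_lam mul1r mul0r addr0. Qed.

Lemma sin_lam_refl k x : sin (lam R k * (1 - x)) = - sin (lam R k * x).
Proof. by rewrite mulrBr mulr1 sinB cos_lam sin_lam mul1r mul0r sub0r. Qed.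

Lemma cont_on_affine a b : cont_on a b (fun x => p * x + q).
Proof.
by apply: cont_onD; [apply: cont_onZ; exact: cont_on_id|exact: cont_on_cst].
Qed.

Lemma cont_on_Xo a b k : cont_on a b (Xo beta k).
Proof. by apply: cont_onM; [exact: cont_on_affine|exact: cont_on_cosZ]. Qed.

Let p2q := p_2q beta_neqN1.

Lemma itg_Xo_cos k j : (0 < k)%N -> (0 < j)%N ->
  itg 0 1 (fun x => Xo beta k x * cos (lam R j * x)) = (if k == j then 1 / 4 else 0).
Proof.
move=> k0 j0; rewrite itg_sym; last first.
  by apply: cont_onM; [exact: cont_on_Xo|exact: cont_on_cosZ].
rewrite (@eq_itg _ _ _ _ (fun x => cos (lam R k * x) * cos (lam R j * x))).
  by rewrite (itg_trig_mul R k0 j0).1; case: ifP => _; field.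
move=> x _; rewrite /Xo !cos_lam_refl.
transitivity ((p + 2 * q) * (cos (lam R k * x) * cos (lam R j * x))); first by ring.
by rewrite p2q mul1r.
Qed.

Lemma itg_odd g : cont_on 0 1 g -> (forall x, g (1 - x) = - g x) -> itg 0 1 g = 0.
Proof.
move=> cg gN; rewrite itg_sym// (@eq_itg _ _ _ _ (fun=> 0)).
  by rewrite itg_cst// mul0r mulr0.
by move=> x _; rewrite gN subrr.
Qed.

Lemma itg_sin_cos k j : itg 0 1 (fun x => sin (lam R k * x) * cos (lam R j * x)) = 0.
Proof.
apply: itg_odd => [|x]; first by apply: cont_onM; [exact: cont_on_sinZ|exact: cont_on_cosZ].
by rewrite sin_lam_refl cos_lam_refl mulNr.
Qed.

Lemma itg_affine_cos j : (0 < j)%N -> itg 0 1 (fun x => (p * x + q) * cos (lam R j * x)) = 0.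
Proof.
move=> j0; rewrite itg_sym; last by apply: cont_onM; [exact: cont_on_affine|exact: cont_on_cosZ].
rewrite (@eq_itg _ _ _ _ (fun x => cos (lam R j * x))) ?itg_cos_lam ?mulr0//.
move=> x _; rewrite cos_lam_refl.
transitivity ((p + 2 * q) * cos (lam R j * x)); first by ring.
by rewrite p2q mul1r.
Qed.

Lemma Lb_affine_refl x : (L (1 - x) = p * x + q) /\ (p * (1 - x) + q = L x).
Proof. by rewrite Lb_refl//; split => //; rewrite /Lb; have := p2q; lra. Qed.

Lemma itg_Xo_Lsin k j : itg 0 1 (fun x => L x * Xo beta k x * sin (lam R j * x)) = 0.
Proof.
apply: itg_odd => [|x].
  apply: cont_onM; last exact: cont_on_sinZ.
  by apply: cont_onM; [exact: cont_on_Lb|exact: cont_on_Xo].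
by rewrite /Xo sin_lam_refl cos_lam_refl (Lb_affine_refl x).1 (Lb_affine_refl x).2; ring.
Qed.

Lemma itg_affine_Lsin j : itg 0 1 (fun x => L x * (p * x + q) * sin (lam R j * x)) = 0.
Proof.
apply: itg_odd => [|x].
  apply: cont_onM; last exact: cont_on_sinZ.
  by apply: cont_onM; [exact: cont_on_Lb|exact: cont_on_affine].
by rewrite sin_lam_refl (Lb_affine_refl x).1 (Lb_affine_refl x).2; ring.
Qed.

Lemma Lb_sum x : L x + L (1 - x) = 1.
Proof. by rewrite (Lb_affine_refl x).1 /Lb; have := p2q; lra. Qed.

Lemma itg_sin_Lsin k j : (0 < k)%N -> (0 < j)%N ->
  itg 0 1 (fun x => L x * sin (lam R k * x) * sin (lam R j * x)) = (if k == j then 1 / 4 else 0).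
Proof.
move=> k0 j0; rewrite itg_sym; last first.
  apply: cont_onM; last exact: cont_on_sinZ.
  by apply: cont_onM; [exact: cont_on_Lb|exact: cont_on_sinZ].
rewrite (@eq_itg _ _ _ _ (fun x => sin (lam R k * x) * sin (lam R j * x))).
  by rewrite (itg_trig_mul R k0 j0).2; case: ifP => _; field.
move=> x _; rewrite !sin_lam_refl.
transitivity ((L x + L (1 - x)) * (sin (lam R k * x) * sin (lam R j * x))); first by ring.
by rewrite Lb_sum mul1r.
Qed.

Lemma itg_sin_lam k : itg 0 1 (fun x => sin (lam R k * x)) = 0.
Proof. by apply: itg_odd => [|x]; [exact: cont_on_sinZ|rewrite sin_lam_refl]. Qed.

Lemma itg_Xo k : (0 < k)%N -> itg 0 1 (Xo beta k) = 0.
Proof. exact: itg_affine_cos. Qed.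

Lemma itg_affine : itg 0 1 (fun x => p * x + q) = 1 / 2.
Proof.
rewrite itg_sym; last exact: cont_on_affine.
rewrite (@eq_itg _ _ _ _ (fun=> 1)) ?itg_cst ?subr0 ?mulr1//.
by move=> x _; rewrite -[RHS]p2q; ring.
Qed.

Lemma itg_sum m n (G : nat -> R -> R) : (forall k, (m <= k < n)%N -> intb 0 1 (G k)) ->
  itg 0 1 (fun x => \sum_(m <= k < n) G k x) = \sum_(m <= k < n) itg 0 1 (G k) /\
  intb 0 1 (fun x => \sum_(m <= k < n) G k x).
Proof.
have c0 : intb (0 : R) 1 (fun=> 0) by apply: cont_on_intb; exact: cont_on_cst.
elim: n => [|n IH] H.
  rewrite big_geq//; split; last by apply: eq_intb c0 => x _; rewrite big_geq.
  by rewrite (@eq_itg _ _ _ _ (fun=> 0)) ?itg_cst ?mul0r// => x _; rewrite big_geq.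
have [mn|nm] := leqP m n; last first.
  rewrite big_geq//; split; last by apply: eq_intb c0 => x _; rewrite big_geq.
  by rewrite (@eq_itg _ _ _ _ (fun=> 0)) ?itg_cst ?mul0r// => x _; rewrite big_geq.
have [|IH1 IH2] := IH.
  by move=> k /andP[mk kn]; apply: H; rewrite mk ltnS ltnW.
have Hn : intb 0 1 (G n) by apply: H; rewrite mn ltnSn.
split; last by apply: eq_intb (intbD IH2 Hn) => x _; rewrite big_nat_recr.
rewrite big_nat_recr//= -IH1 -itgD//.
by apply: eq_itg => x _; rewrite big_nat_recr.
Qed.

Lemma cont_on_Xsum co ce n : cont_on 0 1 (Xsum beta co ce n).
Proof.
apply: cont_on_sum => k _; apply: cont_onD; apply: cont_onZ;
  [exact: cont_on_Xo|exact: cont_on_sinZ].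
Qed.

Lemma itg_Xsum_mul w co ce n : cont_on 0 1 w ->
  itg 0 1 (fun x => Xsum beta co ce n x * w x) =
  \sum_(1 <= k < n.+1) (co k * itg 0 1 (fun x => Xo beta k x * w x) +
                        ce k * itg 0 1 (fun x => sin (lam R k * x) * w x)).
Proof.
move=> cw.
have i1 k : intb 0 1 (fun x => Xo beta k x * w x).
  by apply: cont_on_intb; apply: cont_onM => //; exact: cont_on_Xo.
have i2 k : intb 0 1 (fun x => sin (lam R k * x) * w x).
  by apply: cont_on_intb; apply: cont_onM => //; exact: cont_on_sinZ.
transitivity (itg 0 1 (fun x => \sum_(1 <= k < n.+1)
    (co k * (Xo beta k x * w x) + ce k * (sin (lam R k * x) * w x)))).
  by apply: eq_itg => x _; rewrite /Xsum mulr_suml; apply: eq_bigr => k _; ring.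
rewrite (itg_sum (fun k _ => _)).1; last by move=> k _; apply: intbD; exact: intbZ.
apply: eq_bigr => k _; rewrite itgD; [|exact: intbZ|exact: intbZ].
by rewrite !itgZ.
Qed.

Lemma big_pick (u : nat -> R) j n : (0 < j)%N -> (j < n)%N ->
  (forall k, k != j -> u k = 0) -> \sum_(1 <= k < n) u k = u j.
Proof.
move=> j0 jn u0; rewrite (bigD1_seq j) ?mem_index_iota ?iota_uniq ?j0//=.
by rewrite big1 ?addr0// => k; exact: u0.
Qed.

Lemma Xsum_coefs (c0 : R) co ce n j : (0 < j)%N -> (j <= n)%N ->
  [/\ codd (fun x => c0 * (p * x + q) + Xsum beta co ce n x) j = co j &
      ceven beta (fun x => c0 * (p * x + q) + Xsum beta co ce n x) j = ce j].
Proof.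
move=> j0 jn.
have cS := @cont_on_Xsum co ce n.
have ca : cont_on 0 1 (fun x => p * x + q) by exact: cont_on_affine.
split; rewrite /codd /ceven.
- rewrite (@eq_itg _ _ _ _ (fun x => c0 * ((p * x + q) * cos (lam R j * x)) +
    Xsum beta co ce n x * cos (lam R j * x))); last by move=> x _; ring.
  have cc := @cont_on_cosZ R 0 1 (lam R j).
  rewrite itgD; last 2 first.
  - by apply: intbZ; apply: cont_on_intb; exact: cont_onM.
  - by apply: cont_on_intb; exact: cont_onM.
  rewrite itgZ; last by apply: cont_on_intb; exact: cont_onM.
  rewrite itg_affine_cos// mulr0 add0r itg_Xsum_mul// big_nat.
  rewrite (eq_bigr (fun k => if k == j then co j / 4 else 0)); last first.
    move=> k /andP[k0 _]; rewrite itg_Xo_cos// itg_sin_cos mulr0 addr0.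
    by case: eqVneq => [->|_]; rewrite ?mulr0//; field.
  rewrite -big_nat (@big_pick _ j)//.
    by rewrite eqxx; field.
  by move=> k /negbTE ->.
- rewrite (@eq_itg _ _ _ _ (fun x => c0 * (L x * (p * x + q) * sin (lam R j * x)) +
    Xsum beta co ce n x * (L x * sin (lam R j * x)))); last by move=> x _; ring.
  have cs := @cont_on_sinZ R 0 1 (lam R j).
  have cL := @cont_on_Lb R beta 0 1.
  rewrite itgD; last 2 first.
  - by apply: intbZ; apply: cont_on_intb; do 2 apply: cont_onM => //.
  - by apply: cont_on_intb; do 2 apply: cont_onM => //.
  rewrite itgZ; last by apply: cont_on_intb; do 2 apply: cont_onM => //.
  rewrite itg_affine_Lsin// mulr0 add0r itg_Xsum_mul; last exact: cont_onM.
  rewrite big_nat (eq_bigr (fun k => if k == j then ce j / 4 else 0)); last first.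
    move=> k /andP[k0 _].
    rewrite (@eq_itg _ _ _ (fun x => Xo beta k x * _)
      (fun x => L x * Xo beta k x * sin (lam R j * x))); last first.
      by move=> x _; ring.
    rewrite itg_Xo_Lsin mulr0 add0r.
    rewrite (@eq_itg _ _ _ _ (fun x => L x * sin (lam R k * x) * sin (lam R j * x))); last first.
      by move=> x _; ring.
    rewrite itg_sin_Lsin//.
    by case: eqVneq => [->|_]; rewrite ?mulr0//; field.
  rewrite -big_nat (@big_pick _ j)//.
    by rewrite eqxx; field.
  by move=> k /negbTE ->.
Qed.

Lemma itg_Xsum (c0 : R) co ce n :
  itg 0 1 (fun x => c0 * (p * x + q) + Xsum beta co ce n x) = c0 / 2.
Proof.
have ca : cont_on 0 1 (fun x => p * x + q) by exact: cont_on_affine.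
have cS := @cont_on_Xsum co ce n.
rewrite itgD; [|by apply: intbZ; exact: cont_on_intb|exact: cont_on_intb].
rewrite itgZ; last exact: cont_on_intb.
rewrite itg_affine (@eq_itg _ _ _ _ (fun x => Xsum beta co ce n x * 1)); last first.
  by move=> x _; rewrite mulr1.
rewrite itg_Xsum_mul; last exact: cont_on_cst.
transitivity (c0 * (1 / 2) + 0); last by rewrite addr0 mul1r.
congr (_ + _); rewrite big_nat big1// => k /andP[k0 _].
rewrite (@eq_itg _ _ _ _ (Xo beta k)); last by move=> x _; rewrite mulr1.
rewrite (@eq_itg _ _ _ (fun x => sin (lam R k * x) * 1) (fun x => sin (lam R k * x))); last first.
  by move=> x _; rewrite mulr1.
by rewrite itg_Xo// itg_sin_lam !mulr0 addr0.
Qed.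

Lemma itg_lim (G : nat -> R -> R) g w (l : R) N0 : (forall n, cont_on 0 1 (G n)) ->
  cont_on 0 1 g -> cont_on 0 1 w -> ucvg [set x | 0 <= x <= 1] G g ->
  (forall n, (N0 <= n)%N -> itg 0 1 (fun x => w x * G n x) = l) ->
  itg 0 1 (fun x => w x * g x) = l.
Proof.
move=> cG cg cw Gg Gl; apply/eqP; rewrite -subr_eq0 -normr_le0.
have [K K0 wK] := cont_on_bounded cw.
apply/ler_addgt0Pl => e e0; rewrite addr0.
have K1 : 0 < K + 1 by rewrite ltr_wpDl.
have e1 : 0 < e / (K + 1) by rewrite divr_gt0.
have [N HN] := Gg _ e1; pose n := maxn N N0.
rewrite -(Gl n (leq_maxr _ _)) -itgB; last 2 first.
- by apply: cont_on_intb; exact: cont_onM.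
- by apply: cont_on_intb; exact: cont_onM.
have -> : e = e * (1 - 0) by rewrite subr0 mulr1.
apply: itg_bound => //; first by apply: intbB; apply: cont_on_intb; exact: cont_onM.
move=> x x01; rewrite -mulrBr normrM distrC.
apply: (@le_trans _ _ (K * (e / (K + 1)))).
  by apply: ler_pM => //; [exact: wK|apply: HN => //; exact: leq_maxl].
rewrite mulrCA ler_piMr ?(ltW e0)// ler_pdivrMr// mul1r; lra.
Qed.

(** From n >= j on the partial sums have exactly the j-th coefficients prescribed, and integration
    against a continuous weight passes to a uniform limit. *)
Lemma limit_coefs (c0 : R) co ce g :
  ucvg [set x | 0 <= x <= 1] (fun n x => c0 * (p * x + q) + Xsum beta co ce n x) g ->
  [/\ cont_on 0 1 g, itg 0 1 g = c0 / 2 & forall j, (0 < j)%N ->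
     codd g j = co j /\ ceven beta g j = ce j].
Proof.
move=> Sg.
have cS n : cont_on 0 1 (fun x => c0 * (p * x + q) + Xsum beta co ce n x).
  by apply: cont_onD; [apply: cont_onZ; exact: cont_on_affine|exact: cont_on_Xsum].
have cg : cont_on 0 1 g by exact: cont_on_unif Sg.
split => // [|j j0].
  have := @itg_lim _ g (fun=> 1) (c0 / 2) 0 cS cg (@cont_on_cst R 0 1 1) Sg.
  move=> <-; first by apply: eq_itg => x _; rewrite mul1r.
  move=> n _; rewrite -(itg_Xsum c0 co ce n).
  by apply: eq_itg => x _; rewrite mul1r.
split.
  have := @itg_lim _ g (fun x => cos (lam R j * x)) (co j / 4) j cS cg (@cont_on_cosZ R 0 1 _) Sg.
  rewrite /codd => H; rewrite (@eq_itg _ _ _ _ (fun x => cos (lam R j * x) * g x)); last first.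
    by move=> x _; rewrite mulrC.
  rewrite H; first by field.
  move=> n jn; have [<- _] := @Xsum_coefs c0 co ce n j j0 jn; rewrite /codd.
  rewrite mulrAC divff ?mul1r//.
  by apply: eq_itg => x _; rewrite mulrC.
have cw : cont_on 0 1 (fun x => L x * sin (lam R j * x)).
  by apply: cont_onM; [exact: cont_on_Lb|exact: cont_on_sinZ].
have := @itg_lim _ g (fun x => L x * sin (lam R j * x)) (ce j / 4) j cS cg cw Sg.
rewrite /ceven => H; rewrite (@eq_itg _ _ _ _ (fun x => L x * sin (lam R j * x) * g x)); last first.
  by move=> x _; ring.
rewrite H; first by field.
move=> n jn; have [_ <-] := @Xsum_coefs c0 co ce n j j0 jn; rewrite /ceven.
rewrite mulrAC divff ?mul1r//.
by apply: eq_itg => x _; ring.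
Qed.

(** The even part of d about 1/2 has vanishing cosine coefficients, hence is 0. So d is odd about
    1/2, and then only the average 1/2 of L matters: the weighted sine coefficients are half the
    plain ones, which must vanish too. *)
Lemma biorth_complete d : cont_on 0 1 d -> itg 0 1 d = 0 ->
  (forall j, (0 < j)%N -> codd d j = 0 /\ ceven beta d j = 0) ->
  forall x, 0 <= x <= 1 -> d x = 0.
Proof.
move=> cd d0 dj.
have cdr := cont_on_refl cd.
have dcos k : itg 0 1 (fun x => d x * cos (lam R k * x)) = 0.
  case: k => [|k]; last first.
    by have [+ _] := dj k.+1 isT; rewrite /codd => /eqP; rewrite mulf_eq0 pnatr_eq0 => /eqP.
  by rewrite -[RHS]d0; apply: eq_itg => x _; rewrite lam0 mul0r cos0 mulr1.
have dsym x : 0 <= x <= 1 -> d x + d (1 - x) = 0.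
  apply: (trig_complete (d := fun x => d x + d (1 - x))); first exact: cont_onD.
    move=> k.
    have c2 : cont_on 0 1 (fun x => d x * cos (lam R k * x)).
      by apply: cont_onM => //; exact: cont_on_cosZ.
    rewrite (@eq_itg _ _ _ _ (fun x => d x * cos (lam R k * x) +
       d (1 - x) * cos (lam R k * (1 - x)))); last by move=> y _; rewrite cos_lam_refl mulrDl.
    rewrite itgD; [|exact: cont_on_intb|apply: cont_on_intb; exact: (cont_on_refl c2)].
    by rewrite (itg_refl c2) dcos addr0.
  move=> k; apply: itg_odd.
    by apply: cont_onM; [exact: cont_onD|exact: cont_on_sinZ].
  move=> y; rewrite sin_lam_refl (_ : 1 - (1 - y) = y); last by ring.
  by rewrite (addrC (d (1 - y))) mulrN.
apply: (trig_complete (d := d)) => // k.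
case: k => [|k].
  rewrite (@eq_itg _ _ _ _ (fun=> 0)) ?itg_cst ?mul0r//.
  by move=> x _; rewrite lam0 mul0r sin0 mulr0.
have [_] := dj k.+1 isT; rewrite /ceven => /eqP; rewrite mulf_eq0 pnatr_eq0/= => /eqP.
have cL : cont_on 0 1 (fun x => L x * d x * sin (lam R k.+1 * x)).
  by apply: cont_onM; [apply: cont_onM => //; exact: cont_on_Lb|exact: cont_on_sinZ].
rewrite (itg_sym cL) (@eq_itg _ _ _ _ (fun x => d x * sin (lam R k.+1 * x))); last first.
  move=> x x01; rewrite sin_lam_refl.
  have -> : d (1 - x) = - d x by have := dsym x x01; lra.
  transitivity ((L x + L (1 - x)) * (d x * sin (lam R k.+1 * x))); first by ring.
  by rewrite Lb_sum mul1r.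
by move=> /eqP; rewrite mulf_eq0 mulf_eq0 oner_eq0 invr_eq0 pnatr_eq0/= => /eqP.
Qed.

End Biorthogonality.

(** * Uniform convergence of expansions on the rectangle *)

Definition ucvg_DT (R : realType) (T : R) (G : nat -> R -> R -> R) (g : R -> R -> R) : Prop :=
  forall e : R, 0 < e -> exists N, forall n, (N <= n)%N ->
    forall x t, 0 <= x <= 1 -> 0 <= t <= T -> `|G n x t - g x t| <= e.

Section WeierstrassTest.
Variable R : realType.
Implicit Types (e C : R).

Lemma sum_norm_tail (u w : nat -> R) e C N m n : 0 <= e -> (0 < N)%N -> (N <= m)%N ->
  \sum_(N <= k < n) (lam R k ^+ 2)^-1 <= e ->
  \sum_(1 <= k < n) w k ^+ 2 <= C ->
  (forall k, (0 < k)%N -> `|u k| <= (lam R k)^-1 * `|w k|) ->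
  `|\sum_(m <= k < n) u k| <= Num.sqrt (e * C).
Proof.
move=> e0 N0 Nm He HC uw.
apply: (@le_trans _ _ (\sum_(m <= k < n) (lam R k)^-1 * `|w k|)).
  apply: le_trans (ler_norm_sum _ _ _) _; rewrite !big_nat; apply: ler_sum => k /andP[mk _].
  by apply: uw; apply: leq_trans mk; exact: leq_trans Nm.
apply: le_trans (ler_norm _) _; rewrite -sqrtr_sqr ler_wsqrtr//.
apply: le_trans (sum_cauchy_schwarz _ _ _ _) _.
have sub (v : nat -> R) a : (a <= m)%N -> (forall k, 0 <= v k) ->
    \sum_(m <= k < n) v k <= \sum_(a <= k < n) v k.
  move=> am v0; have [mn|nm] := leqP m n.
    by rewrite (big_cat_nat am mn)/= lerDr sumr_ge0.
  by rewrite big_geq ?sumr_ge0// ltnW.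
apply: ler_pM; [exact: sum_sqr_ge0|exact: sum_sqr_ge0| |].
  apply: le_trans He; rewrite (eq_bigr (fun k => (lam R k ^+ 2)^-1)); last first.
    by move=> k _; rewrite exprVn.
  by apply: sub => // k; rewrite invr_ge0 sqr_ge0.
apply: le_trans HC; rewrite (eq_bigr (fun k => w k ^+ 2)); last first.
  by move=> k _; rewrite real_normK// num_real.
by apply: sub => [|k]; [exact: leq_trans Nm|exact: sqr_ge0].
Qed.

(** The terms need not have a summable majorant independent of x. The square sums of w are only
    bounded uniformly, and Cauchy-Schwarz lets the tail of the series of lam_k^-2 supply the
    uniformity. *)
Lemma l2_ucauchy (X : Type) (A : set X) (u w : nat -> X -> R) C :
  (forall n x, A x -> \sum_(1 <= k < n.+1) w k x ^+ 2 <= C) ->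
  (forall k x, (0 < k)%N -> A x -> `|u k x| <= (lam R k)^-1 * `|w k x|) ->
  exists g, ucvg A (fun n x => \sum_(1 <= k < n.+1) u k x) g.
Proof.
move=> wC uw; apply: ucauchy_ucvg => e e0.
have C1 : 0 < `|C| + 1 by rewrite ltr_wpDl.
have [N [N0 HN]] := @lam_tail R (e ^+ 2 / (`|C| + 1)) (divr_gt0 (exprn_gt0 2 e0) C1).
have main m n x : (N <= m)%N -> (m <= n)%N -> A x ->
    `|\sum_(1 <= k < n.+1) u k x - \sum_(1 <= k < m.+1) u k x| <= e.
  move=> Nm mn Ax; rewrite (@big_cat_nat _ _ _ m.+1 1 n.+1)//= addrAC subrr add0r.
  have := @sum_norm_tail (u^~ x) (w^~ x) (e ^+ 2 / (`|C| + 1)) (`|C| + 1) N m.+1 n.+1.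
  rewrite divfK ?gt_eqF// sqrtr_sqr (ger0_norm (ltW e0)); apply => //.
  - by rewrite ltW// divr_gt0// exprn_gt0.
  - exact: leqW.
  - by apply: le_trans (wC n x Ax) _; have := ler_norm C; lra.
  - by move=> k k0; exact: uw.
exists N => m n Nm Nn x Ax; have [mn|/ltnW nm] := leqP m n; last exact: main.
by rewrite distrC; exact: main.
Qed.

End WeierstrassTest.

Section Expansion.
Variables (R : realType) (T beta : R).
Hypotheses (T_gt0 : 0 < T) (beta_neqN1 : beta <> -1).
Implicit Types (x t : R) (co ce : nat -> R -> R) (g : R -> R -> R).
Local Notation p := (pc beta).
Local Notation q := (qc beta).
Local Notation L := (Lb beta).

Lemma affine_bound x : 0 <= x <= 1 -> `|p * x + q| <= `|p| + `|q|.
Proof.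
move=> /andP[x0 x1]; apply: le_trans (ler_normD _ _) _; rewrite lerD2r normrM.
by rewrite (ger0_norm x0) ler_piMr.
Qed.

Lemma Xo_bound k x : 0 <= x <= 1 -> `|Xo beta k x| <= `|p| + `|q|.
Proof.
move=> x01; rewrite /Xo normrM -[leRHS]mulr1.
by apply: ler_pM => //; [exact: affine_bound|exact: cos_le1_norm].
Qed.

Lemma sin_le1_norm x : `|sin x| <= 1.
Proof. by rewrite ler_norml sin_geN1 sin_le1. Qed.

Lemma Xsum_ucvg co ce (C : R) :
  (forall n t, 0 <= t <= T -> \sum_(1 <= k < n.+1) (lam R k * co k t) ^+ 2 <= C) ->
  (forall n t, 0 <= t <= T -> \sum_(1 <= k < n.+1) (lam R k * ce k t) ^+ 2 <= C) ->
  exists g, ucvg_DT T (fun n x t => Xsum beta (co^~ t) (ce^~ t) n x) g.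
Proof.
move=> Hco Hce; pose K : R := `|p| + `|q|.
have K0 : 0 <= K by rewrite addr_ge0.
have [||g gE] := @l2_ucauchy R (R * R)%type [set z | 0 <= z.1 <= 1 /\ 0 <= z.2 <= T]
  (fun k z => co k z.2 * Xo beta k z.1 + ce k z.2 * sin (lam R k * z.1))
  (fun k z => K * `|lam R k * co k z.2| + `|lam R k * ce k z.2|) (2 * K ^+ 2 * C + 2 * C).
- move=> n [x t]/= [_ tT].
  apply: (@le_trans _ _ (2 * K ^+ 2 * (\sum_(1 <= k < n.+1) (lam R k * co k t) ^+ 2) +
      2 * \sum_(1 <= k < n.+1) (lam R k * ce k t) ^+ 2)); last first.
    apply: lerD; first by apply: ler_wpM2l; [rewrite mulr_ge0 ?sqr_ge0|exact: Hco].
    by apply: ler_wpM2l => //; exact: Hce.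
  rewrite !mulr_sumr -big_split/=; apply: ler_sum => k _.
  set a := lam R k * co k t; set b := lam R k * ce k t.
  rewrite -(real_normK (num_real a)) -(real_normK (num_real b)).
  have := sqr_ge0 (K * `|a| - `|b|); nra.
- move=> k [x t]/= k0 [x01 tT].
  have l0 := lam_gt0 R k0.
  rewrite (ger0_norm (_ : 0 <= K * _ + _)); last by rewrite addr_ge0// mulr_ge0.
  rewrite !(normrM (lam R k)) (gtr0_norm l0).
  have -> : (lam R k)^-1 * (K * (lam R k * `|co k t|) + lam R k * `|ce k t|) =
    `|co k t| * K + `|ce k t| * 1 by field; rewrite gt_eqF.
  apply: le_trans (ler_normD _ _) _; rewrite (normrM (co k t)) (normrM (ce k t)); apply: lerD.
    by apply: ler_wpM2l => //; exact: Xo_bound.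
  by apply: ler_wpM2l => //; exact: sin_le1_norm.
exists (fun x t => g (x, t)) => e e0; have [N HN] := gE e e0.
by exists N => n Nn x t x01 tT; apply: (HN n Nn (x, t)).
Qed.

Lemma ucvg_DT_x G g t : ucvg_DT T G g -> 0 <= t <= T ->
  ucvg [set x | 0 <= x <= 1] (fun n x => G n x t) (fun x => g x t).
Proof. by move=> H tT e e0; have [N HN] := H e e0; exists N => n Nn x x01; exact: HN. Qed.

Lemma ucvg_DT_t G g x : ucvg_DT T G g -> 0 <= x <= 1 ->
  ucvg [set t | 0 <= t <= T] (fun n => G n x) (g x).
Proof. by move=> H tT e e0; have [N HN] := H e e0; exists N => n Nn t tt; exact: HN. Qed.

Lemma eq_ucvg_DT G g h : (forall x t, 0 <= x <= 1 -> 0 <= t <= T -> g x t = h x t) ->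
  ucvg_DT T G g -> ucvg_DT T G h.
Proof.
move=> gh H e e0; have [N HN] := H e e0; exists N => n Nn x t x01 tT.
by rewrite -gh//; exact: HN.
Qed.

Lemma intb1_sqr_bound (w : R -> R) (K : R) : 0 <= K -> cont_on 0 1 w ->
  (forall x, 0 <= x <= 1 -> `|w x| <= K) -> itg 0 1 (fun x => w x ^+ 2) <= K ^+ 2.
Proof.
move=> K0 cw wK; have -> : K ^+ 2 = K ^+ 2 * (1 - 0) by rewrite subr0 mulr1.
rewrite -itg_cst//; apply: le_itg.
- by apply: cont_on_intb; rewrite (_ : (fun x => _) = (fun x => w x * w x))//; exact: cont_onM.
- by apply: cont_on_intb; exact: cont_on_cst.
- by move=> x x01; rewrite -(real_normK (num_real (w x))) lerXn2r ?nnegrE//; exact: wK.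
Qed.

Lemma coddB (g h : R -> R) k : intb 0 1 g -> intb 0 1 h ->
  codd (fun x => g x - h x) k = codd g k - codd h k.
Proof.
move=> ig ih; rewrite /codd -mulrBr -itgB; [|exact: intb_cos|exact: intb_cos].
by congr (_ * _); apply: eq_itg => x _; rewrite mulrBl.
Qed.

Lemma cevenB (g h : R -> R) k : intb 0 1 g -> intb 0 1 h ->
  ceven beta (fun x => g x - h x) k = ceven beta g k - ceven beta h k.
Proof.
move=> ig ih; have cL := @cont_on_Lb R beta 0 1.
rewrite /ceven -mulrBr -itgB; last 2 first.
- by apply: intb_sin; exact: intbM_cont.
- by apply: intb_sin; exact: intbM_cont.
by congr (_ * _); apply: eq_itg => x _; ring.
Qed.

(** One derivative makes lam_k times the coefficients square summable uniformly in t, so the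
    expansion converges to some G; G and g have the same coefficients and are equal by
    [biorth_complete]. *)
Lemma expansion_ucvg g gx : cont_DT T g -> deriv_x T g gx -> cont_DT T gx ->
  (forall t, 0 <= t <= T -> g 0 t = beta * g 1 t) ->
  (forall t, 0 <= t <= T -> itg 0 1 (g^~ t) = 0) ->
  ucvg_DT T (fun n x t => Xsum beta (codd (g^~ t)) (ceven beta (g^~ t)) n x) g.
Proof.
move=> cg dg cgx gbc g0.
have [Kg Kg0 gK] := cont_DT_bounded T_gt0 cg.
have [K1 K10 gxK] := cont_DT_bounded T_gt0 cgx.
have cL := @cont_on_Lb R beta 0 1.
have [KL KL0 LK] := cont_on_bounded cL.
pose K2 := KL * K1 + `|p| * Kg.
have K20 : 0 <= K2 by rewrite addr_ge0// mulr_ge0.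
have ac t : 0 <= t <= T -> AC (g^~ t) (gx^~ t).
  by move=> tT; apply: deriv_on_AC; [exact: dg|exact: cont_DT_x].
have cw t : 0 <= t <= T -> cont_on 0 1 (fun x => L x * gx x t - p * g x t).
  move=> tT; apply: cont_onB; last by apply: cont_onZ; exact: cont_DT_x.
  by apply: cont_onM => //; exact: cont_DT_x.
have [|n t tT|G HG] := @Xsum_ucvg (fun k t => codd (g^~ t) k) (fun k t => ceven beta (g^~ t) k)
  (8 * K1 ^+ 2 + 8 * K2 ^+ 2).
- move=> n t tT; apply: le_trans (codd1_bound _ (ac t tT) _) _.
    by apply: cont_on_L2b; exact: cont_DT_x.
  apply: ler_wpDr; first by rewrite mulr_ge0// sqr_ge0.
  rewrite ler_pM2l//; apply: intb1_sqr_bound => //; first exact: cont_DT_x.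
  by move=> x x01; exact: gxK.
- apply: le_trans (ceven1_bound beta_neqN1 _ (ac t tT) _ (gbc t tT)) _.
    by apply: cont_on_L2b; exact: cw.
  apply: ler_wpDl; first by rewrite mulr_ge0// sqr_ge0.
  rewrite ler_pM2l//; apply: intb1_sqr_bound => //; first exact: cw.
  move=> x x01; apply: le_trans (ler_normB _ _) _; rewrite (normrM (L x)) (normrM p).
  apply: lerD; first by apply: ler_pM => //; [exact: LK|exact: gxK].
  by apply: ler_wpM2l => //; exact: gK.
apply: (eq_ucvg_DT _ HG) => x t x01 tT.
have [|cG iG eG] := @limit_coefs R beta beta_neqN1 0 (codd (g^~ t)) (ceven beta (g^~ t)) (G^~ t).
  move=> e e0; have [N HN] := HG e e0; exists N => n Nn y y01.
  by rewrite mul0r add0r; exact: HN.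
have cgt := cont_DT_x cg tT.
have iG1 := cont_on_intb cG; have ig1 := cont_on_intb cgt.
apply/eqP; rewrite -subr_eq0; apply/eqP.
apply: (@biorth_complete R beta beta_neqN1 (fun x => G x t - g x t)) => //.
- exact: cont_onB.
- by rewrite itgB// g0// iG mul0r subrr.
- by move=> j j0; have [e1 e2] := eG j j0; rewrite coddB// cevenB// e1 e2 !subrr.
Qed.

End Expansion.

(** * Bounds on the data *)

(* The right-hand side of [mode_bound] for l = lam k. *)
Definition mode_size (R : realType) (T d1 d2 : R) (k : nat) (ph ps : R) (F : R -> R) : R :=
  rho d1 d2 * (1 + d2) * `|ph| + rho d1 d2 * (1 + d1) * `|ps| / lam R k
  + Mc d1 d2 / lam R k * itg 0 T (fun t => `|F t|).

Section Data.
Variables (R : realType) (T beta d1 d2 : R).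
Hypotheses (T_gt0 : 0 < T) (beta_neqN1 : beta <> -1).
Hypotheses (d10 : 0 <= d1) (d20 : 0 <= d2) (d12 : d1 + d2 < 1 + d1 * d2).
Variables (phi phi1 phi2 phi3 psi psi1 psi2 : R -> R) (f fx fxx : R -> R -> R).
Hypotheses (phi_d1 : deriv_on 0 1 phi phi1) (phi_d2 : deriv_on 0 1 phi1 phi2)
  (phi_C2 : cont_on 0 1 phi2) (phi_d3 : L2_deriv phi2 phi3)
  (phi_bc : phi 0 = beta * phi 1) (phi1_bc : phi1 0 = phi1 1)
  (phi2_bc : phi2 0 = beta * phi2 1)
  (psi_d1 : deriv_on 0 1 psi psi1)
  (psi_C1 : cont_on 0 1 psi1) (psi_d2 : L2_deriv psi1 psi2)
  (psi_bc : psi 0 = beta * psi 1) (psi1_bc : psi1 0 = psi1 1)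
  (f_C : cont_DT T f) (f_dx : deriv_x T f fx) (fx_C : cont_DT T fx)
  (f_dxx : L2_deriv_x T fx fxx)
  (f_bc : forall t : R, 0 <= t <= T -> f 0 t = beta * f 1 t)
  (fx_bc : forall t : R, 0 <= t <= T -> fx 0 t = fx 1 t).
Implicit Types (t x : R) (g : R -> R -> R) (h : R -> R).
Local Notation p := (pc beta).
Local Notation q := (qc beta).
Local Notation L := (Lb beta).
Local Notation rh := (rho d1 d2).
Local Notation M := (Mc d1 d2).

(** The division by lam_k in [mode_size] explains the weights: three powers of lam_k fall on phi,
    but only two on psi and f. *)
Lemma l2n_mode_size (ph ps : nat -> R) (F : nat -> R -> R) (a b c : R) n :
  l2n (fun k => lam R k ^+ 3 * ph k) n <= a ->
  l2n (fun k => lam R k ^+ 2 * ps k) n <= b ->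
  l2n (fun k => itg 0 T (fun t => `|lam R k ^+ 2 * F k t|)) n <= c ->
  (forall k, cont_on 0 T (F k)) ->
  l2n (fun k => lam R k ^+ 3 * mode_size T d1 d2 k (ph k) (ps k) (F k)) n <=
  rh * (1 + d2) * a + rh * (1 + d1) * b + M * c.
Proof.
move=> Ha Hb Hc cF.
have rh0 := rho_gt0 d12; have M1 := Mc_ge1 d10 d20 d12.
have r1 : 0 <= rh * (1 + d1) by rewrite mulr_ge0 ?(ltW rh0)// addr_ge0.
have r2 : 0 <= rh * (1 + d2) by rewrite mulr_ge0 ?(ltW rh0)// addr_ge0.
have M0 : 0 <= M by rewrite (le_trans _ M1).
apply: (@le_trans _ _ (l2n (fun k => (rh * (1 + d2) * `|lam R k ^+ 3 * ph k| +
   rh * (1 + d1) * `|lam R k ^+ 2 * ps k|) + M * itg 0 T (fun t => `|lam R k ^+ 2 * F k t|)) n)).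
  apply: le_l2n => k k0; rewrite le_eqVlt; apply/orP; left; apply/eqP; congr (`|_|).
  have l0 := lam_gt0 R k0.
  rewrite (@eq_itg _ _ _ _ (fun t => lam R k ^+ 2 * `|F k t|)); last first.
    by move=> t _; rewrite normrM ger0_norm// exprn_ge0// ltW.
  rewrite itgZ; last by apply: cont_on_intb; exact: cont_on_norm.
  rewrite (normrM (lam R k ^+ 3)) (normrM (lam R k ^+ 2)).
  rewrite (ger0_norm (exprn_ge0 3 (ltW l0))) (ger0_norm (exprn_ge0 2 (ltW l0))).
  by rewrite /mode_size; field; rewrite gt_eqF.
have nrm (v : nat -> R) m : l2n (fun k => `|v k|) m = l2n v m.
  by rewrite /l2n; congr (Num.sqrt _); apply: eq_bigr => k _; rewrite real_normK// num_real.
apply: le_trans (l2nD _ _ _) _; apply: lerD; last first.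
  by rewrite l2nZ (ger0_norm M0) ler_wpM2l.
by apply: le_trans (l2nD _ _ _) _; rewrite !l2nZ !nrm; apply: lerD;
  [rewrite (ger0_norm r2)|rewrite (ger0_norm r1)]; rewrite ler_wpM2l.
Qed.

Lemma l2n_L2norm (u : nat -> R) (g : R -> R) n : intb 0 1 (fun x => g x ^+ 2) ->
  \sum_(1 <= k < n.+1) u k ^+ 2 <= 8 * itg 0 1 (fun x => g x ^+ 2) ->
  l2n u n <= 2 * Num.sqrt 2 * L2norm g.
Proof.
move=> ig H; apply: l2n_le; first by rewrite mulr_ge0 ?L2norm_ge0// mulr_ge0// sqrtr_ge0.
rewrite !exprMn sqr_sqrtr// L2norm_sqr//.
by apply: le_trans H _; rewrite le_eqVlt; apply/orP; left; apply/eqP; ring.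
Qed.

Lemma cont_on_codd g k : cont_DT T g -> cont_on 0 T (fun t => codd (g^~ t) k).
Proof.
move=> cg; apply: cont_onZ; apply: (@cont_on_itg R T (fun x t => g x t * cos (lam R k * x))).
by apply: cont_DTM => //; apply: cont_on_DT_x; exact: cont_on_cosZ.
Qed.

Lemma cont_on_ceven g k : cont_DT T g -> cont_on 0 T (fun t => ceven beta (g^~ t) k).
Proof.
move=> cg; apply: cont_onZ.
apply: (@cont_on_itg R T (fun x t => L x * g x t * sin (lam R k * x))).
apply: cont_DTM; last by apply: cont_on_DT_x; exact: cont_on_sinZ.
by apply: cont_DTM => //; apply: cont_on_DT_x; exact: cont_on_Lb.
Qed.

Let L2phi3 : L2b phi3. Proof. by apply: L2_L2b; case: phi_d3. Qed.
Let L2psi2 : L2b psi2. Proof. by apply: L2_L2b; case: psi_d2. Qed.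
Let ACphi : AC phi phi1.
Proof. by apply: deriv_on_AC => //; exact: deriv_on_cont phi_d2. Qed.
Let ACphi1 : AC phi1 phi2. Proof. exact: deriv_on_AC. Qed.
Let ACphi2 : AC phi2 phi3.
Proof. by split; [case: L2phi3|case: phi_d3]. Qed.
Let ACpsi : AC psi psi1. Proof. exact: deriv_on_AC. Qed.
Let ACpsi1 : AC psi1 psi2.
Proof. by split; [case: L2psi2|case: psi_d2]. Qed.
Let sfxx : sq_DT T fxx. Proof. by apply: L2_DT_sq => //; case: f_dxx. Qed.
Let ACf t : 0 <= t <= T -> AC (f^~ t) (fx^~ t).
Proof. by move=> tT; apply: deriv_on_AC; [exact: f_dx|exact: cont_DT_x]. Qed.
Let ACfx : {ae @lebesgue_measure R, forall t : R, 0 <= t <= T ->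
  AC (fx^~ t) (fxx^~ t) /\ L2b (fxx^~ t)}.
Proof.
have := sq_DT_ae sfxx; case: f_dxx => _.
apply: filterS2; first exact: (ae_filter_ringOfSetsType (@lebesgue_measure R)).
move=> t H1 H2 tT.
by split; [split; [case: (H2 tT)|exact: H1]|exact: H2].
Qed.

Let Lw (g h : R -> R) (c : R) : L2b g -> cont_on 0 1 h -> L2b (fun x => L x * g x - c * h x).
Proof.
move=> Lg ch; apply: (L2bD (h := fun x => - (c * h x))).
  by apply: L2bM_cont => //; exact: cont_on_Lb.
by apply: cont_on_L2b; apply: cont_onN; exact: cont_onZ.
Qed.

Definition odd_size k := mode_size T d1 d2 k (codd phi k) (codd psi k) (fun t => codd (f^~ t) k).
Definition even_size k := mode_size T d1 d2 k (ceven beta phi k) (ceven beta psi k)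
  (fun t => ceven beta (f^~ t) k).

(** Bessel's inequality yields 2 sqrt 2 where A_2 has 4 sqrt 2, and likewise for f. The half left
    over is used in the final norm count. *)
Lemma odd_size_bound n :
  l2n (fun k => lam R k ^+ 3 * odd_size k) n <= A2 T d1 d2 phi3 psi2 fxx / 2.
Proof.
have H1 : l2n (fun k => lam R k ^+ 3 * codd phi k) n <= 2 * Num.sqrt 2 * L2norm phi3.
  by apply: l2n_L2norm; [case: L2phi3|exact: codd3_bound ACphi ACphi1 ACphi2 _ _].
have H2 : l2n (fun k => lam R k ^+ 2 * codd psi k) n <= 2 * Num.sqrt 2 * L2norm psi2.
  by apply: l2n_L2norm; [case: L2psi2|exact: codd2_bound ACpsi ACpsi1 _ _].
have H3 : l2n (fun k => itg 0 T (fun t => `|lam R k ^+ 2 * codd (f^~ t) k|)) n <=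
    2 * Num.sqrt (2 * T) * L2norm_DT T fxx.
  apply: (itg_abs_bound T_gt0 (u := fun k t => lam R k ^+ 2 * codd (f^~ t) k)) => //.
    by move=> k; apply: cont_onZ; exact: cont_on_codd.
  apply: filterS ACfx; first exact: (ae_filter_ringOfSetsType (@lebesgue_measure R)).
  move=> t H tT; have [H4 H5] := H tT.
  exact: codd2_bound (ACf tT) H4 H5 (fx_bc tT).
apply: le_trans (@l2n_mode_size (codd phi) (codd psi) (fun k t => codd (f^~ t) k) _ _ _ n
  H1 H2 H3 (fun k => cont_on_codd (k := k) f_C)) _.
by rewrite /A2 le_eqVlt; apply/orP; left; apply/eqP; field.
Qed.

(** Here 2 sqrt 2 <= 4 is compared with half of the coefficients 8 of A_3. The boundary terms of L
    phi and its derivatives cancel by the conditions with beta and the periodicity of phi'. *)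
Lemma even_size_bound n :
  l2n (fun k => lam R k ^+ 3 * even_size k) n <=
  A3 T beta d1 d2 phi2 phi3 psi1 psi2 fx fxx / 2.
Proof.
pose w1 x := phi3 x * (1 - q - p * x) - 3 * p * phi2 x.
pose w2 x := psi2 x * (1 - q - p * x) - 2 * p * psi1 x.
pose w3 x t := fxx x t * (1 - q - p * x) - 2 * p * fx x t.
have E1 : w1 = (fun x => L x * phi3 x - 3 * p * phi2 x) by apply/funext => x; rewrite /w1 mulrC.
have E2 : w2 = (fun x => L x * psi2 x - 2 * p * psi1 x) by apply/funext => x; rewrite /w2 mulrC.
have L1 : L2b w1 by rewrite E1; apply: Lw.
have L2 : L2b w2 by rewrite E2; apply: Lw.
have H1 : l2n (fun k => lam R k ^+ 3 * ceven beta phi k) n <= 2 * Num.sqrt 2 * L2norm w1.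
  apply: l2n_L2norm; [by case: L1|rewrite E1].
  by apply: (ceven3_bound _ _ ACphi ACphi1 ACphi2) => //; rewrite -E1.
have H2 : l2n (fun k => lam R k ^+ 2 * ceven beta psi k) n <= 2 * Num.sqrt 2 * L2norm w2.
  apply: l2n_L2norm; [by case: L2|rewrite E2].
  by apply: (ceven2_bound _ _ ACpsi ACpsi1) => //; rewrite -E2.
have H3 : l2n (fun k => itg 0 T (fun t => `|lam R k ^+ 2 * ceven beta (f^~ t) k|)) n <=
    2 * Num.sqrt (2 * T) * L2norm_DT T w3.
  apply: (itg_abs_bound T_gt0 (u := fun k t => lam R k ^+ 2 * ceven beta (f^~ t) k)) => //.
  - by apply: (sq_DT_weight T_gt0) => //; exact: cont_on_Lb.
  - by move=> k; apply: cont_onZ; exact: cont_on_ceven.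
  apply: filterS ACfx; first exact: (ae_filter_ringOfSetsType (@lebesgue_measure R)).
  move=> t H tT; have [H4 H5] := H tT.
  rewrite (@eq_itg _ _ _ _ (fun x => (L x * fxx x t - 2 * p * fx x t) ^+ 2)); last first.
    by move=> x _; rewrite /w3 (mulrC (fxx x t)).
  apply: (ceven2_bound beta_neqN1 n (ACf tT) H4); last exact: f_bc.
  by apply: Lw => //; exact: cont_DT_x.
apply: le_trans (@l2n_mode_size (ceven beta phi) (ceven beta psi) (fun k t => ceven beta (f^~ t) k)
  _ _ _ n H1 H2 H3 (fun k => cont_on_ceven (k := k) f_C)) _.
have rh0 := rho_gt0 d12; have M1 := Mc_ge1 d10 d20 d12.
have r1 : 0 <= rh * (1 + d1) by rewrite mulr_ge0 ?(ltW rh0)// addr_ge0.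
have r2 : 0 <= rh * (1 + d2) by rewrite mulr_ge0 ?(ltW rh0)// addr_ge0.
have M0 : 0 <= M by rewrite (le_trans _ M1).
have n1 := L2norm_ge0 w1; have n2 := L2norm_ge0 w2.
have n3 : 0 <= L2norm_DT T w3 by rewrite /L2norm_DT fine_ge0// Lnorm_ge0.
have n4 : 0 <= L2norm_DT T fxx by rewrite /L2norm_DT fine_ge0// Lnorm_ge0.
have n5 := L2norm_ge0 phi3; have n6 := L2norm_ge0 psi2.
have T0 := ltW T_gt0.
have rh0' := ltW rh0.
have [g1 g2] : 0 <= rho1 T d1 d2 /\ 0 <= rho2 T d1 d2.
  by split; rewrite /rho1 /rho2;
    repeat first [done | rewrite invr_ge0 | apply: addr_ge0 | apply: mulr_ge0 | apply: exprn_ge0].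
rewrite /A3 -/w1 -/w2 -/w3 sqrtrM//.
set sT := Num.sqrt T; set s2 := Num.sqrt 2.
have s20 : 0 <= s2 by exact: sqrtr_ge0.
have sT0 : 0 <= sT by exact: sqrtr_ge0.
have s2le : s2 <= 2.
  have s2E : s2 ^+ 2 = 2 by rewrite sqr_sqrtr.
  rewrite leNgt; apply/negP => s2gt.
  by have := @ltrXn2r R 2 2 s2 (ler0n _ 2) s2gt; rewrite s2E/=; lra.
have x1 : 0 <= rh * (1 + d2) * L2norm w1 by rewrite mulr_ge0.
have x2 : 0 <= rh * (1 + d1) * L2norm w2 by rewrite mulr_ge0.
have x3 : 0 <= M * (sT * L2norm_DT T w3) by rewrite mulr_ge0// mulr_ge0.
have x4 : 0 <= rho1 T d1 d2 * L2norm phi3 by rewrite mulr_ge0.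
have x5 : 0 <= rho2 T d1 d2 * L2norm psi2 by rewrite mulr_ge0.
have x6 : 0 <= M ^+ 2 * T * sT * L2norm_DT T fxx.
  by rewrite mulr_ge0// mulr_ge0// mulr_ge0// sqr_ge0.
have y1 : s2 * (rh * (1 + d2) * L2norm w1) <= 2 * (rh * (1 + d2) * L2norm w1) by rewrite ler_wpM2r.
have y2 : s2 * (rh * (1 + d1) * L2norm w2) <= 2 * (rh * (1 + d1) * L2norm w2) by rewrite ler_wpM2r.
have y3 : s2 * (M * (sT * L2norm_DT T w3)) <= 2 * (M * (sT * L2norm_DT T w3)) by rewrite ler_wpM2r.
lra.
Qed.

End Data.

(** * A bound on the slope p *)

Section WeightBound.
Variables (R : realType) (beta : R).
Hypothesis beta_neqN1 : beta <> -1.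
Implicit Types (x s t : R) (v w : R -> R).
Local Notation p := (pc beta).
Local Notation q := (qc beta).
Local Notation L := (Lb beta).

(** The zero of L, which lies strictly inside (0,1) exactly when |p| > 1. *)
Let x0 := 1 / 2 + 1 / (2 * p).

Let LE x : p != 0 -> L x = p * (x0 - x).
Proof.
move=> p0; have := p_2q beta_neqN1; rewrite /Lb => E.
have -> : q = (1 - p) / 2 by lra.
by rewrite /x0; field.
Qed.

(* (L^3 v)' = L^2 (L v' - 3 p v), and L^2 is monotone on both sides of the zero x0 of L. *)
Lemma Lb_mul_bound v v' x : 1 < `|p| -> AC v v' -> L2b (fun x => L x * v' x - 3 * p * v x) ->
  0 <= x <= 1 ->
  `|L x * v x| <= itg 0 1 (fun x => `|L x * v' x - 3 * p * v x|).
Proof.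
move=> p1 av [iw _] /andP[x_ge0 x_le1].
have p0 : p != 0 by rewrite -normr_gt0 (lt_trans ltr01).
have /andP[x00 x01] : 0 < x0 < 1.
  have : `|1 / (2 * p)| < 1 / 2.
    rewrite normrM normr1 mul1r normfV normrM (ger0_norm (ler0n R 2)) mul1r.
    rewrite ltf_pV2 ?posrE ?mulr_gt0 ?normr_gt0//; lra.
  by rewrite ltr_norml /x0 => /andP[? ?]; apply/andP; split; lra.
pose w x := L x * v' x - 3 * p * v x; pose I := itg 0 1 (fun x => `|w x|).
rewrite -/I.
have aP : AC (fun x => L x ^+ 3 * v x) (fun x => L x ^+ 2 * w x).
  have aL := AC_Lb beta.
  have := ACM (ACM aL (ACM aL aL)) av.
  by apply: eq_AC => y _; rewrite /w; ring.
have Lx0 : L x0 = 0 by rewrite LE// subrr mulr0.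
have key a b : 0 <= a -> a <= b -> b <= 1 ->
    (forall s, a <= s <= b -> L s ^+ 2 <= L x ^+ 2) ->
    `|L b ^+ 3 * v b - L a ^+ 3 * v a| <= L x ^+ 2 * I.
  move=> a0 ab b1 Ls; rewrite -(AC_itg aP a0 ab b1).
  have iab : intb a b w by apply: sub_intb iw.
  have iLw : intb a b (fun s => L s ^+ 2 * w s).
    apply: intbM_cont => //; rewrite (_ : (fun s => _) = (fun s => L s * L s))//.
    by apply: cont_onM; exact: cont_on_Lb.
  apply: le_trans (le_norm_itg iLw) _.
  apply: (@le_trans _ _ (itg a b (fun s => L x ^+ 2 * `|w s|))).
    apply: le_itg; [exact: intb_norm|by apply: intbZ; exact: intb_norm|].
    move=> s sab; rewrite normrM (ger0_norm (sqr_ge0 _)) ler_wpM2r//; exact: Ls.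
  rewrite itgZ; last exact: intb_norm.
  rewrite ler_wpM2l ?sqr_ge0// /I.
  have inw : intb 0 1 (fun x => `|w x|) by exact: intb_norm.
  rewrite (itg_split a0 (le_trans ab b1) inw).
  rewrite (itg_split ab b1 (sub_intb a0 (lexx _) inw)).
  have ge0 c d : 0 <= itg c d (fun x => `|w x|) by apply: itg_ge0.
  by have := ge0 0 a; have := ge0 b 1; lra.
have main : `|L x ^+ 3 * v x| <= L x ^+ 2 * I.
  have [xx0|x0x] := leP x x0.
    have := key x x0 x_ge0 xx0 (ltW x01); rewrite Lx0 expr0n/= mul0r sub0r normrN; apply.
    move=> s /andP[xs sx0]; rewrite !LE// !(exprMn _ p) ler_wpM2l ?sqr_ge0//.
    by rewrite ler_pXn2r ?nnegrE ?subr_ge0//; lra.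
  have := key x0 x (ltW x00) (ltW x0x) x_le1; rewrite Lx0 expr0n/= mul0r subr0; apply.
  move=> s /andP[xs sx0]; rewrite !LE// !(exprMn _ p) ler_wpM2l ?sqr_ge0//.
  rewrite -(opprB s) -(opprB x) !sqrrN ler_pXn2r ?nnegrE ?subr_ge0 ?(ltW x0x)//; lra.
have I0 : 0 <= I by apply: itg_ge0.
have [->|Lx] := eqVneq (L x) 0; first by rewrite mul0r normr0.
have L2 : 0 < L x ^+ 2 by rewrite exprn_even_gt0.
rewrite -(ler_pM2l L2); apply: le_trans main.
by rewrite (exprSr _ 2) -mulrA (normrM (L x ^+ 2)) (ger0_norm (sqr_ge0 (L x))).
Qed.

(** Both s and m lie in [0,1/2], so s + m <= 1 and |s^2 - m^2| <= |s - m|; and s is at least as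
    close to m as to y, because m is y or its reflection into the same half as s. *)
Lemma norm_weight_le s (y m : R) : m = Num.min y (1 - y) -> 0 <= y <= 1 -> 0 <= s <= 1 / 2 ->
  `|s ^+ 2 - m ^+ 2| <= `|s - y|.
Proof.
move=> mE /andP[y0 y1] /andP[s0 s2].
have [m0 m2] : 0 <= m /\ m <= 1 / 2.
  by rewrite mE; case: (leP y (1 - y)) => H; split; lra.
have sm : `|s - m| <= `|s - y|.
  rewrite mE; case: (leP y (1 - y)) => H //.
  rewrite [leRHS]ler0_norm; last by lra.
  by rewrite ler_norml; apply/andP; split; lra.
rewrite subr_sqr normrM (ger0_norm (addr_ge0 s0 m0)).
apply: le_trans sm; rewrite ler_piMr//; lra.
Qed.

(* phi(1/2) = - int K phi'' with K(s) = s^2/2 - k0 on [0,1/2] and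
   K(s) = (1-s)^2/2 - k0 on [1/2,1]; k0 is chosen so that K vanishes at the zero
   x0 of L, where [Lb_mul_bound] gives no control on phi''. *)
Lemma midpoint_bound phi phi1 phi2 phi3 : 1 < `|p| ->
  deriv_on 0 1 phi phi1 -> deriv_on 0 1 phi1 phi2 -> AC phi2 phi3 ->
  L2b (fun x => L x * phi3 x - 3 * p * phi2 x) ->
  phi1 0 = phi1 1 -> itg 0 1 phi = 0 ->
  `|p| * `|phi (1 / 2)| <= L2norm (fun x => L x * phi3 x - 3 * p * phi2 x) / 2.
Proof.
move=> p1 dphi dphi1 aphi2 Lw bc int0.
set W := L2norm _.
have p0 : p != 0 by rewrite -normr_gt0 (lt_trans ltr01).
have pp : 0 < `|p| by rewrite normr_gt0.
have x01 : 0 <= x0 <= 1.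
  have : `|1 / (2 * p)| <= 1 / 2.
    rewrite normrM normr1 mul1r normfV normrM (ger0_norm (ler0n R 2)) mul1r.
    rewrite lef_pV2 ?posrE ?mulr_gt0 ?normr_gt0//; lra.
  by rewrite ler_norml /x0 => /andP[? ?]; apply/andP; split; lra.
have vb x : 0 <= x <= 1 -> `|x - x0| * `|phi2 x| <= W / `|p|.
  move=> xx; rewrite ler_pdivlMr//.
  rewrite (_ : _ * _ * _ = `|L x * phi2 x|); last first.
    by rewrite LE// !normrM (distrC x0); ring.
  by apply: le_trans (Lb_mul_bound p1 aphi2 Lw xx) _; exact: itg_norm_le_L2norm.
pose m := Num.min x0 (1 - x0); pose k0 := m ^+ 2 / 2.
pose F x := itg 0 x phi.
have dF : deriv_on 0 1 F phi by apply: deriv_on_itg; exact: deriv_on_cont dphi.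
have dsub (g g' : R -> R) : deriv_on 0 1 g g' ->
    deriv_on 0 (1/2) g g' /\ deriv_on (1/2) 1 g g'.
  by move=> dg; split; apply: sub_deriv_on dg; lra.
have [dF1 dF2] := dsub _ _ dF; have [dp1 dp2] := dsub _ _ dphi; have [dq1 dq2] := dsub _ _ dphi1.
(* Primitives of K phi'' on the two halves, found by integrating by parts twice. [F] is the
   primitive of phi, zero at both ends since int phi = 0. *)
pose H1 s := (s * s / 2 - k0) * phi1 s - s * phi s + F s.
pose H2 s := ((1 - s) * (1 - s) / 2 - k0) * phi1 s + (1 - s) * phi s + F s.
have dH1 : deriv_on 0 (1 / 2) H1 (fun s => (s ^+ 2 - m ^+ 2) / 2 * phi2 s).
  have di := @deriv_on_id R 0 (1 / 2).
  have dq : deriv_on 0 (1 / 2) (fun s => s * s / 2 - k0) (fun s => s).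
    have := deriv_onB (deriv_onZ (1 / 2) (deriv_onM di di)) (@deriv_on_cst R 0 (1 / 2) k0).
    by apply: eq_deriv_on => s _; field.
  have := deriv_onD (deriv_onB (deriv_onM dq dq1) (deriv_onM di dp1)) dF1.
  by apply: eq_deriv_on => s _; rewrite ?/H1 ?/H2 ?/k0; field.
have dH2 : deriv_on (1 / 2) 1 H2 (fun s => ((1 - s) ^+ 2 - m ^+ 2) / 2 * phi2 s).
  have di : deriv_on (1 / 2) 1 (fun s : R => 1 - s) (fun=> -1).
    have := deriv_onB (@deriv_on_cst R (1 / 2) 1 1) (@deriv_on_id R (1 / 2) 1).
    by apply: eq_deriv_on => s _ //; rewrite sub0r.
  have dq : deriv_on (1 / 2) 1 (fun s => (1 - s) * (1 - s) / 2 - k0) (fun s => - (1 - s)).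
    have := deriv_onB (deriv_onZ (1 / 2) (deriv_onM di di)) (@deriv_on_cst R (1 / 2) 1 k0).
    by apply: eq_deriv_on => s _; field.
  have := deriv_onD (deriv_onD (deriv_onM dq dq2) (deriv_onM di dp2)) dF2.
  by apply: eq_deriv_on => s _; rewrite ?/H1 ?/H2 ?/k0; field.
(* The k0 terms at 0 and 1 cancel because phi1 0 = phi1 1, and the phi1 terms at 1/2 cancel between
   the halves. Only the two terms with phi(1/2), of weight 1/2 each, remain. *)
have E : - phi (1 / 2) = (H1 (1 / 2) - H1 0) + (H2 1 - H2 (1 / 2)).
  have F0 : F 0 = 0 by exact: itg_point.
  have F1 : F 1 = 0 by [].
  by rewrite /H1 /H2 F0 F1 bc; field.
have half c s : 0 <= s <= 1 -> `|c| <= `|s - x0| ->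
    `|c / 2 * phi2 s| <= W / `|p| / 2.
  move=> ss cs; have := vb s ss.
  rewrite (normrM (c / 2)) (normrM c) (ger0_norm (_ : 0 <= 2^-1 :> R)) ?invr_ge0//.
  by have := ler_wpM2r (normr_ge0 (phi2 s)) cs; lra.
have b1 : `|H1 (1 / 2) - H1 0| <= W / `|p| / 2 * `|1 / 2 - 0|.
  apply: (deriv_on_lipschitz dH1); [|by apply/andP; split; lra|by apply/andP; split; lra].
  move=> s /andP[s0 s2]; apply: half; first by apply/andP; split; lra.
  by apply: norm_weight_le => //; rewrite s0.
have b2 : `|H2 1 - H2 (1 / 2)| <= W / `|p| / 2 * `|1 - 1 / 2|.
  apply: (deriv_on_lipschitz dH2); [|by apply/andP; split; lra|by apply/andP; split; lra].
  move=> s /andP[s0 s2]; apply: half; first by apply/andP; split; lra.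
  rewrite (_ : s - x0 = - ((1 - s) - (1 - x0))); last by ring.
  rewrite normrN; apply: norm_weight_le.
  - by rewrite /m minC; congr Num.min; ring.
  - by move/andP: x01 => [? ?]; apply/andP; split; lra.
  - by apply/andP; split; lra.
have : `|phi (1 / 2)| <= W / `|p| / 2.
  rewrite -normrN E; apply: le_trans (ler_normD _ _) _.
  move: b1 b2; rewrite subr0 (_ : 1 - 1 / 2 = 1 / 2); last by lra.
  by rewrite (ger0_norm (_ : 0 <= 1 / 2)); lra.
rewrite -(ler_pM2l pp) => /le_trans; apply.
by rewrite le_eqVlt; apply/orP; left; apply/eqP; field; rewrite gt_eqF.
Qed.

End WeightBound.

(** * Sign of h and a lower bound for the norm of 1/h *)

Section Smallness.
Variables (R : realType) (T : R).
Hypothesis T_gt0 : 0 < T.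

Lemma nonvanishing_same_sign (h : R -> R) : cont_on 0 T h ->
  (forall t, 0 <= t <= T -> h t <> 0) -> 0 <= h 0 * h T.
Proof.
move=> ch h0; rewrite leNgt; apply/negP => hh.
have [|c] := @IVT R h 0 T 0 (ltW T_gt0) ch.
  have [hle|hlt] := leP (h 0) (h T); apply/andP; split; nra.
by rewrite in_itv/= => cT; exact: h0.
Qed.

Lemma supnormV_ge (h : R -> R) (d : R) : 0 <= d -> cont_on 0 T h ->
  (forall t, 0 <= t <= T -> h t <> 0) ->
  1 + d <= supnorm T (fun t => (h t)^-1) * `|h 0 + d * h T|.
Proof.
move=> d0 ch h0; set N := supnorm _ _.
have hN t : 0 <= t <= T -> 1 <= N * `|h t|.
  move=> tT; have ht : h t != 0 by apply/eqP; exact: h0.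
  have := supnorm_ge (cont_onV h0 ch) tT; rewrite -/N normfV.
  by move=> H; rewrite -ler_pdivrMr ?normr_gt0// mul1r.
have T0 := ltW T_gt0.
have h00 := hN 0; have hTT := hN T.
rewrite lexx T0 in h00; rewrite lexx T0 in hTT.
have {}h00 := h00 isT; have {}hTT := hTT isT.
have ss := nonvanishing_same_sign ch h0.
have -> : `|h 0 + d * h T| = `|h 0| + d * `|h T|.
  have [a|a] := leP 0 (h 0).
    have [b|b] := leP 0 (h T); first by rewrite !ger0_norm// addr_ge0// mulr_ge0.
    have -> : h 0 = 0 by nra.
    by rewrite normr0 !add0r normrM (ger0_norm d0).
  have b : h T <= 0 by rewrite leNgt; apply/negP => b; nra.
  rewrite (ltr0_norm a) (ler0_norm b) ler0_norm; last by have := mulr_ge0_le0 d0 b; lra.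
  by ring.
rewrite mulrDr; have := ler_wpM2l d0 hTT; lra.
Qed.

Lemma rho_mul_ge1 (d1 d2 : R) : 0 <= d1 -> 0 <= d2 -> d1 + d2 < 1 + d1 * d2 ->
  1 <= rho d1 d2 * (1 + d1) * (1 + d2).
Proof.
move=> d10 d20 d12; rewrite /rho -mulrA mulrAC mul1r ler_pdivlMr; last by lra.
by have := mulr_ge0 d10 d20; lra.
Qed.

End Smallness.

(** * The closed system for a and the odd modes *)

Lemma ucvg_lim_bound (R : realType) (X : Type) (A : set X) (G : nat -> X -> R) g x (B : R) :
  ucvg A G g -> A x -> (forall n, `|G n x| <= B) -> `|g x| <= B.
Proof.
move=> Gg Ax GB; rewrite -[g x]subr0.
apply: (@le_lim_bound R (fun n => G n x) (g x) 0 B 0) => [e e0|n _]; last by rewrite subr0.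
by have [N HN] := Gg e e0; exists N => n Nn; exact: HN.
Qed.

Lemma ucvgB (R : realType) (X : Type) (A : set X) (G H : nat -> X -> R) g h :
  ucvg A G g -> ucvg A H h -> ucvg A (fun n x => G n x - H n x) (fun x => g x - h x).
Proof.
move=> Gg Hh e e0; have e2 : 0 < e / 2 by rewrite divr_gt0.
have [N1 H1] := Gg _ e2; have [N2 H2] := Hh _ e2.
exists (maxn N1 N2) => n; rewrite geq_max => /andP[n1 n2] x Ax.
have := H1 n n1 x Ax; have := H2 n n2 x Ax.
rewrite !ler_norml => /andP[? ?] /andP[? ?]; apply/andP; split; lra.
Qed.

Section OddSystem.
Variables (R : realType) (T d1 d2 : R).
Hypotheses (T0 : 0 < T) (d10 : 0 <= d1) (d20 : 0 <= d2) (d12 : d1 + d2 < 1 + d1 * d2).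
Variables (ph ps : nat -> R) (F : nat -> R -> R) (hi g : R -> R) (N G Q r : R).
Hypotheses (cF : forall k, cont_on 0 T (F k)) (chi : cont_on 0 T hi) (cg : cont_on 0 T g).
Hypotheses (hiN : forall t, 0 <= t <= T -> `|hi t| <= N)
           (gG : forall t, 0 <= t <= T -> `|g t| <= G).
Hypothesis sizeQ : forall n,
  l2n (fun k => lam R k ^+ 3 * mode_size T d1 d2 k (ph k) (ps k) (F k)) n <= Q.
Local Notation M := (Mc d1 d2).
Local Notation S0 := (sum_lam R).
Hypotheses (r2 : 2 <= r) (MTr : M * T * r <= 1 / 4) (Qr : 2 * Q <= r)
  (NSMT : 1 / 2 * N * S0 * M * T * r ^+ 2 <= 1)
  (Nr : N * (G + 1 / 2 * S0 * Q) + 2 / 15 <= r).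
Implicit Types (a b y : R -> R) (t : R).

Let size k := mode_size T d1 d2 k (ph k) (ps k) (F k).

Definition odd_mode a k y := exists z,
  mode_eq T (lam R k) d1 d2 (fun t => a t * y t + F k t) (ph k) (ps k) y z.

(** Partial sums of -2 u_xx(1/2,t): X_(2k-1)(1/2) = (-1)^k / 2, and the sines vanish at 1/2. *)
Definition alt_sum (y : nat -> R -> R) n t := \sum_(1 <= k < n.+1) (-1) ^+ k * lam R k ^+ 2 * y k t.

Definition good_potential a := cont_on 0 T a /\ forall t, 0 <= t <= T -> `|a t| <= r.

Let MT0 : 0 <= M * T.
Proof. by rewrite mulr_ge0 ?(ltW T0)// (le_trans ler01)// Mc_ge1. Qed.

Let size_ge0 k : (0 < k)%N -> 0 <= size k.
Proof.
move=> k0; have l0 := lam_gt0 R k0; have rh0 := rho_gt0 d12.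
have M0 : 0 <= M by rewrite (le_trans ler01)// Mc_ge1.
by rewrite /size /mode_size; apply: addr_ge0; [apply: addr_ge0|];
  repeat first [done | exact: ltW | rewrite invr_ge0 | apply: itg_ge0
    | apply: mulr_ge0 | apply: addr_ge0].
Qed.

Let small k : (0 < k)%N -> M * T * r / lam R k <= 1 / 16.
Proof.
move=> k0; rewrite ler_pdivrMr ?lam_gt0//; have := lam_ge R k0; move: MTr; lra.
Qed.

Let dJ k : deriv_on 0 T (fun t => itg 0 t (fun s => `|F k s|)) (fun t => `|F k t|).
Proof. by apply: deriv_on_itg; exact: cont_on_norm. Qed.

Let size_J k : rho d1 d2 * (1 + d2) * `|ph k| + rho d1 d2 * (1 + d1) * `|ps k| / lam R k
  + M / lam R k * (itg 0 T (fun s => `|F k s|) - itg 0 0 (fun s => `|F k s|)) = size k.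
Proof. by rewrite itg_point subr0. Qed.

Lemma odd_mode_exists a k : good_potential a -> (0 < k)%N -> exists y, odd_mode a k y.
Proof.
move=> [ca ar] k0.
have [y [z H]] := potential_exists T0 (lam_gt0 R k0) d10 d20 d12 ca ar (small k0)
  (ph k) (ps k) (@cF k) (@dJ k) (fun t _ => lexx _).
by exists y, z.
Qed.

(** The second bound feeds the first back as a source, with lam_k >= 4. It matters for the size of
    a: the excess over 1 is proportional to M T r, which [key] can pay for even when N S0 Q is
    large, whereas a plain factor 16/15 would enlarge A_4 itself. *)
Lemma odd_mode_bound a k y t : good_potential a -> (0 < k)%N -> odd_mode a k y ->
  0 <= t <= T -> `|y t| <= 16 / 15 * size k /\ `|y t| <= (1 + 4 / 15 * (M * T * r)) * size k.
Proof.
move=> [ca ar] k0 [z H] tT; have l0 := lam_gt0 R k0.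
have b1 s : 0 <= s <= T -> `|y s| <= 16 / 15 * size k.
  apply: (potential_bound T0 l0 d10 d20 d12 ar (small k0) H (@dJ k) (fun t _ => lexx _)).
  by rewrite size_J.
split; first exact: b1.
have b2 s : 0 <= s <= T -> `|a s * y s| <= r * (16 / 15 * size k).
  by move=> sT; rewrite normrM; apply: ler_pM => //; [exact: ar|exact: b1].
have := mode_bound_add T0 l0 d10 d20 d12 H b2 (@dJ k) (fun t _ => lexx _) tT.
rewrite size_J => /le_trans; apply.
have -> : M * T / lam R k * (r * (16 / 15 * size k)) = M * T * r / lam R k * (16 / 15 * size k).
  by ring.
have : M * T * r / lam R k <= M * T * r * (1 / 4).
  rewrite ler_wpM2l//; first by rewrite mulr_ge0//; move: r2; lra.
  by rewrite div1r lef_pV2 ?posrE//; exact: lam_ge.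
by have s0 := size_ge0 k0; move=> /(ler_wpM2r s0); lra.
Qed.

Let altE (y : nat -> R -> R) k t : `|(-1) ^+ k * lam R k ^+ 2 * y k t| = lam R k ^+ 2 * `|y k t|.
Proof.
rewrite (normrM (_ * lam R k ^+ 2)) (normrM ((-1) ^+ k)) normrX normrN1 expr1n mul1r.
by rewrite (ger0_norm (sqr_ge0 (lam R k))).
Qed.

Let alt_sum_bound (y : nat -> R -> R) (c : R) n t : 0 <= c ->
  (forall k, (0 < k)%N -> `|y k t| <= c * size k) -> `|alt_sum y n t| <= c * (S0 * Q).
Proof.
move=> c0 yc; apply: le_trans (ler_norm_sum _ _ _) _.
apply: (@le_trans _ _ (c * \sum_(1 <= k < n.+1) (lam R k)^-1 * (lam R k ^+ 3 * size k))).
  rewrite mulr_sumr !big_nat; apply: ler_sum => k /andP[k0 _]; rewrite altE.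
  have l0 := lam_gt0 R k0.
  have -> : c * ((lam R k)^-1 * (lam R k ^+ 3 * size k)) = lam R k ^+ 2 * (c * size k).
    by field; rewrite gt_eqF.
  by rewrite ler_wpM2l ?sqr_ge0//; exact: yc.
rewrite ler_wpM2l//; apply: le_trans (sum_lam_cauchy _ _) _.
by rewrite ler_wpM2l ?sum_lam_ge0//; exact: sizeQ.
Qed.

Lemma alt_sum_ucvg a (y : nat -> R -> R) : good_potential a ->
  (forall k, (0 < k)%N -> odd_mode a k (y k)) ->
  exists S, ucvg [set t | 0 <= t <= T] (alt_sum y) S.
Proof.
move=> ga Hy.
apply: (@l2_ucauchy R R [set t | 0 <= t <= T] (fun k t => (-1) ^+ k * lam R k ^+ 2 * y k t)
  (fun k _ => 16 / 15 * (lam R k ^+ 3 * size k)) ((16 / 15 * Q) ^+ 2)).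
  move=> n t _; rewrite -l2n_sqr l2nZ ger0_norm//.
  have := sizeQ n; have := l2n_ge0 (fun k => lam R k ^+ 3 * size k) n.
  move=> A0 AQ; apply: lerXn2r; rewrite ?nnegrE; first by apply: mulr_ge0.
    by apply: mulr_ge0 => //; exact: le_trans AQ.
  by apply: ler_wpM2l.
move=> k t k0 tT; rewrite altE; have l0 := lam_gt0 R k0.
rewrite [X in _ <= _ * X]ger0_norm; last first.
  by apply: mulr_ge0 => //; apply: mulr_ge0; [apply: exprn_ge0; exact: ltW|exact: size_ge0].
have -> : (lam R k)^-1 * (16 / 15 * (lam R k ^+ 3 * size k)) = lam R k ^+ 2 * (16 / 15 * size k).
  by field; rewrite gt_eqF.
by rewrite ler_wpM2l ?sqr_ge0//; case: (odd_mode_bound ga k0 (Hy k k0) tT).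
Qed.

Let Q0 : 0 <= Q. Proof. exact: le_trans (l2n_ge0 _ 0) (sizeQ 0). Qed.
Let T00 : (0 : R) <= 0 <= T. Proof. by rewrite lexx ltW. Qed.
Let N0 : 0 <= N. Proof. exact: le_trans (normr_ge0 _) (hiN T00). Qed.

(** After multiplication by r, the smallness of B_4 r^2 leaves Q, and Q <= r / 2 as Q is half of
    A_2. The 2/15 in the bound of a is 4/15 of this 1/2. *)
Let key : 1 / 2 * N * (S0 * Q) * (M * T * r) <= 1 / 2.
Proof.
have r0 : 0 < r by move: r2; lra.
rewrite -(ler_pM2r r0).
have -> : 1 / 2 * N * (S0 * Q) * (M * T * r) * r = 1 / 2 * N * S0 * M * T * r ^+ 2 * Q by ring.
have := ler_wpM2r Q0 NSMT; move: Qr; lra.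
Qed.

Lemma alt_sum_lim_bound a (y : nat -> R -> R) S t : good_potential a ->
  (forall k, (0 < k)%N -> odd_mode a k (y k)) ->
  ucvg [set t | 0 <= t <= T] (alt_sum y) S -> 0 <= t <= T ->
  `|hi t * (g t + 1 / 2 * S t)| <= N * (G + 1 / 2 * S0 * Q) + 2 / 15.
Proof.
move=> ga Hy yS tT; pose c := 1 + 4 / 15 * (M * T * r).
have MTr0 : 0 <= M * T * r by rewrite mulr_ge0//; move: r2; lra.
have c0 : 0 <= c by rewrite /c; lra.
have SB : `|S t| <= c * (S0 * Q).
  apply: (ucvg_lim_bound yS tT) => n; apply: alt_sum_bound => // k k0.
  by case: (odd_mode_bound ga k0 (Hy k k0) tT).
rewrite normrM; apply: (@le_trans _ _ (N * (G + 1 / 2 * (c * (S0 * Q))))).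
  apply: ler_pM => //; first exact: hiN.
  apply: le_trans (ler_normD _ _) _; apply: lerD; first exact: gG.
  by rewrite normrM (ger0_norm (_ : 0 <= 1 / 2)) ?divr_ge0// ler_wpM2l// divr_ge0.
by move: key; rewrite /c; lra.
Qed.

(** Contraction in a. Each y_k moves by O(M T |a - b|) times its size, so the smallness again comes
    from the product N S0 Q M T. *)
Lemma alt_sum_lim_lipschitz a b (ya yb : nat -> R -> R) Sa Sb D t :
  good_potential a -> good_potential b ->
  (forall k, (0 < k)%N -> odd_mode a k (ya k)) ->
  (forall k, (0 < k)%N -> odd_mode b k (yb k)) ->
  ucvg [set t | 0 <= t <= T] (alt_sum ya) Sa ->
  ucvg [set t | 0 <= t <= T] (alt_sum yb) Sb -> 0 <= D ->
  (forall t, 0 <= t <= T -> `|a t - b t| <= D) -> 0 <= t <= T ->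
  `|hi t * (g t + 1 / 2 * Sa t) - hi t * (g t + 1 / 2 * Sb t)| <= 1 / 2 * D.
Proof.
(* 64/225 = 16/15 (dependence on the potential) times 1/4 (from 1 / lam_k) times 16/15 (bound of
   yb). *)
move=> ga gb Ha Hb yA yB D0 abD tT; pose c := 64 / 225 * (M * T) * D.
have c0 : 0 <= c by apply: mulr_ge0 => //; apply: mulr_ge0 => //; lra.
have diff k : (0 < k)%N -> `|ya k t - yb k t| <= c * size k.
  move=> k0; have [z Hz] := Ha k k0; have [z' Hz'] := Hb k k0.
  have b2 s : 0 <= s <= T -> `|yb k s| <= 16 / 15 * size k.
    by move=> sT; case: (odd_mode_bound gb k0 (Hb k k0) sT).
  have l0 := lam_gt0 R k0.
  have := potential_lipschitz T0 l0 d10 d20 d12 ga.2 (small k0) Hz Hz' abD b2 tT.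
  move=> /le_trans; apply.
  have : M * T / lam R k <= M * T * (1 / 4).
    rewrite ler_wpM2l// div1r lef_pV2 ?posrE//; exact: lam_ge.
  have DZ : 0 <= D * size k by rewrite mulr_ge0// size_ge0.
  by move=> /(ler_wpM2r DZ); rewrite /c; lra.
have SB : `|Sa t - Sb t| <= c * (S0 * Q).
  apply: (@ucvg_lim_bound R R [set t | 0 <= t <= T] (fun n t => alt_sum ya n t - alt_sum yb n t)
    (fun t => Sa t - Sb t) t _ (ucvgB yA yB) tT) => n.
  have -> : alt_sum ya n t - alt_sum yb n t = alt_sum (fun k t => ya k t - yb k t) n t.
    by rewrite /alt_sum -sumrB; apply: eq_bigr => k _; ring.
  by apply: alt_sum_bound => // k k0; exact: diff.
rewrite -mulrBr normrM; apply: (@le_trans _ _ (N * (1 / 2 * (c * (S0 * Q))))).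
  apply: ler_pM => //; first exact: hiN.
  rewrite (_ : _ - _ = 1 / 2 * (Sa t - Sb t)); last by ring.
  by rewrite normrM (ger0_norm (_ : 0 <= 1 / 2)) ?divr_ge0// ler_wpM2l// divr_ge0.
have X0 : 0 <= 1 / 2 * N * (S0 * Q) * (M * T).
  have S00 := sum_lam_ge0 R; apply: mulr_ge0 => //; apply: mulr_ge0; last exact: mulr_ge0.
  by apply: mulr_ge0 => //; lra.
have X1 : 1 / 2 * N * (S0 * Q) * (M * T) <= 1 / 4.
  have := ler_wpM2l X0 r2; move: key; lra.
by have := ler_wpM2r D0 X1; rewrite /c; lra.
Qed.

(** The bound asserted for a is finer than the radius r of the contraction: the norm count of {u,a}
    has to fit the modes of u beside it. *)
Lemma odd_system_exists : exists a (y : nat -> R -> R) S,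
  [/\ cont_on 0 T a, forall t, 0 <= t <= T -> `|a t| <= N * (G + 1 / 2 * S0 * Q) + 2 / 15,
      forall k, (0 < k)%N -> odd_mode a k (y k),
      ucvg [set t | 0 <= t <= T] (alt_sum y) S &
      forall t, 0 <= t <= T -> a t = hi t * (g t + 1 / 2 * S t)].
Proof.
have ex a : exists yS : (nat -> R -> R) * (R -> R), good_potential a ->
    (forall k, (0 < k)%N -> odd_mode a k (yS.1 k)) /\
    ucvg [set t | 0 <= t <= T] (alt_sum yS.1) yS.2.
  have [ga|nga] := pselect (good_potential a); last by exists (fun _ _ => 0, fun=> 0).
  have exy k : exists y, (0 < k)%N -> odd_mode a k y.
    case: k => [|k]; first by exists (fun=> 0).
    by have [y Hy] := odd_mode_exists ga (ltn0Sn k); exists y.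
  have [y Hy] := choice exy; have [S HS] := alt_sum_ucvg ga Hy.
  by exists (y, S).
have [yS HyS] := choice ex.
pose Phi a t := hi t * (g t + 1 / 2 * (yS a).2 t).
have cS a : good_potential a -> cont_on 0 T (yS a).2.
  move=> ga; have [Hy HS] := HyS a ga; apply: cont_on_unif HS => n.
  apply: cont_on_sum => k /andP[k0 _]; apply: cont_onZ.
  by have [z [dy _ _ _]] := Hy k k0; exact: deriv_on_cont dy.
have [|||||a [ca ar aE]] := @contraction_cont R T Phi r (1 / 2).
- by move: r2; lra.
- by lra.
- by lra.
- move=> a ca ar; have ga : good_potential a by [].
  have [Hy HS] := HyS a ga; split.
    by apply: cont_onM => //; apply: cont_onD => //; apply: cont_onZ; exact: cS.
  by move=> t tT; apply: le_trans (alt_sum_lim_bound ga Hy HS tT) Nr.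
- move=> a b D ca ar cb br D0 abD t tT.
  have ga : good_potential a by []. have gb : good_potential b by [].
  have [Ha HSa] := HyS a ga; have [Hb HSb] := HyS b gb.
  exact: (alt_sum_lim_lipschitz ga gb Ha Hb HSa HSb D0 abD tT).
have ga : good_potential a by []. have [Hy HS] := HyS a ga.
exists a, (yS a).1, (yS a).2; split => // t tT; last by rewrite -[LHS]aE.
by rewrite -aE//; exact: (alt_sum_lim_bound ga Hy HS tT).
Qed.

(** Where |a - b| is maximal, [alt_sum_lim_lipschitz] bounds it by half of itself. *)
Lemma odd_system_unique a b (ya yb : nat -> R -> R) Sa Sb :
  good_potential a -> good_potential b ->
  (forall k, (0 < k)%N -> odd_mode a k (ya k)) ->
  (forall k, (0 < k)%N -> odd_mode b k (yb k)) ->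
  ucvg [set t | 0 <= t <= T] (alt_sum ya) Sa ->
  ucvg [set t | 0 <= t <= T] (alt_sum yb) Sb ->
  (forall t, 0 <= t <= T -> a t = hi t * (g t + 1 / 2 * Sa t)) ->
  (forall t, 0 <= t <= T -> b t = hi t * (g t + 1 / 2 * Sb t)) ->
  forall t, 0 <= t <= T -> a t = b t.
Proof.
move=> ga gb Ha Hb yA yB aE bE.
have [c cT Hc] := cont_on_max (ltW T0) (cont_on_norm (cont_onB ga.1 gb.1)).
have := alt_sum_lim_lipschitz ga gb Ha Hb yA yB (normr_ge0 _) Hc cT.
rewrite -aE// -bE// => H.
have D0 : `|a c - b c| <= 0 by have := normr_ge0 (a c - b c); lra.
move=> t tT; have := le_trans (Hc t tT) D0.
by rewrite normr_le0 subr_eq0 => /eqP.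
Qed.

End OddSystem.

Lemma potential_mode_unique (R : realType) (T d1 d2 r : R) (a F : R -> R) (ph ps : R) (k : nat)
    (y1 z1 y2 z2 : R -> R) : 0 < T -> 0 <= d1 -> 0 <= d2 -> d1 + d2 < 1 + d1 * d2 ->
  (forall t, 0 <= t <= T -> `|a t| <= r) -> Mc d1 d2 * T * r <= 1 / 4 -> (0 < k)%N ->
  mode_eq T (lam R k) d1 d2 (fun t => a t * y1 t + F t) ph ps y1 z1 ->
  mode_eq T (lam R k) d1 d2 (fun t => a t * y2 t + F t) ph ps y2 z2 ->
  forall t, 0 <= t <= T -> y1 t = y2 t.
Proof.
move=> T0 d10 d20 d12 ar MTr k0 H1 H2 t tT.
have l0 := lam_gt0 R k0.
have small : Mc d1 d2 * T * r / lam R k <= 1 / 16.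
  by rewrite ler_pdivrMr//; have := lam_ge R k0; lra.
have [Z Z0 HZ] : exists2 Z : R, 0 <= Z & forall t, 0 <= t <= T -> `|y2 t| <= Z.
  by case: H2 => /deriv_on_cont/cont_on_bounded.
have D0 s : 0 <= s <= T -> `|a s - a s| <= 0 by rewrite subrr normr0.
have := potential_lipschitz T0 l0 d10 d20 d12 ar small H1 H2 D0 HZ tT.
by rewrite mul0r !mulr0 normr_le0 subr_eq0 => /eqP.
Qed.

(** * Synthesis of the solution *)

Lemma lim_uniq (R : realType) (u : nat -> R) (l m : R) :
  (forall e, 0 < e -> exists N, forall n, (N <= n)%N -> `|u n - l| <= e) ->
  (forall e, 0 < e -> exists N, forall n, (N <= n)%N -> `|u n - m| <= e) -> l = m.
Proof.
move=> ul um; apply/eqP; rewrite -subr_eq0 -normr_le0; apply/ler_addgt0Pl => e e0; rewrite addr0.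
have e2 : 0 < e / 2 by rewrite divr_gt0.
have [N1 H1] := ul _ e2; have [N2 H2] := um _ e2.
have := H1 _ (leq_maxl N1 N2); have := H2 _ (leq_maxr N1 N2).
rewrite !ler_norml => /andP[? ?] /andP[? ?]; apply/andP; split; lra.
Qed.

Lemma lim_lin (R : realType) (u v : nat -> R) (c l m : R) :
  (forall e, 0 < e -> exists N, forall n, (N <= n)%N -> `|u n - l| <= e) ->
  (forall e, 0 < e -> exists N, forall n, (N <= n)%N -> `|v n - m| <= e) ->
  forall e, 0 < e -> exists N, forall n, (N <= n)%N -> `|u n + c * v n - (l + c * m)| <= e.
Proof.
move=> ul vm e e0; have c1 : 0 < `|c| + 1 by rewrite ltr_wpDl.
have e2 : 0 < e / 2 by rewrite divr_gt0.
have e3 : 0 < e / 2 / (`|c| + 1) by rewrite divr_gt0.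
have [N1 H1] := ul _ e2; have [N2 H2] := vm _ e3.
exists (maxn N1 N2) => n; rewrite geq_max => /andP[n1 n2].
have -> : u n + c * v n - (l + c * m) = (u n - l) + c * (v n - m) by ring.
apply: le_trans (ler_normD _ _) _; rewrite (normrM c).
have := H1 n n1; have h2 := H2 n n2.
have : `|c| * `|v n - m| <= (`|c| + 1) * (e / 2 / (`|c| + 1)).
  by apply: ler_pM => //; lra.
have -> : (`|c| + 1) * (e / 2 / (`|c| + 1)) = e / 2 by field; rewrite gt_eqF.
lra.
Qed.

Definition Xsum1 (R : realType) (beta : R) (co ce : nat -> R) (n : nat) (x : R) : R :=
  \sum_(1 <= k < n.+1)
    (co k * (pc beta * cos (lam R k * x)
             + (pc beta * x + qc beta) * (- lam R k * sin (lam R k * x)))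
     + ce k * (lam R k * cos (lam R k * x))).

Section PartialSums.
Variables (R : realType) (T beta : R).
Implicit Types (co ce : nat -> R) (c d : nat -> R -> R) (x t : R).
Local Notation p := (pc beta).
Local Notation q := (qc beta).

Lemma cont_DT_Xsum c d n : (forall k, (0 < k)%N -> cont_on 0 T (c k)) ->
  (forall k, (0 < k)%N -> cont_on 0 T (d k)) ->
  cont_DT T (fun x t => Xsum beta (c^~ t) (d^~ t) n x).
Proof.
move=> cc cd; elim: n => [|n IH].
  rewrite (_ : (fun x t => _) = (fun _ _ => 0)).
    by apply: cont_on_DT_t; exact: cont_on_cst.
  by apply/funext => x; apply/funext => t; rewrite /Xsum big_geq.
rewrite (_ : (fun x t => _) = (fun x t => Xsum beta (c^~ t) (d^~ t) n x +
   (c n.+1 t * Xo beta n.+1 x + d n.+1 t * sin (lam R n.+1 * x)))); last first.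
  by apply/funext => x; apply/funext => t; rewrite /Xsum big_nat_recr.
apply: cont_DTD => //; apply: cont_DTD.
  apply: (cont_DTM (g := fun _ t => c n.+1 t) (h := fun x _ => Xo beta n.+1 x)).
    by apply: cont_on_DT_t; exact: cc.
  by apply: cont_on_DT_x; exact: cont_on_Xo.
apply: (cont_DTM (g := fun _ t => d n.+1 t) (h := fun x _ => sin (lam R n.+1 * x))).
  by apply: cont_on_DT_t; exact: cd.
by apply: cont_on_DT_x; exact: cont_on_sinZ.
Qed.

Let daff a b : deriv_on a b (fun x => p * x + q) (fun=> p).
Proof.
have := deriv_onD (deriv_onZ p (@deriv_on_id R a b)) (@deriv_on_cst R a b q).
by apply: eq_deriv_on => x _; ring.
Qed.

Lemma deriv_on_Xsum co ce n : deriv_on 0 1 (Xsum beta co ce n) (Xsum1 beta co ce n).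
Proof.
apply: deriv_on_sum => k _; apply: deriv_onD; apply: deriv_onZ; last exact: deriv_on_sinZ.
have := deriv_onM (@daff 0 1) (@deriv_on_cosZ R 0 1 (lam R k)).
by apply: eq_deriv_on.
Qed.

(** X_(2k-1) is not an eigenfunction of the second derivative but an associated one: X_(2k-1)'' =
    -lam_k^2 X_(2k-1) - 2 p lam_k X_(2k). This is the origin of the coupling. *)
Lemma deriv_on_Xsum1 co ce n : deriv_on 0 1 (Xsum1 beta co ce n)
  (Xsum beta (fun k => - (lam R k ^+ 2 * co k))
             (fun k => - (lam R k ^+ 2 * ce k) - 2 * p * lam R k * co k) n).
Proof.
rewrite /Xsum1 /Xsum.
have dc k := @deriv_on_cosZ R 0 1 (lam R k).
have ds k := @deriv_on_sinZ R 0 1 (lam R k).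
have := @deriv_on_sum R 0 1 1 n.+1 (fun k x => co k * (p * cos (lam R k * x)
             + (p * x + q) * (- lam R k * sin (lam R k * x)))
     + ce k * (lam R k * cos (lam R k * x))) _
  (fun k _ => deriv_onD (deriv_onZ (co k) (deriv_onD (deriv_onZ p (dc k))
     (deriv_onM (@daff 0 1) (deriv_onZ (- lam R k) (ds k)))))
     (deriv_onZ (ce k) (deriv_onZ (lam R k) (dc k)))).
apply: eq_deriv_on => x _ //; apply: eq_bigr => k _; rewrite /Xo; ring.
Qed.

Lemma deriv_on_Xsum_t c c' d d' n x : (forall k, (0 < k)%N -> deriv_on 0 T (c k) (c' k)) ->
  (forall k, (0 < k)%N -> deriv_on 0 T (d k) (d' k)) ->
  deriv_on 0 T (fun t => Xsum beta (c^~ t) (d^~ t) n x) (fun t => Xsum beta (c'^~ t) (d'^~ t) n x).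
Proof.
move=> dc dd; apply: deriv_on_sum => k /andP[k0 _].
have := deriv_onD (deriv_onZ (Xo beta k x) (dc k k0)) (deriv_onZ (sin (lam R k * x)) (dd k k0)).
by apply: eq_deriv_on => t _; ring.
Qed.

Lemma Xsum_lin (s : R) co ce co' ce' n x :
  Xsum beta co ce n x + s * Xsum beta co' ce' n x =
  Xsum beta (fun k => co k + s * co' k) (fun k => ce k + s * ce' k) n x.
Proof. by rewrite /Xsum mulr_sumr -big_split; apply: eq_bigr => k _ /=; ring. Qed.

Lemma eq_Xsum co ce co' ce' n x : (forall k, (0 < k)%N -> co k = co' k) ->
  (forall k, (0 < k)%N -> ce k = ce' k) -> Xsum beta co ce n x = Xsum beta co' ce' n x.
Proof. by move=> H1 H2; apply: eq_big_nat => k /andP[k0 _]; rewrite H1// H2. Qed.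

Lemma Xsum_bc co ce n : beta <> -1 -> Xsum beta co ce n 0 = beta * Xsum beta co ce n 1.
Proof.
move=> /eqP; rewrite -subr_eq0 opprK => b1.
rewrite /Xsum mulr_sumr; apply: eq_bigr => k _.
rewrite /Xo !mulr0 !mulr1 cos0 sin0 cos_lam sin_lam /pc /qc; field.
by rewrite addrC.
Qed.

Lemma sin_lam_half k : sin (lam R k * (1 / 2)) = 0.
Proof.
elim: k => [|k IH]; first by rewrite lam0 mul0r sin0.
rewrite lamS mulrDl sinD IH mul0r add0r /lam mulr1.
have -> : 2 * pi * (1 / 2) = pi :> R by field.
by rewrite sinpi mulr0.
Qed.

Lemma cos_lam_half k : cos (lam R k * (1 / 2)) = (-1) ^+ k.
Proof.
elim: k => [|k IH]; first by rewrite lam0 mul0r cos0.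
rewrite lamS mulrDl cosD IH sin_lam_half mul0r subr0 /lam mulr1.
have -> : 2 * pi * (1 / 2) = pi :> R by field.
by rewrite cospi exprSr.
Qed.

Lemma Xsum_half co ce n : beta <> -1 ->
  Xsum beta co ce n (1 / 2) = 1 / 2 * \sum_(1 <= k < n.+1) (-1) ^+ k * co k.
Proof.
move=> b1; have := p_2q b1 => pq; rewrite /Xsum mulr_sumr; apply: eq_bigr => k _.
rewrite sin_lam_half /Xo cos_lam_half.
have -> : p * (1 / 2) + q = 1 / 2 by lra.
by ring.
Qed.

End PartialSums.

(* Here l = 1 is a dummy frequency: v'' = (a + 1) v - v. *)
Lemma zero_data_zero (R : realType) (T d1 d2 r : R) (a v v1 : R -> R) : 0 < T -> 0 <= d1 ->
  0 <= d2 -> d1 + d2 < 1 + d1 * d2 -> 2 <= r -> Mc d1 d2 * T * r <= 1 / 4 ->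
  (forall t, 0 <= t <= T -> `|a t| <= r) ->
  deriv_on 0 T v v1 -> deriv_on 0 T v1 (fun t => a t * v t) ->
  v 0 + d1 * v T = 0 -> v1 0 + d2 * v1 T = 0 ->
  forall t, 0 <= t <= T -> v t = 0.
Proof.
move=> T0 d10 d20 d12 r2 MTr ar dv dv1 bc bc1.
have M1 := Mc_ge1 d10 d20 d12.
have [c cT Hc] := cont_on_max (ltW T0) (cont_on_norm (deriv_on_cont dv)).
have m : mode_eq T 1 d1 d2 (fun t => (a t + 1) * v t + 0) 0 0 v v1.
  split => //; apply: eq_deriv_on dv1 => // t _; ring.
have F1 t : 0 <= t <= T -> `|(a t + 1) * v t| <= (r + 1) * `|v c|.
  move=> tT; rewrite normrM; apply: ler_pM => //; last exact: Hc.
  by apply: le_trans (ler_normD _ _) _; rewrite normr1 lerD2r; exact: ar.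
have F2 t : 0 <= t <= T -> `|0 : R| <= (fun=> 0 : R) t by rewrite normr0.
have := mode_bound_add T0 ltr01 d10 d20 d12 m F1 (@deriv_on_cst R 0 T 0) F2 cT.
rewrite normr0 !mulr0 mul0r subrr mulr0 !add0r divr1 => H.
have vc : `|v c| <= 0.
  have V0 := normr_ge0 (v c).
  have MT0 : 0 <= Mc d1 d2 * T by rewrite mulr_ge0 ?(ltW T0)// (le_trans ler01).
  have MT8 : Mc d1 d2 * T <= 1 / 8 by have := ler_wpM2l MT0 r2; lra.
  have : Mc d1 d2 * T * (r + 1) <= 1 / 2 by lra.
  by move=> /(ler_wpM2r V0); lra.
move=> t tT; apply/eqP; rewrite -normr_le0; exact: le_trans (Hc t tT) vc.
Qed.

Lemma sum_lam_cube_le (R : realType) (w : nat -> R) (n : nat) :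
  \sum_(1 <= k < n.+1) (lam R k * w k) ^+ 2 <= \sum_(1 <= k < n.+1) (lam R k ^+ 3 * w k) ^+ 2.
Proof.
rewrite !big_nat; apply: ler_sum => k /andP[k0 _].
have : 1 <= lam R k by have := lam_ge R k0; lra.
move: (lam R k) (w k) => l v l1; rewrite (exprMn 2 l) (exprMn 2 (l ^+ 3)) ler_wpM2r ?sqr_ge0//.
by rewrite -!exprM; apply: ler_weXn2l.
Qed.

(** One more power of lam_k on the coefficients of u_xx gives lam_k^3, which is the weight of the
    norm of B_(2,T)^3. The coupling part carries only lam_k^2; (A + 2 p B)^2 <= 2 A^2 + 8 p^2 B^2
    gives the constant. *)
Lemma Xsum2_ucvg (R : realType) (T beta C : R) (y z : nat -> R -> R) : 0 < T ->
  (forall n t, 0 <= t <= T -> \sum_(1 <= k < n.+1) (lam R k ^+ 3 * y k t) ^+ 2 <= C) ->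
  (forall n t, 0 <= t <= T -> \sum_(1 <= k < n.+1) (lam R k ^+ 3 * z k t) ^+ 2 <= C) ->
  exists g, ucvg_DT T (fun n x t => Xsum beta (fun k => - (lam R k ^+ 2 * y k t))
    (fun k => - (lam R k ^+ 2 * z k t) - 2 * pc beta * lam R k * y k t) n x) g.
Proof.
move=> T0 yC zC; move pE : (pc beta) => p.
have C0 : 0 <= C by apply: le_trans (yC 0%N 0 _); rewrite ?big_geq// lexx ltW.
apply: (@Xsum_ucvg R T beta (fun k t => - (lam R k ^+ 2 * y k t))
  (fun k t => - (lam R k ^+ 2 * z k t) - 2 * p * lam R k * y k t)
  (2 * C + 8 * p ^+ 2 * C)) => n t tT.
  apply: le_trans (_ : C <= _); last by have := mulr_ge0 (sqr_ge0 p) C0; lra.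
  apply: le_trans (yC n t tT); rewrite le_eqVlt; apply/orP; left; apply/eqP.
  by apply: eq_bigr => k _; ring.
apply: (@le_trans _ _ (2 * (\sum_(1 <= k < n.+1) (lam R k ^+ 3 * z k t) ^+ 2) +
   8 * p ^+ 2 * (\sum_(1 <= k < n.+1) (lam R k ^+ 3 * y k t) ^+ 2))); last first.
  apply: lerD; first by rewrite ler_wpM2l// zC.
  by apply: ler_wpM2l (yC n t tT); apply: mulr_ge0 => //; exact: sqr_ge0.
rewrite !mulr_sumr -big_split/= !big_nat; apply: ler_sum => k /andP[k0 _].
have : 1 <= lam R k by have := lam_ge R k0; lra.
move: (lam R k) (y k t) (z k t) => l v w l1.
have le2 : (l ^+ 2 * v) ^+ 2 <= (l ^+ 3 * v) ^+ 2.
  rewrite (exprMn 2 (l ^+ 2)) (exprMn 2 (l ^+ 3)) ler_wpM2r ?sqr_ge0//.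
  by rewrite -!exprM; apply: ler_weXn2l.
have := ler_wpM2l (mulr_ge0 (ler0n R 8) (sqr_ge0 p)) le2.
have := sqr_ge0 (l ^+ 3 * w - 2 * p * (l ^+ 2 * v)).
have -> : l * (- (l ^+ 2 * w) - 2 * p * l * v) = - (l ^+ 3 * w) - 2 * p * (l ^+ 2 * v) by ring.
move: (l ^+ 3 * w) (l ^+ 2 * v) (l ^+ 3 * v) => A B D; nra.
Qed.

Section Synthesis.
Variables (R : realType) (T beta d1 d2 r C : R).
Hypotheses (T0 : 0 < T) (b1 : beta <> -1) (d10 : 0 <= d1) (d20 : 0 <= d2)
  (d12 : d1 + d2 < 1 + d1 * d2) (r2 : 2 <= r) (MTr : Mc d1 d2 * T * r <= 1 / 4).
Variables (phi psi h h1 h2 a : R -> R) (f : R -> R -> R)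
  (y y1 z z1 Fo Fe : nat -> R -> R) (po pe qo qe : nat -> R) (S : R -> R).
Local Notation p := (pc beta).
Implicit Types (x t e : R).
Hypotheses (ca : cont_on 0 T a) (ar : forall t, 0 <= t <= T -> `|a t| <= r).
Hypothesis my : forall k, (0 < k)%N ->
  mode_eq T (lam R k) d1 d2 (fun t => a t * y k t + Fo k t) (po k) (qo k) (y k) (y1 k).
Hypothesis mz : forall k, (0 < k)%N ->
  mode_eq T (lam R k) d1 d2 (fun t => a t * z k t + (Fe k t - 2 * p * lam R k * y k t))
    (pe k) (qe k) (z k) (z1 k).
Hypotheses
  (yC : forall n t, 0 <= t <= T -> \sum_(1 <= k < n.+1) (lam R k ^+ 3 * y k t) ^+ 2 <= C)
  (zC : forall n t, 0 <= t <= T -> \sum_(1 <= k < n.+1) (lam R k ^+ 3 * z k t) ^+ 2 <= C).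
Hypotheses (cf : cont_DT T f)
  (fE : ucvg_DT T (fun n x t => Xsum beta (Fo^~ t) (Fe^~ t) n x) f)
  (phiE : forall x, 0 <= x <= 1 -> forall e, 0 < e ->
     exists N, forall n, (N <= n)%N -> `|Xsum beta po pe n x - phi x| <= e)
  (psiE : forall x, 0 <= x <= 1 -> forall e, 0 < e ->
     exists N, forall n, (N <= n)%N -> `|Xsum beta qo qe n x - psi x| <= e).
Hypotheses (dh : deriv_on 0 T h h1) (dh1 : deriv_on 0 T h1 h2)
  (h_phi : h 0 + d1 * h T = phi (1 / 2)) (h_psi : h1 0 + d2 * h1 T = psi (1 / 2))
  (SE : ucvg [set t | 0 <= t <= T] (alt_sum y) S)
  (aE : forall t, 0 <= t <= T -> a t * h t = h2 t - f (1 / 2) t + 1 / 2 * S t).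

Let dy k : (0 < k)%N -> deriv_on 0 T (y k) (y1 k). Proof. by move=> /my[]. Qed.
Let dz k : (0 < k)%N -> deriv_on 0 T (z k) (z1 k). Proof. by move=> /mz[]. Qed.
Let cy k : (0 < k)%N -> cont_on 0 T (y k). Proof. by move=> /dy/deriv_on_cont. Qed.
Let cz k : (0 < k)%N -> cont_on 0 T (z k). Proof. by move=> /dz/deriv_on_cont. Qed.

Let C0 : 0 <= C.
Proof. by apply: le_trans (yC 0 (t := 0) _); rewrite ?big_geq// lexx ltW. Qed.

Let P n x t := Xsum beta (y^~ t) (z^~ t) n x.
Let Pxx n x t := Xsum beta (fun k => - (lam R k ^+ 2 * y k t))
  (fun k => - (lam R k ^+ 2 * z k t) - 2 * p * lam R k * y k t) n x.
Let Ptt n x t := Xsum beta (fun k => a t * y k t + Fo k t - lam R k ^+ 2 * y k t)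
  (fun k => a t * z k t + (Fe k t - 2 * p * lam R k * y k t) - lam R k ^+ 2 * z k t) n x.

Let P_ucvg : exists u, ucvg_DT T P u.
Proof.
apply: (@Xsum_ucvg R T beta y z C) => n t tT.
  exact: le_trans (sum_lam_cube_le (y^~ t) n) (yC n tT).
exact: le_trans (sum_lam_cube_le (z^~ t) n) (zC n tT).
Qed.

Let Pxx_ucvg : exists uxx, ucvg_DT T Pxx uxx.
Proof. exact: Xsum2_ucvg yC zC. Qed.

(** Only the sums for u, u_xx and u_tt are estimated; [deriv_on2_lim] provides u_x and u_t and
    justifies the termwise derivatives. *)
Lemma synthesis : exists u,
  classical_solution T beta d1 d2 phi psi f h u a /\ ucvg_DT T P u.
Proof.
have [u Hu] := P_ucvg; have [uxx Huxx] := Pxx_ucvg.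
pose utt x t := a t * u x t + f x t + uxx x t.
have cP n : cont_DT T (P n) by apply: cont_DT_Xsum.
have cPxx n : cont_DT T (Pxx n).
  apply: (@cont_DT_Xsum R T beta (fun k t => - (lam R k ^+ 2 * y k t))
    (fun k t => - (lam R k ^+ 2 * z k t) - 2 * p * lam R k * y k t) n) => k k0.
    by apply: cont_onN; apply: cont_onZ; exact: cy.
  apply: cont_onB; last by apply: cont_onZ; exact: cy.
  by apply: cont_onN; apply: cont_onZ; exact: cz.
have cu : cont_DT T u by exact: cont_DT_unif cP Hu.
have cuxx : cont_DT T uxx by exact: cont_DT_unif cPxx Huxx.
have cutt : cont_DT T utt.
  apply: cont_DTD => //; apply: cont_DTD => //.
  by apply: (cont_DTM (g := fun _ t => a t)) => //; exact: cont_on_DT_t.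
(* The mode equations make the partial sums satisfy the differential equation exactly, with f
   truncated; convergence of [Ptt] is inherited from the other sums. *)
have PttE n x t : Ptt n x t =
    a t * P n x t + Xsum beta (Fo^~ t) (Fe^~ t) n x + Pxx n x t.
  rewrite [RHS]addrC addrCA -[Pxx _ _ _ + _]addrC -[X in _ + (X + _)]mul1r (addrC (1 * _)).
  rewrite /P /Pxx /Ptt /Xsum !mulr_sumr -!big_split/=; apply: eq_bigr => k _; ring.
have Hutt : ucvg_DT T Ptt utt.
  move=> e e0; have r1 : 0 < r + 1 by move: r2; lra.
  have e3 : 0 < e / 3 by rewrite divr_gt0.
  have e4 : 0 < e / 3 / (r + 1) by rewrite divr_gt0.
  have [N1 H1] := Hu _ e4; have [N2 H2] := fE e3; have [N3 H3] := Huxx _ e3.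
  exists (maxn N1 (maxn N2 N3)) => n; rewrite !geq_max => /and3P[n1 n2 n3] x t x01 tT.
  rewrite PttE /utt.
  have -> : a t * P n x t + Xsum beta (Fo^~ t) (Fe^~ t) n x + Pxx n x t -
     (a t * u x t + f x t + uxx x t) = a t * (P n x t - u x t) +
     (Xsum beta (Fo^~ t) (Fe^~ t) n x - f x t) + (Pxx n x t - uxx x t) by ring.
  apply: le_trans (ler_normD _ _) _.
  have h1' := H1 n n1 x t x01 tT; have := H2 n n2 x t x01 tT; have := H3 n n3 x t x01 tT.
  have : `|a t * (P n x t - u x t)| <= (r + 1) * (e / 3 / (r + 1)).
    rewrite normrM; apply: ler_pM => //.
    by apply: le_trans (ar tT) _; rewrite lerDl.
  have -> : (r + 1) * (e / 3 / (r + 1)) = e / 3 by field; rewrite gt_eqF.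
  have := ler_normD (a t * (P n x t - u x t)) (Xsum beta (Fo^~ t) (Fe^~ t) n x - f x t).
  lra.
have Pt x t : 0 <= x <= 1 -> 0 <= t <= T -> forall e, 0 < e -> exists N, forall n, (N <= n)%N ->
    `|P n x t - u x t| <= e.
  by move=> x01 tT e e0; have [N HN] := Hu e e0; exists N => n Nn; exact: HN.
have exx t : exists g1, 0 <= t <= T -> deriv_on 0 1 (u^~ t) g1 /\ deriv_on 0 1 g1 (uxx^~ t).
  have [tT|tT] := boolP (0 <= t <= T); last by exists (fun=> 0).
  have [g1 [_ D1 D2]] := @deriv_on2_lim R 0 1 (fun n x => P n x t)
    (fun n => Xsum1 beta (y^~ t) (z^~ t) n) (fun n x => Pxx n x t) (u^~ t) (uxx^~ t) ltr01
    (fun n => @deriv_on_Xsum R beta (y^~ t) (z^~ t) n) (fun n => @deriv_on_Xsum1 R beta _ _ n)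
    (fun x x01 => Pt x t x01 tT) (ucvg_DT_x Huxx tT).
  by exists g1.
have [uxT HuxT] := choice exx.
have ext x : exists g1, 0 <= x <= 1 ->
    [/\ ucvg [set t | 0 <= t <= T] (fun n t => Xsum beta (y1^~ t) (z1^~ t) n x) g1,
        deriv_on 0 T (u x) g1 & deriv_on 0 T g1 (utt x)].
  have [x01|x01] := boolP (0 <= x <= 1); last by exists (fun=> 0).
  have [g1 Hg1] := @deriv_on2_lim R 0 T (fun n t => P n x t)
    (fun n t => Xsum beta (y1^~ t) (z1^~ t) n x) (fun n t => Ptt n x t) (u x) (utt x) T0
    (fun n => @deriv_on_Xsum_t R T beta y y1 z z1 n x dy dz)
    (fun n => @deriv_on_Xsum_t R T beta y1 _ z1 _ n x
       (fun k k0 => let: And4 _ H _ _ := my k0 in H) (fun k k0 => let: And4 _ H _ _ := mz k0 in H))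
    (fun t tT => Pt x t x01 tT) (ucvg_DT_t Hutt x01).
  by exists g1.
have [ut Hut] := choice ext.
have T00 : 0 <= (0 : R) <= T by rewrite lexx ltW.
have TTT : 0 <= T <= T by rewrite lexx ltW.
have bc x : 0 <= x <= 1 -> u x 0 + d1 * u x T = phi x /\ ut x 0 + d2 * ut x T = psi x.
  move=> x01; have [Hg _ _] := Hut x x01; split.
    apply: lim_uniq (lim_lin d1 (Pt x 0 x01 T00) (Pt x T x01 TTT)) _ => e e0.
    have [N HN] := phiE x01 e0; exists N => n Nn; rewrite /P Xsum_lin.
    rewrite (@eq_Xsum _ _ _ _ po pe); first exact: HN.
      by move=> k /my[].
    by move=> k /mz[].
  have Gt t : 0 <= t <= T -> forall e, 0 < e -> exists N, forall n, (N <= n)%N ->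
      `|Xsum beta (y1^~ t) (z1^~ t) n x - ut x t| <= e.
    by move=> tT e e0; have [N HN] := Hg e e0; exists N => n Nn; exact: HN.
  apply: lim_uniq (lim_lin d2 (Gt 0 T00) (Gt T TTT)) _ => e e0.
  have [N HN] := psiE x01 e0; exists N => n Nn; rewrite Xsum_lin.
  rewrite (@eq_Xsum _ _ _ _ qo qe); first exact: HN.
    by move=> k /my[].
  by move=> k /mz[].
have half01 : 0 <= (1 / 2 : R) <= 1 by apply/andP; split; lra.
(* v = u(1/2,.) - h solves v'' = a v: the value of u_xx at 1/2 is -S/2, and the formula for a was
   designed to cancel it against h'' and f. *)
have uh : forall t, 0 <= t <= T -> u (1 / 2) t - h t = 0.
  have [_ D1 D2] := Hut _ half01; have [bc1 bc2] := bc _ half01.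
  apply: (zero_data_zero T0 d10 d20 d12 r2 MTr ar (deriv_onB D1 dh)).
  - apply: eq_deriv_on (deriv_onB D2 dh1) => // t tT.
    rewrite /utt; have := aE tT.
    have -> : uxx (1 / 2) t = - (1 / 2 * S t).
      apply: lim_uniq (_ : forall e, 0 < e -> exists N, forall n, (N <= n)%N ->
         `|Pxx n (1 / 2) t - _| <= e) _.
        by move=> e e0; have [N HN] := Huxx e e0; exists N => n Nn; exact: HN.
      move=> e e0; have [N HN] := SE e0; exists N => n Nn; have := HN n Nn t tT.
      rewrite /Pxx Xsum_half// /alt_sum.
      have -> : \sum_(1 <= k < n.+1) (-1) ^+ k * - (lam R k ^+ 2 * y k t) =
          - \sum_(1 <= k < n.+1) (-1) ^+ k * lam R k ^+ 2 * y k t.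
        by rewrite -sumrN; apply: eq_bigr => k _; ring.
      rewrite !ler_norml => /andP[? ?]; apply/andP; split; lra.
    move=> H; rewrite mulrBr H; ring.
  - by move: h_phi bc1; lra.
  - by move: h_psi bc2; lra.
exists u; split => //; split => //; split => //.
exists (fun x t => uxT t x), uxx, ut, utt; split.
  split; [by move=> t /HuxT[]|by move=> t /HuxT[]|exact: cuxx|].
  by split; [by move=> x /Hut[]|by move=> x /Hut[]|exact: cutt].
split; first by move=> x t _ _; rewrite /utt; ring.
split; first exact: bc.
move=> t tT; split.
- have H01 : 0 <= (0 : R) <= 1 by rewrite lexx ler01.
  have H11 : 0 <= (1 : R) <= 1 by rewrite lexx ler01.
  apply: lim_uniq (Pt 0 t H01 tT) _ => e e0.
  have c0 : 0 < `|beta| + 1 by rewrite ltr_wpDl.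
  have [N HN] := Pt 1 t H11 tT _ (divr_gt0 e0 c0).
  exists N => n Nn; rewrite /P Xsum_bc// -mulrBr normrM.
  apply: le_trans (_ : (`|beta| + 1) * (e / (`|beta| + 1)) <= _).
    by apply: ler_pM => //; [rewrite lerDl|exact: HN].
  by rewrite mulrC divfK// gt_eqF.
- have [|_ + _] := @limit_coefs R beta b1 0 (y^~ t) (z^~ t) (u^~ t).
    by move=> e e0; have [N HN] := Hu e e0; exists N => n Nn x x01; rewrite mul0r add0r; exact: HN.
  by rewrite mul0r.
- by have := uh t tT; lra.
Qed.

End Synthesis.

(** * From bounds on partial sums to the norm of the ball, and back *)

Section BallNorm.
Variable R : realType.
Implicit Types (w : nat -> R) (B : R).

Lemma sqrte_series_le w B : 0 <= B -> (forall n, l2n w n <= B) ->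
  (sqrte (\sum_(1 <= k <oo) (w k ^+ 2)%:E) <= B%:E)%E.
Proof.
move=> B0 wB; have -> : B%:E = sqrte (B ^+ 2)%:E by rewrite /= sqrtr_sqr ger0_norm.
rewrite lee_sqrt ?lee_fin ?sqr_ge0//.
apply: lime_le; first by apply: is_cvg_nneseries => k _ _; rewrite lee_fin sqr_ge0.
apply: nearW => -[|n]; first by rewrite big_geq// lee_fin sqr_ge0.
rewrite sumEFin lee_fin -l2n_sqr lerXn2r ?nnegrE ?l2n_ge0//; exact: wB.
Qed.

Lemma series_le_sqrte w B : 0 <= B ->
  (sqrte (\sum_(1 <= k <oo) (w k ^+ 2)%:E) <= B%:E)%E -> forall n, l2n w n <= B.
Proof.
move=> B0 + n; have -> : B%:E = sqrte (B ^+ 2)%:E by rewrite /= sqrtr_sqr ger0_norm.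
rewrite lee_sqrt ?lee_fin ?sqr_ge0// => H.
apply: l2n_le => //; rewrite -lee_fin -sumEFin; apply: le_trans H.
by apply: nneseries_lim_ge => k _ _; rewrite lee_fin sqr_ge0.
Qed.

End BallNorm.

Definition interleave (R : realType) (y z : nat -> R -> R) (j : nat) : R -> R :=
  if j == 0%N then fun=> 0 else if odd j then y (uphalf j) else z (uphalf j).

Section Ball.
Variables (R : realType) (T beta : R).
Hypothesis T0 : 0 < T.
Implicit Types (y z : nat -> R -> R) (u : R -> R -> R).
Local Notation p := (pc beta).
Local Notation q := (qc beta).

Lemma interleave_odd y z k : (0 < k)%N -> interleave y z (k.*2).-1 = y k.
Proof.
case: k => // k _; rewrite /interleave doubleS/= odd_double/=.
by rewrite doubleK.
Qed.

Lemma interleave_even y z k : (0 < k)%N -> interleave y z k.*2 = z k.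
Proof.
case: k => // k _; rewrite /interleave doubleS/= odd_double/=.
by rewrite uphalf_double.
Qed.

Lemma series_odd (c : nat -> R) x n :
  series (fun k => c k * Xb beta k x) n.*2.+1 =
  c 0%N * Xb beta 0 x + Xsum beta (fun k => c k.*2.-1) (fun k => c k.*2) n x.
Proof.
elim: n => [|n IH].
  by rewrite /series/= /Xsum big_nat1 big_geq// addr0.
rewrite doubleS /series/= big_nat_recr//= big_nat_recr//= -/(series _ _).
have -> : \sum_(0 <= i < n.*2.+1) c i * Xb beta i x =
  c 0%N * Xb beta 0 x + Xsum beta (fun k => c k.*2.-1) (fun k => c k.*2) n x.
  by rewrite -IH.
rewrite /Xsum [in RHS]big_nat_recr//= -!addrA; congr (_ + (_ + _)).
rewrite /Xb /= odd_double/= /Xo !uphalf_half /= half_double odd_double.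
by rewrite add0n doubleS.
Qed.

(** [Xsum] adds the modes in pairs, whereas [B_expansion] adds them one at a time, so an even number
    of terms ends with an unpaired cosine mode. *)
Lemma B_expansionP (c : nat -> R -> R) u (C : R) : (forall k, cont_on 0 T (c k)) ->
  (forall n t, 0 <= t <= T -> \sum_(1 <= k < n.+1) (lam R k * c k.*2.-1 t) ^+ 2 <= C) ->
  ucvg_DT T (fun n x t => c 0%N t * (p * x + q) +
     Xsum beta (fun k => c k.*2.-1 t) (fun k => c k.*2 t) n x) u ->
  B_expansion T beta u c.
Proof.
move=> cc cC Hu; split => // x t x01 tT.
(* The cosine part alone converges uniformly; the unpaired mode is a difference of two consecutive
   sums of it, hence small. *)
have [||u0 Hu0] := @Xsum_ucvg R T beta (fun k => c k.*2.-1) (fun _ _ => 0) C.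
- exact: cC.
- move=> n s sT; rewrite big1; last by move=> k _; rewrite mulr0 expr0n.
  by apply: le_trans (cC n s sT); exact: sum_sqr_ge0.
apply/cvgrPdist_le => e e0.
have e3 : 0 < e / 3 by rewrite divr_gt0.
have [N1 H1] := Hu _ e3; have [N2 H2] := Hu0 _ e3.
exists (maxn N1 N2).*2.+2 => // n /= Nn; rewrite distrC.
pose m := n.-1./2.
have Nm : (maxn N1 N2 <= m)%N.
  by rewrite /m -[maxn _ _]doubleK half_leq// -ltnS prednK// ltnW// (leq_trans _ Nn).
have [n1 n2] : (N1 <= m)%N /\ (N2 <= m)%N.
  by apply/andP; rewrite -geq_max.
have h1 := H1 m n1 x t x01 tT.
have Xb0 : Xb beta 0 x = p * x + q by [].
have n0 : (0 < n)%N by apply: leq_trans Nn.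
have [od|ev] := boolP (odd n.-1); last first.
  have nE : n = m.*2.+1.
    by rewrite /m -[LHS]prednK// -[X in X.+1](odd_double_half n.-1) (negbTE ev) add0n.
  rewrite nE (series_odd (c^~ t)) Xb0; apply: le_trans h1 _; lra.
have nE : n = m.*2.+2 by rewrite /m -[LHS]prednK// -[X in X.+1](odd_double_half n.-1) od add1n.
have -> : series (fun k => c k t * Xb beta k x) n =
    series (fun k => c k t * Xb beta k x) m.*2.+1 + c m.*2.+1 t * Xb beta m.*2.+1 x.
  by rewrite nE /series/= big_nat_recr.
rewrite (series_odd (c^~ t)) Xb0.
have h2 := H2 m n2 x t x01 tT; have h3 := H2 m.+1 (leqW n2) x t x01 tT.
have E : Xsum beta (fun k => c k.*2.-1 t) (fun=> 0) m.+1 x -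
   Xsum beta (fun k => c k.*2.-1 t) (fun=> 0) m x = c m.*2.+1 t * Xb beta m.*2.+1 x.
  rewrite /Xsum big_nat_recr//= addrAC subrr add0r mul0r addr0 /Xb /Xo/= odd_double/=.
  by rewrite doubleK.
rewrite -E; move: h1 h2 h3; rewrite !ler_norml => /andP[? ?] /andP[? ?] /andP[? ?].
by apply/andP; split; lra.
Qed.

End Ball.

(** * The modes of a classical solution *)

Lemma deriv_on_unique (R : realType) (a b : R) (g g1 g2 : R -> R) : a < b ->
  deriv_on a b g g1 -> deriv_on a b g g2 -> forall x, a <= x <= b -> g1 x = g2 x.
Proof.
move=> ab D1 D2 x xab; apply/eqP; rewrite -subr_eq0 -normr_le0.
apply/ler_addgt0Pl => e e0; rewrite addr0.
have [d d0 Hd] := (deriv_onP _ _ _ _).1 (deriv_onB D1 D2) x xab e e0.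
(* A step of at most half the length: one of x + s and x - s stays in [a,b]. *)
pose s := Num.min d (b - a) / 2.
have m0 : 0 < Num.min d (b - a) by rewrite lt_min d0 subr_gt0.
have [md mb] : Num.min d (b - a) <= d /\ Num.min d (b - a) <= b - a.
  by split; rewrite ge_min lexx ?orbT.
have s0 : 0 < s by rewrite /s divr_gt0.
have [sd sb] : s < d /\ s <= (b - a) / 2 by rewrite /s; split; lra.
have main z : a <= z <= b -> `|z - x| = s -> `|g1 x - g2 x| <= e.
  move=> zab zx; have := Hd z zab; rewrite zx => /(_ sd).
  rewrite (_ : g z - g z - (g x - g x) - (g1 x - g2 x) * (z - x) =
    - ((g1 x - g2 x) * (z - x))); last by ring.
  by rewrite normrN (normrM (g1 x - g2 x)) zx ler_pM2r.
move: xab => /andP[ax xb]; have [h|h] := leP x ((a + b) / 2).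
  apply: (main (x + s)); last by rewrite addrC addKr gtr0_norm.
  by apply/andP; split; lra.
apply: (main (x - s)); last by rewrite addrAC subrr add0r normrN gtr0_norm.
by apply/andP; split; lra.
Qed.

(** * Differentiation under the integral sign *)

Section ParametricIntegral.
Variables (R : realType) (T : R) (g gt : R -> R -> R) (w : R -> R).
Hypotheses (T0 : 0 < T) (cg : forall t, 0 <= t <= T -> cont_on 0 1 (g^~ t))
  (dg : forall x, 0 <= x <= 1 -> deriv_on 0 T (g x) (gt x)) (cw : cont_on 0 1 w).
Hypothesis equi : forall t : R, 0 <= t <= T -> forall e : R, 0 < e ->
  exists2 d : R, 0 < d & forall x t' : R, 0 <= x <= 1 -> 0 <= t' <= T ->
    `|t' - t| < d -> `|gt x t' - gt x t| <= e.

(** The mean value theorem in t turns equicontinuity of gt into difference quotients that converge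
    uniformly in x. *)
Let slope t : 0 <= t <= T -> forall e : R, 0 < e ->
  exists2 d : R, 0 < d & forall x t' : R, 0 <= x <= 1 -> 0 <= t' <= T -> `|t' - t| < d ->
    `|g x t' - g x t - gt x t * (t' - t)| <= e * `|t' - t|.
Proof.
move=> tT e e0; have [d d0 Hd] := equi tT e0; exists d => // x t' x01 t'T tt.
have [/andP[t0 t1] /andP[t'0 t'1]] := (tT, t'T).
case: (ltgtP t t') => [lt|lt|<-]; last by rewrite !subrr mulr0 subrr normr0 mulr0.
- have [c /andP[tc ct] E] := mvt_on (dg x01) t0 lt t'1.
  rewrite E -mulrBl normrM ler_wpM2r// Hd//; first by apply/andP; split; lra.
  apply: le_lt_trans tt; rewrite !gtr0_norm ?subr_gt0//; lra.
- have [c /andP[tc ct] E] := mvt_on (dg x01) t'0 lt t1.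
  rewrite (_ : _ - _ = (gt x c - gt x t) * (t' - t)); last first.
    rewrite mulrBl; congr (_ - _); rewrite -(opprB (g x t)) E; ring.
  rewrite normrM ler_wpM2r// Hd//; first by apply/andP; split; lra.
  apply: le_lt_trans tt; rewrite !ltr0_norm ?subr_lt0//; lra.
Qed.

(** A uniform limit of difference quotients of g. It is needed because [classical_solution] provides
    no continuity of u_t in x. *)
Lemma cont_on_gt t : 0 <= t <= T -> cont_on 0 1 (gt^~ t).
Proof.
move=> tT; apply: within_continuous_unif => e e0.
have [d d0 Hd] := slope tT e0.
pose s := Num.min d T / 2.
have m0 : 0 < Num.min d T by rewrite lt_min d0.
have [md mb] : Num.min d T <= d /\ Num.min d T <= T by split; rewrite ge_min lexx ?orbT.
have s0 : 0 < s by rewrite /s divr_gt0.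
have [sd sb] : s < d /\ s <= T / 2 by rewrite /s; split; lra.
have [t' t'T tt] : exists2 t', 0 <= t' <= T & `|t' - t| = s.
  move: tT => /andP[t0 t1]; have [h|h] := leP t (T / 2).
    exists (t + s); last by rewrite addrC addKr gtr0_norm.
    by apply/andP; split; lra.
  exists (t - s); last by rewrite addrAC subrr add0r normrN gtr0_norm.
  by apply/andP; split; lra.
exists (fun x => (t' - t)^-1 * (g x t' - g x t)).
  by apply: cont_onZ; apply: cont_onB; exact: cg.
move=> x; rewrite /= in_itv/= => x01.
have n0 : t' - t != 0 by rewrite -normr_gt0 tt.
rewrite -(ler_pM2r (_ : 0 < `|t' - t|)) ?normr_gt0// -normrM.
rewrite (_ : _ * _ = g x t' - g x t - gt x t * (t' - t)); last by field.
by apply: Hd => //; rewrite tt.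
Qed.

Lemma deriv_itg : deriv_on 0 T (fun t => itg 0 1 (fun x => w x * g x t))
  (fun t => itg 0 1 (fun x => w x * gt x t)).
Proof.
apply/deriv_onP => t tT e e0; have [K K0 wK] := cont_on_bounded cw.
have K1 : 0 < K + 1 by rewrite ltr_wpDl.
have e1 : 0 < e / (K + 1) by rewrite divr_gt0.
have [d d0 Hd] := slope tT e1; exists d => // t' t'T tt.
have cc s : 0 <= s <= T -> cont_on 0 1 (fun x => w x * g x s).
  by move=> sT; apply: cont_onM; [exact: cw|exact: cg].
have cgt := cont_onM cw (cont_on_gt tT).
have i1 := cont_on_intb (cc _ t'T); have i2 := cont_on_intb (cc _ tT); have i3 := cont_on_intb cgt.
rewrite mulrC -itgZ// -itgB// -itgB; [|exact: intbB|exact: intbZ].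
rewrite (@eq_itg _ _ _ _ (fun x => w x * (g x t' - g x t - gt x t * (t' - t)))); last first.
  by move=> x _; ring.
apply: (@le_trans _ _ (K * (e / (K + 1) * `|t' - t|) * (1 - 0))).
  apply: itg_bound => //.
    apply: (eq_intb _ (intbB (intbB i1 i2) (intbZ (t' - t) i3))) => x _; ring.
  by move=> x x01; rewrite normrM; apply: ler_pM => //; [exact: wK|exact: Hd].
rewrite subr0 mulr1 mulrA ler_wpM2r// mulrCA ler_piMr ?(ltW e0)//.
rewrite ler_pdivrMr// mul1r; lra.
Qed.

End ParametricIntegral.

Lemma eq_mode_eq (R : realType) (T l d1 d2 : R) (F G : R -> R) (ph ps : R) (y z : R -> R) :
  (forall t, 0 <= t <= T -> F t = G t) -> mode_eq T l d1 d2 F ph ps y z ->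
  mode_eq T l d1 d2 G ph ps y z.
Proof.
move=> FG [D1 D2 b1 b2]; split => //; apply: eq_deriv_on D2 => // t tT; by rewrite FG.
Qed.

Lemma ball_bounds (R : realType) (T r : R) (c : nat -> R -> R) (b : R -> R) :
  (B_norm T c + (supnorm T b)%:E <= r%:E)%E ->
  [/\ 0 <= r, supnorm T b <= r,
      forall n, l2n (fun k => lam R k ^+ 3 * supnorm T (c k.*2.-1)) n <= r &
      forall n, l2n (fun k => lam R k ^+ 3 * supnorm T (c k.*2)) n <= r].
Proof.
rewrite /B_norm; set X := sqrte _; set Y := sqrte _ => H.
have X0 : (0 <= X)%E by exact: sqrte_ge0.
have Y0 : (0 <= Y)%E by exact: sqrte_ge0.
have c0 : (0 <= (supnorm T (c 0%N))%:E)%E by rewrite lee_fin supnorm_ge0.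
have b0 : (0 <= (supnorm T b)%:E)%E by rewrite lee_fin supnorm_ge0.
have hb : ((supnorm T b)%:E <= r%:E)%E.
  by apply: le_trans H; rewrite leeDr// !adde_ge0.
have hX : (X <= r%:E)%E.
  by apply: le_trans H; rewrite -!addeA addeCA leeDl// !adde_ge0.
have hY : (Y <= r%:E)%E.
  by apply: le_trans H; rewrite addeC addeA leeDr// !adde_ge0.
have r0 : 0 <= r by rewrite -lee_fin (le_trans b0).
split => //; first exact: (series_le_sqrte r0 hX).
exact: (series_le_sqrte r0 hY).
Qed.

Section SolutionModes.
Variables (R : realType) (T beta d1 d2 r : R).
Hypotheses (T0 : 0 < T) (b1 : beta <> -1).
Variables (phi psi h h1 h2 : R -> R) (f v : R -> R -> R) (b : R -> R).
Hypotheses (cf : cont_DT T f) (f_int : forall t : R, 0 <= t <= T -> itg 0 1 (f^~ t) = 0)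
  (dh : deriv_on 0 T h h1) (dh1 : deriv_on 0 T h1 h2)
  (phi_C : cont_on 0 1 phi) (psi_C : cont_on 0 1 psi).
Implicit Types (x t : R).
Local Notation p := (pc beta).
Local Notation q := (qc beta).
Local Notation L := (Lb beta).

(** [B_expansion] only gives pointwise convergence; the norm bound upgrades it to uniform
    convergence, under which the coefficients can be computed as integrals. *)
Lemma ball_expansion : in_ball T beta r v b -> exists (c0 : R -> R) (y z : nat -> R -> R),
  [/\ good_potential T r b,
      ucvg_DT T (fun n x t => c0 t * (p * x + q) + Xsum beta (y^~ t) (z^~ t) n x) v,
      forall n t, 0 <= t <= T -> \sum_(1 <= k < n.+1) (lam R k ^+ 3 * y k t) ^+ 2 <= r ^+ 2 &
      forall n t, 0 <= t <= T -> \sum_(1 <= k < n.+1) (lam R k ^+ 3 * z k t) ^+ 2 <= r ^+ 2].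
Proof.
move=> [cb [c [[cc sc] nc]]]; have [r0 br ry rz] := ball_bounds nc.
have sup3 (w : nat -> R -> R) n t : (forall k, cont_on 0 T (w k)) -> 0 <= t <= T ->
    l2n (fun k => lam R k ^+ 3 * supnorm T (w k)) n <= r ->
    \sum_(1 <= k < n.+1) (lam R k ^+ 3 * w k t) ^+ 2 <= r ^+ 2.
  move=> cw tT wr; apply: (@le_trans _ _ (l2n (fun k => lam R k ^+ 3 * supnorm T (w k)) n ^+ 2)).
    rewrite l2n_sqr !big_nat; apply: ler_sum => k /andP[k0 _].
    rewrite !(exprMn 2 (lam R k ^+ 3)) ler_wpM2l ?sqr_ge0// -(real_normK (num_real (w k t))).
    by rewrite lerXn2r ?nnegrE ?supnorm_ge0//; exact: supnorm_ge.
  by rewrite lerXn2r ?nnegrE ?l2n_ge0.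
have yC n t tT := @sup3 (fun k => c k.*2.-1) n t (fun k => cc _) tT (ry n).
have zC n t tT := @sup3 (fun k => c k.*2) n t (fun k => cc _) tT (rz n).
exists (c 0%N), (fun k => c k.*2.-1), (fun k => c k.*2); split => //.
  by split => // t tT; apply: le_trans br; exact: supnorm_ge.
have [||G HG] := @Xsum_ucvg R T beta (fun k => c k.*2.-1) (fun k => c k.*2) (r ^+ 2).
- move=> n t tT; exact: le_trans (sum_lam_cube_le (fun k => c k.*2.-1 t) n) (yC n t tT).
- move=> n t tT; exact: le_trans (sum_lam_cube_le (fun k => c k.*2 t) n) (zC n t tT).
move=> e e0; have [N HN] := HG e e0; exists N => n Nn x t x01 tT.
suff -> : v x t = c 0%N t * (p * x + q) + G x t.
  by rewrite opprD addrACA subrr add0r; exact: HN.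
apply: (@lim_uniq R (fun n => c 0%N t * (p * x + q) +
   Xsum beta (fun k => c k.*2.-1 t) (fun k => c k.*2 t) n x)) => [e' e'0|e' e'0].
  have /cvgrPdist_le/(_ e' e'0)[N' _ HN'] := sc x t x01 tT.
  exists N' => m Nm; rewrite distrC -(@series_odd R beta (c^~ t) x m).
  by apply: HN' => /=; rewrite (leq_trans Nm)// -addnn leqW// leq_addr.
have [N' HN'] := HG e' e'0; exists N' => m Nm.
by rewrite opprD addrACA subrr add0r; exact: HN'.
Qed.

(** The equation is integrated against the dual system and differentiated under the integral. An
    integral coefficient is identified with the expansion coefficient of the same index, so both the
    mode equations and the ball estimates apply to it. *)
Lemma solution_modes : classical_solution T beta d1 d2 phi psi f h v b -> in_ball T beta r v b ->
  exists (y z : nat -> R -> R) S,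
  [/\ good_potential T r b, ucvg_DT T (fun n x t => Xsum beta (y^~ t) (z^~ t) n x) v,
      forall k, (0 < k)%N -> (exists y1,
        mode_eq T (lam R k) d1 d2 (fun t => b t * y k t + codd (f^~ t) k)
          (codd phi k) (codd psi k) (y k) y1) /\
        (exists z1,
        mode_eq T (lam R k) d1 d2
          (fun t => b t * z k t + (ceven beta (f^~ t) k - 2 * p * lam R k * y k t))
          (ceven beta phi k) (ceven beta psi k) (z k) z1),
      ucvg [set t | 0 <= t <= T] (alt_sum y) S &
      forall t, 0 <= t <= T -> b t * h t = h2 t - f (1 / 2) t + 1 / 2 * S t].
Proof.
move=> [cv [cb [vx [vxx [vt [vtt [[Dx Dxx cvxx [Dt Dtt cvtt]] [pde [ic bcs]]]]]]]]].
move=> /ball_expansion[c0 [y [z [gb Hv0 yC zC]]]].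
have co t : 0 <= t <= T -> c0 t = 0 /\ forall j, (0 < j)%N ->
    codd (v^~ t) j = y j t /\ ceven beta (v^~ t) j = z j t.
  move=> tT; have [|_ i1 H] := @limit_coefs R beta b1 (c0 t) (y^~ t) (z^~ t) (v^~ t).
    by move=> e e0; have [N HN] := Hv0 e e0; exists N => n Nn x x01; exact: HN.
  by split => //; have [_ i2 _] := bcs t tT; move: i1; rewrite /itg i2; lra.
have Hv : ucvg_DT T (fun n x t => Xsum beta (y^~ t) (z^~ t) n x) v.
  move=> e e0; have [N HN] := Hv0 e e0; exists N => n Nn x t x01 tT.
  by have := HN n Nn x t x01 tT; rewrite (co t tT).1 mul0r add0r.
have cvt t : 0 <= t <= T -> cont_on 0 1 (v^~ t) by move=> tT; exact: cont_DT_x.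
(* u_t is Lipschitz in t uniformly in x, because u_tt is bounded on the compact rectangle. *)
have equi1 t : 0 <= t <= T -> forall e : R, 0 < e -> exists2 d : R, 0 < d &
    forall x t', 0 <= x <= 1 -> 0 <= t' <= T -> `|t' - t| < d -> `|vt x t' - vt x t| <= e.
  move=> tT e e0; have [K K0 HK] := cont_DT_bounded T0 cvtt.
  have K1 : 0 < K + 1 by rewrite ltr_wpDl.
  exists (e / (K + 1)); first by rewrite divr_gt0.
  move=> x t' x01 t'T tt.
  have := deriv_on_lipschitz (Dtt x x01) (fun s sT => HK x s x01 sT) tT t'T.
  move=> /le_trans; apply; rewrite ltr_pdivlMr// in tt.
  by have := normr_ge0 (t' - t); lra.
have equi2 := cont_DT_equi cvtt.
have cvtt1 t : 0 <= t <= T -> cont_on 0 1 (vt^~ t).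
  exact: (cont_on_gt T0 cvt Dt equi1).
have dW w : cont_on 0 1 w ->
    deriv_on 0 T (fun t => itg 0 1 (fun x => w x * v x t))
      (fun t => itg 0 1 (fun x => w x * vt x t)) /\
    deriv_on 0 T (fun t => itg 0 1 (fun x => w x * vt x t))
      (fun t => itg 0 1 (fun x => w x * vtt x t)).
  by move=> cw; split; [exact: deriv_itg T0 cvt Dt cw equi1|exact: deriv_itg T0 cvtt1 Dtt cw equi2].
have icw w t g : 0 <= t <= T -> cont_on 0 1 w -> cont_DT T g -> intb 0 1 (fun x => w x * g x t).
  by move=> tT cw cg; apply: cont_on_intb; apply: cont_onM => //; exact: cont_DT_x.
have vttE w t : 0 <= t <= T -> cont_on 0 1 w -> itg 0 1 (fun x => w x * vtt x t) =
    itg 0 1 (fun x => w x * vxx x t) + b t * itg 0 1 (fun x => w x * v x t) +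
    itg 0 1 (fun x => w x * f x t).
  move=> tT cw; rewrite -itgZ; last exact: icw.
  rewrite -itgD; [|exact: icw|by apply: intbZ; exact: icw].
  rewrite -itgD; [|by apply: intbD; [exact: icw|apply: intbZ; exact: icw]|exact: icw].
  apply: eq_itg => x x01; have := pde x t x01 tT.
  by move=> /eqP; rewrite subr_eq => /eqP ->; ring.
have acv t : 0 <= t <= T -> AC (v^~ t) (vx^~ t).
  by move=> tT; apply: deriv_on_AC; [exact: Dx|exact: deriv_on_cont (Dxx t tT)].
have acvx t : 0 <= t <= T -> AC (vx^~ t) (vxx^~ t).
  by move=> tT; apply: deriv_on_AC; [exact: Dxx|exact: cont_DT_x].
have c1 : cont_on 0 1 (fun=> 1 : R) by exact: cont_on_cst.
have zero t : 0 <= t <= T -> itg 0 1 (fun x => 1 * vtt x t) = 0.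
  have [D1 D2] := dW _ c1.
  have z0 s : 0 <= s <= T -> 0 = itg 0 1 (fun x => 1 * v x s).
    move=> sT; have [_ i2 _] := bcs s sT; rewrite -[LHS]i2.
    by apply: eq_itg => x _; rewrite mul1r.
  have D10 : deriv_on 0 T (fun t => itg 0 1 (fun x => 1 * v x t)) (fun=> 0).
    by apply: (eq_deriv_on _ _ (@deriv_on_cst R 0 T 0)) => // s sT; exact: z0.
  have z1 s : 0 <= s <= T -> 0 = itg 0 1 (fun x => 1 * vt x s).
    by move=> sT; exact: (deriv_on_unique T0 D10 D1 sT).
  have D20 : deriv_on 0 T (fun t => itg 0 1 (fun x => 1 * vt x t)) (fun=> 0).
    by apply: (eq_deriv_on _ _ (@deriv_on_cst R 0 T 0)) => // s sT; exact: z1.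
  by move=> tT; apply/esym; exact: (deriv_on_unique T0 D20 D2 tT).
(* Integrating the equation over x, every term but int u_xx = u_x(1,t) - u_x(0,t) vanishes. *)
have vx_bc t : 0 <= t <= T -> vx 0 t = vx 1 t.
  move=> tT; have := zero t tT; rewrite vttE//.
  have e1 (g : R -> R -> R) : itg 0 1 (fun x => 1 * g x t) = itg 0 1 (g^~ t).
    by apply: eq_itg => x _; rewrite mul1r.
  have [_ i2 _] := bcs t tT.
  rewrite !e1 f_int// addr0 [X in b t * X]i2 mulr0 addr0.
  rewrite (ftc2 ler01 _ (Dxx t tT)); last exact: cont_DT_x.
  by lra.
exists y, z.
have Hodd k : (0 < k)%N -> exists y1, mode_eq T (lam R k) d1 d2
    (fun t => b t * y k t + codd (f^~ t) k) (codd phi k) (codd psi k) (y k) y1.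
  move=> k0; pose w x := 4 * cos (lam R k * x).
  have cw : cont_on 0 1 w by apply: cont_onZ; exact: cont_on_cosZ.
  have wE g : intb 0 1 (fun x => g x * cos (lam R k * x)) ->
      itg 0 1 (fun x => w x * g x) = codd g k.
    by move=> ig; rewrite /codd -itgZ//; apply: eq_itg => x _; rewrite /w; ring.
  have icos g : cont_on 0 1 g -> intb 0 1 (fun x => g x * cos (lam R k * x)).
    by move=> cg; apply: intb_cos; exact: cont_on_intb.
  have yE t : 0 <= t <= T -> itg 0 1 (fun x => w x * v x t) = y k t.
    move=> tT; have [_ /(_ k k0)[<- _]] := co t tT; apply: wE; apply: icos; exact: cvt.
  have [D1 D2] := dW w cw.
  have T00 : 0 <= (0 : R) <= T by rewrite lexx ltW.
  have TTT : 0 <= T <= T by rewrite lexx ltW.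
  exists (fun t => itg 0 1 (fun x => w x * vt x t)); split.
  - exact: eq_deriv_on D1.
  - apply: eq_deriv_on D2 => // t tT; rewrite vttE// yE// wE; last by apply: icos; exact: cont_DT_x.
    rewrite wE; last by apply: icos; exact: cont_DT_x.
    have := itg_cos_parts2 k (acv t tT) (acvx t tT) (vx_bc t tT).
    have [_ /(_ k k0)[E _]] := co t tT; rewrite -E /codd => E2.
    have -> : itg 0 1 (fun x => vxx x t * cos (lam R k * x)) =
      - (lam R k ^+ 2 * itg 0 1 (fun x => v x t * cos (lam R k * x))) by rewrite E2 opprK.
    by ring.
  - rewrite -!yE// -itgZ; last exact: icw.
    rewrite -itgD; [|exact: icw|by apply: intbZ; exact: icw].
    rewrite -(wE phi); last exact: icos.
    by apply: eq_itg => x x01; have [<- _] := ic x x01; ring.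
  - have ivt t : 0 <= t <= T -> intb 0 1 (fun x => w x * vt x t).
      by move=> tT; apply: cont_on_intb; apply: cont_onM => //; exact: cvtt1.
    rewrite -itgZ; last exact: ivt.
    rewrite -itgD; [|exact: ivt|by apply: intbZ; exact: ivt].
    rewrite -(wE psi); last exact: icos.
    by apply: eq_itg => x x01; have [_ <-] := ic x x01; ring.
have Heven k : (0 < k)%N -> exists z1, mode_eq T (lam R k) d1 d2
    (fun t => b t * z k t + (ceven beta (f^~ t) k - 2 * p * lam R k * y k t))
    (ceven beta phi k) (ceven beta psi k) (z k) z1.
  move=> k0; pose w x := 4 * (L x * sin (lam R k * x)).
  have cL := @cont_on_Lb R beta 0 1.
  have cw : cont_on 0 1 w.
    by apply: cont_onZ; apply: cont_onM => //; exact: cont_on_sinZ.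
  have wE g : intb 0 1 (fun x => L x * g x * sin (lam R k * x)) ->
      itg 0 1 (fun x => w x * g x) = ceven beta g k.
    by move=> ig; rewrite /ceven -itgZ//; apply: eq_itg => x _; rewrite /w; ring.
  have isin g : cont_on 0 1 g -> intb 0 1 (fun x => L x * g x * sin (lam R k * x)).
    by move=> cg; apply: intb_sin; apply: cont_on_intb; exact: cont_onM.
  have zE t : 0 <= t <= T -> itg 0 1 (fun x => w x * v x t) = z k t.
    move=> tT; have [_ /(_ k k0)[_ <-]] := co t tT; apply: wE; apply: isin; exact: cvt.
  have [D1 D2] := dW w cw.
  have T00 : 0 <= (0 : R) <= T by rewrite lexx ltW.
  have TTT : 0 <= T <= T by rewrite lexx ltW.
  exists (fun t => itg 0 1 (fun x => w x * vt x t)); split.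
  - exact: eq_deriv_on D1.
  - apply: eq_deriv_on D2 => // t tT; rewrite vttE// zE// wE; last by apply: isin; exact: cont_DT_x.
    rewrite wE; last by apply: isin; exact: cont_DT_x.
    have [bc _ _] := bcs t tT.
    have := itg_sin_parts2 k (AC_LbM beta (acv t tT))
      (AC_LbM2 beta (acv t tT) (acvx t tT)) (Lb_bc b1 bc).
    have := itg_cos_parts k (acv t tT).
    have [_ /(_ k k0)[Eo Ee]] := co t tT; rewrite -Eo -Ee /codd /ceven => E1.
    have cvx : cont_on 0 1 (vx^~ t) by exact: deriv_on_cont (Dxx t tT).
    rewrite (@eq_itg _ _ _ (fun x => (L x * vxx x t - 2 * p * vx x t) * sin (lam R k * x))
      (fun x => L x * vxx x t * sin (lam R k * x) -
         2 * p * (vx x t * sin (lam R k * x)))); last first.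
      by move=> x _; ring.
    rewrite itgB; [|by apply: isin; exact: cont_DT_x
      |by apply: intbZ; apply: intb_sin; exact: cont_on_intb].
    rewrite itgZ; last by apply: intb_sin; exact: cont_on_intb.
    move=> E2.
    have -> : itg 0 1 (fun x => L x * vxx x t * sin (lam R k * x)) =
      - (lam R k ^+ 2 * itg 0 1 (fun x => L x * v x t * sin (lam R k * x)))
      - 2 * p * (lam R k * itg 0 1 (fun x => v x t * cos (lam R k * x))).
      by rewrite E1 E2; ring.
    by ring.
  - rewrite -!zE// -itgZ; last exact: icw.
    rewrite -itgD; [|exact: icw|by apply: intbZ; exact: icw].
    rewrite -(wE phi); last exact: isin.
    by apply: eq_itg => x x01; have [<- _] := ic x x01; ring.
  - have ivt t : 0 <= t <= T -> intb 0 1 (fun x => w x * vt x t).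
      by move=> tT; apply: cont_on_intb; apply: cont_onM => //; exact: cvtt1.
    rewrite -itgZ; last exact: ivt.
    rewrite -itgD; [|exact: ivt|by apply: intbZ; exact: ivt].
    rewrite -(wE psi); last exact: isin.
    by apply: eq_itg => x x01; have [_ <-] := ic x x01; ring.
have [g Hg] := Xsum2_ucvg beta T0 yC zC.
have Pv x t : 0 <= x <= 1 -> 0 <= t <= T -> forall e, 0 < e -> exists N, forall n, (N <= n)%N ->
    `|Xsum beta (y^~ t) (z^~ t) n x - v x t| <= e.
  by move=> x01 tT e e0; have [N HN] := Hv e e0; exists N => n Nn; exact: HN.
(* The limit of the twice differentiated series is u_xx itself, by uniqueness of derivatives; its
   value at 1/2 therefore determines S. *)
have gE x t : 0 <= x <= 1 -> 0 <= t <= T -> vxx x t = g x t.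
  move=> x01 tT.
  have [g1 [_ G1 G2]] := @deriv_on2_lim R 0 1 (fun n x => Xsum beta (y^~ t) (z^~ t) n x)
    (fun n => Xsum1 beta (y^~ t) (z^~ t) n) _ (v^~ t) (g^~ t) ltr01
    (fun n => @deriv_on_Xsum R beta (y^~ t) (z^~ t) n) (fun n => @deriv_on_Xsum1 R beta _ _ n)
    (fun x x01 => Pv x t x01 tT) (ucvg_DT_x Hg tT).
  have E1 := deriv_on_unique ltr01 (Dx t tT) G1.
  have D2 : deriv_on 0 1 (vx^~ t) (g^~ t) by apply: (eq_deriv_on _ _ G2) => // s s01; rewrite E1.
  exact: (deriv_on_unique ltr01 (Dxx t tT) D2 x01).
have half01 : 0 <= (1 / 2 : R) <= 1 by apply/andP; split; lra.
exists (fun t => - 2 * g (1 / 2) t); split => //.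
- by move=> k k0; split; [exact: Hodd|exact: Heven].
- move=> e e0; have [N HN] := Hg _ (divr_gt0 e0 (ltr0n R 2)); exists N => n Nn t tT.
  have := HN n Nn _ t half01 tT; rewrite Xsum_half// /alt_sum.
  have -> : \sum_(1 <= k < n.+1) (-1) ^+ k * - (lam R k ^+ 2 * y k t) =
      - \sum_(1 <= k < n.+1) (-1) ^+ k * lam R k ^+ 2 * y k t.
    by rewrite -sumrN; apply: eq_bigr => k _; ring.
  by rewrite !ler_norml => /andP[? ?]; apply/andP; split; lra.
- move=> t tT; have hE s : 0 <= s <= T -> v (1 / 2) s = h s by move=> sT; case: (bcs s sT).
  have E1 : forall s, 0 <= s <= T -> vt (1 / 2) s = h1 s.
    have D1 : deriv_on 0 T (v (1 / 2)) h1.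
      by apply: (eq_deriv_on _ _ dh) => // s sT; rewrite hE.
    by move=> s sT; exact: (deriv_on_unique T0 (Dt _ half01) D1 sT).
  have E2 : vtt (1 / 2) t = h2 t.
    have D2 : deriv_on 0 T (vt (1 / 2)) h2.
      by apply: (eq_deriv_on _ _ dh1) => // s sT; rewrite E1.
    exact: (deriv_on_unique T0 (Dtt _ half01) D2 tT).
  by have := pde _ t half01 tT; rewrite hE// E2 gE//; lra.
Qed.

End SolutionModes.

(** * Existence and uniqueness *)

(* p, F, W and S play the roles of |pc beta|, |phi(1/2)|, the norm of
   phi''' (1-q-px) - 3 p phi'' and sum_lam. A large p forces N = ||1/h|| to be
   large, hence T to be small by the term B_4. *)
Lemma weight_slope_num (R : realType) (p F N S W A MT rh d1 d2 : R) :
  0 <= p -> 0 <= N -> 0 <= W -> 0 <= A -> 0 <= MT -> 0 < rh -> 0 <= d1 -> 0 <= d2 ->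
  p * F <= W / 2 -> 1 + d1 <= N * F -> 1 / 2 * N * S * MT * (A + 2) ^+ 2 <= 1 ->
  1 / 8 <= S -> 8 * rh * (1 + d2) * W <= A -> 1 <= rh * (1 + d1) * (1 + d2) ->
  2 * p * MT <= 1 / 4.
Proof.
move=> p0 N0 W0 A0 MT0 rh0 d10 d20 pF NF B4 S8 WA rh1.
have s1 : p * (1 + d1) <= N * (W / 2).
  have := ler_wpM2l p0 NF; have := ler_wpM2l N0 pF; lra.
set X := MT * (A + 2) ^+ 2.
have X0 : 0 <= X by rewrite mulr_ge0// sqr_ge0.
have s2 : N * X <= 16.
  have NX0 : 0 <= N * X by rewrite mulr_ge0.
  have := ler_wpM2l NX0 S8; move: B4; rewrite /X; lra.
have s3 : p * X * (1 + d1) <= 8 * W.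
  have := ler_wpM2l X0 s1; have := ler_wpM2r W0 s2; lra.
have pX0 : 0 <= p * X by rewrite mulr_ge0.
have rd0 : 0 <= rh * (1 + d2) by rewrite mulr_ge0 ?addr_ge0// ltW.
(* The factor 1 + d1 gained from h is traded for rho (1 + d2) through rho (1 + d1) (1 + d2) >= 1,
   which is the coefficient of W in A_3. *)
have s4 : p * X <= A.
  have := ler_wpM2l pX0 rh1; have := ler_wpM2l rd0 s3; lra.
(* A <= (A + 2)^2 / 8 is just (A - 2)^2 >= 0. *)
have s5 : (p * MT - 1 / 8) * (A + 2) ^+ 2 <= 0.
  have := sqr_ge0 (A - 2); move: s4; rewrite /X; lra.
have s6 : p * MT <= 1 / 8.
  rewrite leNgt; apply/negP => lt; move: s5; apply/negP; rewrite -ltNge.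
  by rewrite mulr_gt0 ?subr_gt0// exprn_gt0//; lra.
lra.
Qed.

(** The coupling is a source of size 2 |p| lam_k D whose lam_k cancels the division by lam_k in the
    mode bound. The extra term 2 |p| M T D is therefore uniform in k, and no decay of y_k is
    lost. *)
Lemma even_mode_exists (R : realType) (T d1 d2 r : R) (a F y : R -> R) (k : nat) (p ph ps D : R) :
  0 < T -> 0 <= d1 -> 0 <= d2 -> d1 + d2 < 1 + d1 * d2 -> good_potential T r a ->
  Mc d1 d2 * T * r <= 1 / 4 -> (0 < k)%N -> cont_on 0 T F -> cont_on 0 T y ->
  (forall t, 0 <= t <= T -> `|y t| <= D) ->
  exists z z1, mode_eq T (lam R k) d1 d2
      (fun t => a t * z t + (F t - 2 * p * lam R k * y t)) ph ps z z1 /\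
    forall t, 0 <= t <= T ->
      `|z t| <= 16 / 15 * (mode_size T d1 d2 k ph ps F + 2 * `|p| * (Mc d1 d2 * T) * D).
Proof.
move=> T0 d10 d20 d12 [ca ar] MTr k0 cF cy yD.
have l0 := lam_gt0 R k0.
have small : Mc d1 d2 * T * r / lam R k <= 1 / 16.
  by rewrite ler_pdivrMr//; have := lam_ge R k0; lra.
pose c := 2 * `|p| * lam R k * D.
pose J t := itg 0 t (fun s => `|F s|) + c * t.
have dJ : deriv_on 0 T J (fun t => `|F t| + c).
  have := deriv_onD (deriv_on_itg (cont_on_norm cF)) (deriv_onZ c (@deriv_on_id R 0 T)).
  by apply: eq_deriv_on => // t _; rewrite mulr1.
have FG t : 0 <= t <= T -> `|F t - 2 * p * lam R k * y t| <= `|F t| + c.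
  move=> tT; apply: le_trans (ler_normB _ _) _; rewrite lerD2l.
  rewrite (normrM (2 * p * lam R k)) (normrM (2 * p)) (normrM 2 p).
  rewrite (gtr0_norm l0) (ger0_norm (ler0n R 2)).
  by apply: ler_wpM2l (yD t tT); apply: mulr_ge0; [exact: mulr_ge0|exact: ltW].
have cG : cont_on 0 T (fun t => F t - 2 * p * lam R k * y t).
  by apply: cont_onB => //; exact: cont_onZ.
have [z [z1 H]] := potential_exists T0 l0 d10 d20 d12 ca ar small ph ps cG dJ FG.
exists z, z1; split => //.
apply: (potential_bound T0 l0 d10 d20 d12 ar small H dJ FG).
rewrite /mode_size /J itg_point mulr0 addr0 subr0 /c le_eqVlt; apply/orP; left; apply/eqP.
by field; rewrite gt_eqF.
Qed.

Lemma l2n_scale (R : realType) (y s : nat -> R) (c : R) n : 0 <= c ->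
  (forall k, (0 < k)%N -> `|y k| <= c * s k) ->
  l2n (fun k => lam R k ^+ 3 * y k) n <= c * l2n (fun k => lam R k ^+ 3 * s k) n.
Proof.
move=> c0 ys; rewrite -[X in X * _](ger0_norm c0) -l2nZ; apply: le_l2n => k k0.
have l3 : 0 <= lam R k ^+ 3 by rewrite exprn_ge0// ltW// lam_gt0.
rewrite (normrM (lam R k ^+ 3)) (ger0_norm l3) mulrCA (normrM (lam R k ^+ 3)) (ger0_norm l3).
by apply: ler_wpM2l => //; apply: le_trans (ys k k0) (ler_norm _).
Qed.

Lemma L2norm_DT_ge0 (R : realType) (T : R) g : 0 <= L2norm_DT T g.
Proof. by rewrite /L2norm_DT fine_ge0// Lnorm_ge0. Qed.

(** * Verification of the smallness conditions and the norm count *)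

Section Main.
Variables (R : realType) (T beta delta1 delta2 : R)
  (phi phi1 phi2 phi3 psi psi1 psi2 : R -> R)
  (f fx fxx : R -> R -> R) (h h1 h2 : R -> R).
Hypotheses (T_gt0 : 0 < T) (beta_neqN1 : beta <> -1)
  (delta1_ge0 : 0 <= delta1) (delta2_ge0 : 0 <= delta2)
  (delta12 : delta1 + delta2 < 1 + delta1 * delta2)
  (phi_d1 : deriv_on 0 1 phi phi1) (phi_d2 : deriv_on 0 1 phi1 phi2)
  (phi_C2 : cont_on 0 1 phi2) (phi_d3 : L2_deriv phi2 phi3)
  (phi_bc : phi 0 = beta * phi 1) (phi1_bc : phi1 0 = phi1 1)
  (phi2_bc : phi2 0 = beta * phi2 1)
  (psi_d1 : deriv_on 0 1 psi psi1)
  (psi_C1 : cont_on 0 1 psi1) (psi_d2 : L2_deriv psi1 psi2)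
  (psi_bc : psi 0 = beta * psi 1) (psi1_bc : psi1 0 = psi1 1)
  (f_C : cont_DT T f) (f_dx : deriv_x T f fx) (fx_C : cont_DT T fx)
  (f_dxx : L2_deriv_x T fx fxx)
  (f_bc : forall t : R, 0 <= t <= T -> f 0 t = beta * f 1 t)
  (fx_bc : forall t : R, 0 <= t <= T -> fx 0 t = fx 1 t)
  (h_d1 : deriv_on 0 T h h1) (h_d2 : deriv_on 0 T h1 h2)
  (h_C2 : cont_on 0 T h2)
  (h_neq0 : forall t : R, 0 <= t <= T -> h t <> 0)
  (f_int : forall t : R, 0 <= t <= T -> itg 0 1 (f^~ t) = 0)
  (phi_int : itg 0 1 phi = 0) (psi_int : itg 0 1 psi = 0)
  (h_phi : h 0 + delta1 * h T = phi (1 / 2))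
  (h_psi : h1 0 + delta2 * h1 T = psi (1 / 2)).

Let a1 := A1 T delta1 delta2 phi psi f.
Let a2 := A2 T delta1 delta2 phi3 psi2 fxx.
Let a3 := A3 T beta delta1 delta2 phi2 phi3 psi1 psi2 fx fxx.
Let a4 := A4 T delta1 delta2 phi3 psi2 f fxx h h2.
Let b1 := B1 T delta1 delta2.
Let b2 := B2 T delta1 delta2.
Let b3 := B3 T delta1 delta2.
Let b4 := B4 T delta1 delta2 h.
Let r := a1 + a2 + a3 + a4 + 2.
Hypothesis small : (b1 + b2 + b3 + b4) * r ^+ 2 < 1.

Local Notation M := (Mc delta1 delta2).
Local Notation rh := (rho delta1 delta2).
Local Notation S0 := (sum_lam R).
Let hi t := (h t)^-1.
Let g t := h2 t - f (1 / 2) t.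
Let N := supnorm T hi.
Let G := supnorm T g.
Let Q := a2 / 2.

Let T_ge0 : 0 <= T. Proof. exact: ltW. Qed.
Let rho_ge0 : 0 <= rh. Proof. by rewrite ltW// rho_gt0. Qed.
Let M_ge0 : 0 <= M. Proof. by rewrite (le_trans ler01)// Mc_ge1. Qed.
Let N_ge0 : 0 <= N. Proof. exact: supnorm_ge0. Qed.
Let G_ge0 : 0 <= G. Proof. exact: supnorm_ge0. Qed.
Let MT_ge0 : 0 <= M * T. Proof. exact: mulr_ge0. Qed.

Ltac nonneg := repeat first [done | exact: L2norm_ge0 | exact: L2norm_DT_ge0
  | exact: sqrtr_ge0 | rewrite invr_ge0 | apply: addr_ge0 | apply: mulr_ge0 | apply: exprn_ge0].

Let rho1_ge0 : 0 <= rho1 T delta1 delta2. Proof. by rewrite /rho1; nonneg. Qed.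
Let rho2_ge0 : 0 <= rho2 T delta1 delta2. Proof. by rewrite /rho2; nonneg. Qed.
Let a1_ge0 : 0 <= a1. Proof. by rewrite /a1 /A1; nonneg. Qed.
Let a2_ge0 : 0 <= a2. Proof. by rewrite /a2 /A2; nonneg. Qed.
Let b1_ge0 : 0 <= b1. Proof. by rewrite /b1 /B1; nonneg. Qed.
Let b2_ge0 : 0 <= b2. Proof. by rewrite /b2 /B2; nonneg. Qed.
Let b3_ge0 : 0 <= b3. Proof. by rewrite /b3 /B3; nonneg. Qed.

Let w x := phi3 x * (1 - qc beta - pc beta * x) - 3 * pc beta * phi2 x.

Let a3_ge : 8 * rh * (1 + delta2) * L2norm w <= a3.
Proof. by rewrite /a3 /A3 -/w -!addrA lerDl; nonneg. Qed.

Let a3_ge0 : 0 <= a3. Proof. by apply: le_trans a3_ge; nonneg. Qed.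

Let a4E : a4 = N * (G + 1 / 2 * S0 * Q).
Proof. by rewrite /a4 /A4 /Q /a2 /A2 -/hi -/g -/N -/G; field. Qed.

Let b4E : b4 = 1 / 2 * N * S0 * M * T. Proof. by []. Qed.

Let Q_ge0 : 0 <= Q. Proof. by rewrite /Q; apply: divr_ge0. Qed.

Let a4_ge0 : 0 <= a4.
Proof. by have S00 := sum_lam_ge0 R; rewrite a4E; nonneg. Qed.

Let b4_ge0 : 0 <= b4.
Proof. by have S00 := sum_lam_ge0 R; rewrite b4E; nonneg. Qed.

Let r2 : 2 <= r.
Proof. by move: a1_ge0 a2_ge0 a3_ge0 a4_ge0; rewrite /r; lra. Qed.

Let rr_ge0 : 0 <= r ^+ 2. Proof. exact: sqr_ge0. Qed.

Let small2 : b2 * r ^+ 2 <= 1.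
Proof.
by have := mulr_ge0 (addr_ge0 (addr_ge0 b1_ge0 b3_ge0) b4_ge0) rr_ge0; move: small; lra.
Qed.

Let small4 : b4 * r ^+ 2 <= 1.
Proof.
by have := mulr_ge0 (addr_ge0 (addr_ge0 b1_ge0 b2_ge0) b3_ge0) rr_ge0; move: small; lra.
Qed.

(** B_2 is 2 M T, and r >= 2 gives 4 M T r <= 2 M T r^2 <= 1. *)
Let MTr : M * T * r <= 1 / 4.
Proof.
have MTr0 : 0 <= M * T * r by apply: mulr_ge0 => //; apply: le_trans r2.
by have := ler_wpM2l MTr0 r2; move: small2; rewrite /b2 /B2; lra.
Qed.

(** For |p| <= 1 this follows from [MTr] and r >= 2, which give M T <= 1/8. For larger |p| the link
    runs through phi(1/2) and the norm of 1/h. *)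
Let slope : 2 * `|pc beta| * (M * T) <= 1 / 4.
Proof.
have [ple|pgt] := leP `|pc beta| 1.
  have MT8 : M * T <= 1 / 8 by have := ler_wpM2l MT_ge0 r2; move: MTr; lra.
  by move: `|pc beta| ple => p' ple; have := ler_wpM2r MT_ge0 ple; lra.
have aphi2 : AC phi2 phi3 by case: phi_d3 => /L2_L2b[i3 _] ac; split.
have wE : w = (fun x => Lb beta x * phi3 x - 3 * pc beta * phi2 x).
  by apply/funext => x; rewrite /w mulrC.
have Lw : L2b (fun x => Lb beta x * phi3 x - 3 * pc beta * phi2 x).
  apply: (L2bD (h := fun x => - (3 * pc beta * phi2 x))).
    by apply: L2bM_cont; [case: phi_d3 => /L2_L2b|exact: cont_on_Lb].
  by apply: cont_on_L2b; apply: cont_onN; exact: cont_onZ.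
have mid := midpoint_bound beta_neqN1 pgt phi_d1 phi_d2 aphi2 Lw phi1_bc phi_int.
rewrite -wE in mid.
have hN := supnormV_ge T_gt0 delta1_ge0 (deriv_on_cont h_d1) h_neq0.
rewrite h_phi -/hi -/N in hN.
have rd1 := rho_mul_ge1 delta1_ge0 delta2_ge0 delta12.
have [S8 _] := sum_lam_facts R.
have A_ge0 : 0 <= a1 + a2 + a3 + a4 by nonneg.
apply: (weight_slope_num (normr_ge0 _) N_ge0 (L2norm_ge0 w) A_ge0 MT_ge0 (rho_gt0 delta12)
  delta1_ge0 delta2_ge0 mid hN _ S8 _ rd1).
  by move: small4; rewrite b4E !mulrA.
by apply: le_trans a3_ge _; move: a1_ge0 a2_ge0 a4_ge0; lra.
Qed.

Let Qr : 2 * Q <= r.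
Proof. by move: a1_ge0 a3_ge0 a4_ge0; rewrite /r /Q; lra. Qed.

Let NSMT : 1 / 2 * N * S0 * M * T * r ^+ 2 <= 1. Proof. by rewrite -b4E. Qed.

Let Nr : N * (G + 1 / 2 * S0 * Q) + 2 / 15 <= r.
Proof. by rewrite -a4E; move: a1_ge0 a2_ge0 a3_ge0; rewrite /r; lra. Qed.

Let s1 := odd_size T delta1 delta2 phi psi f.
Let s2 := even_size T beta delta1 delta2 phi psi f.

Let s1Q n : l2n (fun k => lam R k ^+ 3 * s1 k) n <= Q.
Proof.
exact: (odd_size_bound T_gt0 delta1_ge0 delta2_ge0 delta12 phi_d1 phi_d2 phi_C2 phi_d3 phi1_bc
  psi_d1 psi_C1 psi_d2 psi1_bc f_C f_dx fx_C f_dxx fx_bc).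
Qed.

Let s2Q n : l2n (fun k => lam R k ^+ 3 * s2 k) n <= a3 / 2.
Proof.
exact: (even_size_bound T_gt0 beta_neqN1 delta1_ge0 delta2_ge0 delta12 phi_d1 phi_d2 phi_C2 phi_d3
  phi_bc phi1_bc phi2_bc psi_d1 psi_C1 psi_d2 psi_bc f_C f_dx fx_C f_dxx f_bc).
Qed.

(** Size of the even modes with the coupling included; 16/15 times [s1] bounds y_k, and in [E] the
    1/4 is the bound of [slope]. *)
Let s3 k := s2 k + 2 * `|pc beta| * (M * T) * (16 / 15 * s1 k).
Let E := a3 / 2 + 1 / 4 * (16 / 15 * Q).

Let E_ge0 : 0 <= E.
Proof. by move: a3_ge0 Q_ge0; rewrite /E; lra. Qed.

Let s3E n : l2n (fun k => lam R k ^+ 3 * s3 k) n <= E.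
Proof.
have k0 : 0 <= 2 * `|pc beta| * (M * T) * (16 / 15).
  by apply: mulr_ge0; [apply: mulr_ge0 => //; exact: mulr_ge0|lra].
apply: (@le_trans _ _ (l2n (fun k => lam R k ^+ 3 * s2 k) n +
   2 * `|pc beta| * (M * T) * (16 / 15) * l2n (fun k => lam R k ^+ 3 * s1 k) n)).
  rewrite -[X in _ <= _ + X * _](ger0_norm k0) -l2nZ.
  apply: le_trans (l2nD _ _ _); rewrite le_eqVlt; apply/orP; left; apply/eqP.
  by congr l2n; apply/funext => k; rewrite /s3; ring.
apply: lerD; first exact: s2Q.
have l0 := l2n_ge0 (fun k => lam R k ^+ 3 * s1 k) n.
apply: (@le_trans _ _ (1 / 4 * (16 / 15) * l2n (fun k => lam R k ^+ 3 * s1 k) n)).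
  by apply: ler_wpM2r => //; apply: ler_wpM2r; [lra|exact: slope].
by have := s1Q n; lra.
Qed.

(** The budget in full: the modes take 8/15 + 32/225 = 152/225 of A_2 and 8/15 of A_3, and a takes
    A_4 + 2/15. *)
Let total : 16 / 15 * Q + 16 / 15 * E + (a4 + 2 / 15) <= r.
Proof. by move: a1_ge0 a2_ge0 a3_ge0; rewrite /E /Q /r; lra. Qed.

Let phi_C : cont_on 0 1 phi. Proof. exact: deriv_on_cont phi_d1. Qed.
Let psi_C : cont_on 0 1 psi. Proof. exact: deriv_on_cont psi_d1. Qed.

Let half01 : 0 <= (1 / 2 : R) <= 1. Proof. by apply/andP; split; lra. Qed.

Let chi : cont_on 0 T hi.
Proof. by apply: cont_onV => //; exact: deriv_on_cont h_d1. Qed.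

Let cg : cont_on 0 T g.
Proof. by apply: cont_onB => //; exact: cont_DT_t. Qed.

Let cFo k : cont_on 0 T (fun t => codd (f^~ t) k). Proof. exact: cont_on_codd. Qed.
Let cFe k : cont_on 0 T (fun t => ceven beta (f^~ t) k). Proof. exact: cont_on_ceven. Qed.
Let hiN t : 0 <= t <= T -> `|hi t| <= N. Proof. exact: supnorm_ge. Qed.
Let gG t : 0 <= t <= T -> `|g t| <= G. Proof. exact: supnorm_ge. Qed.

Let sumC (v s : nat -> R) (D : R) n : 0 <= D -> (forall k, (0 < k)%N -> `|v k| <= 16 / 15 * s k) ->
  l2n (fun k => lam R k ^+ 3 * s k) n <= D ->
  \sum_(1 <= k < n.+1) (lam R k ^+ 3 * v k) ^+ 2 <= (16 / 15 * D) ^+ 2.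
Proof.
move=> D0 vs sD; have c0 : (0 : R) <= 16 / 15 by lra.
rewrite -l2n_sqr lerXn2r ?nnegrE ?l2n_ge0//; first by apply: mulr_ge0.
apply: le_trans (l2n_scale n c0 vs) _; exact: ler_wpM2l.
Qed.

Let ball (v s : nat -> R -> R) (s' : nat -> R) (D : R) : 0 <= D ->
  (forall k, (0 < k)%N -> v k = s k) ->
  (forall k t, (0 < k)%N -> 0 <= t <= T -> `|s k t| <= 16 / 15 * s' k) ->
  (forall n, l2n (fun k => lam R k ^+ 3 * s' k) n <= D) ->
  (sqrte (\sum_(1 <= k <oo) ((lam R k ^+ 3 * supnorm T (v k)) ^+ 2)%:E) <= (16 / 15 * D)%:E)%E.
Proof.
have c0 : (0 : R) <= 16 / 15 by lra.
move=> D0 vE sB sD; apply: sqrte_series_le; first exact: mulr_ge0.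
move=> n; apply: (@le_trans _ _ (16 / 15 * l2n (fun k => lam R k ^+ 3 * s' k) n)).
  apply: l2n_scale => // k k0; rewrite ger0_norm ?supnorm_ge0// vE//.
  by apply: supnorm_le => // t tT; exact: sB.
exact: ler_wpM2l.
Qed.

Let const_ucvg (v v1 : R -> R) : deriv_on 0 1 v v1 -> cont_on 0 1 v1 -> v 0 = beta * v 1 ->
  itg 0 1 v = 0 -> forall x : R, 0 <= x <= 1 -> forall e : R, 0 < e ->
  exists n0, forall n, (n0 <= n)%N -> `|Xsum beta (codd v) (ceven beta v) n x - v x| <= e.
Proof.
move=> dv cv1 vbc v0 x x01 e e0.
have [n0 H] := @expansion_ucvg R T beta T_gt0 beta_neqN1 (fun x _ => v x) (fun x _ => v1 x)
  (cont_on_DT_x (deriv_on_cont dv)) (fun t _ => dv) (cont_on_DT_x cv1) (fun t _ => vbc)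
  (fun t _ => v0) e e0.
by exists n0 => n Nn; apply: (H n Nn x 0 x01); rewrite lexx ltW.
Qed.

Lemma existence_uniqueness : exists u a,
  [/\ classical_solution T beta delta1 delta2 phi psi f h u a, in_ball T beta r u a &
      forall v b, classical_solution T beta delta1 delta2 phi psi f h v b ->
        in_ball T beta r v b ->
        (forall x t, 0 <= x <= 1 -> 0 <= t <= T -> v x t = u x t) /\
        (forall t, 0 <= t <= T -> b t = a t)].
Proof.
have [a [y [S [ca aB Hy HS aE]]]] := odd_system_exists T_gt0 delta1_ge0 delta2_ge0 delta12
  (F := fun k t => codd (f^~ t) k) cFo chi cg hiN gG s1Q r2 MTr Qr NSMT Nr.
have ga : good_potential T r a.
  by split => // t tT; apply: le_trans (aB t tT) Nr.

have yB k t : (0 < k)%N -> 0 <= t <= T -> `|y k t| <= 16 / 15 * s1 k.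
  move=> k0 tT; have [//] := odd_mode_bound T_gt0 delta1_ge0 delta2_ge0 delta12
    (F := fun k t => codd (f^~ t) k) cFo r2 MTr ga k0 (Hy k k0) tT.
have exy1 k : exists y1, (0 < k)%N -> mode_eq T (lam R k) delta1 delta2
    (fun t => a t * y k t + codd (f^~ t) k) (codd phi k) (codd psi k) (y k) y1.
  case: k => [|k]; first by exists (fun=> 0).
  by have [y1 H] := Hy k.+1 isT; exists y1.
have [y1 my] := choice exy1.
have cy k : (0 < k)%N -> cont_on 0 T (y k) by move=> /my[/deriv_on_cont].
have exz k : exists zz : (R -> R) * (R -> R), (0 < k)%N -> mode_eq T (lam R k) delta1 delta2
    (fun t => a t * zz.1 t + (ceven beta (f^~ t) k - 2 * pc beta * lam R k * y k t))
    (ceven beta phi k) (ceven beta psi k) zz.1 zz.2 /\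
    forall t, 0 <= t <= T -> `|zz.1 t| <= 16 / 15 * s3 k.
  case: k => [|k]; first by exists (fun=> 0, fun=> 0).
  have [z [z1 [H1 H2]]] := even_mode_exists (pc beta) (ceven beta phi k.+1) (ceven beta psi k.+1)
    T_gt0 delta1_ge0 delta2_ge0 delta12 ga MTr (ltn0Sn k) (@cFe k.+1) (cy k.+1 isT)
    (fun t tT => yB k.+1 t isT tT).
  by exists (z, z1).
have [zz Hz] := choice exz.
pose z k := (zz k).1; pose z1 k := (zz k).2.
have mz k (k0 : (0 < k)%N) := (Hz k k0).1.
have zB k t : (0 < k)%N -> 0 <= t <= T -> `|z k t| <= 16 / 15 * s3 k.
  by move=> k0; exact: (Hz k k0).2.
have cz k : (0 < k)%N -> cont_on 0 T (z k) by move=> /mz[/deriv_on_cont].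
pose C := (16 / 15 * Q) ^+ 2 + (16 / 15 * E) ^+ 2.
have yC n t : 0 <= t <= T -> \sum_(1 <= k < n.+1) (lam R k ^+ 3 * y k t) ^+ 2 <= C.
  move=> tT; have := @sumC (y^~ t) s1 Q n Q_ge0 (fun k k0 => yB k t k0 tT) (s1Q n).
  by move=> /le_trans; apply; rewrite /C lerDl sqr_ge0.
have zC n t : 0 <= t <= T -> \sum_(1 <= k < n.+1) (lam R k ^+ 3 * z k t) ^+ 2 <= C.
  move=> tT; have := @sumC (z^~ t) s3 E n E_ge0 (fun k k0 => zB k t k0 tT) (s3E n).
  by move=> /le_trans; apply; rewrite /C lerDr sqr_ge0.
have fE := expansion_ucvg T_gt0 beta_neqN1 f_C f_dx fx_C f_bc f_int.
have hE t : 0 <= t <= T -> a t * h t = h2 t - f (1 / 2) t + 1 / 2 * S t.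
  move=> tT; have ht : h t != 0 by apply/eqP; exact: h_neq0.
  by rewrite aE// /hi mulrC mulVKf.
have [u [solu Hu]] := synthesis T_gt0 beta_neqN1 delta1_ge0 delta2_ge0 delta12 r2 MTr ca ga.2
  my mz yC zC f_C fE
  (const_ucvg phi_d1 (deriv_on_cont phi_d2) phi_bc phi_int)
  (const_ucvg psi_d1 psi_C1 psi_bc psi_int) h_d1 h_d2 h_phi h_psi HS hE.
exists u, a; split => //.
  split => //; pose c := interleave y z.
  have c0E : c 0%N = (fun=> 0) by [].
  have cyE k : (0 < k)%N -> c k.*2.-1 = y k by exact: interleave_odd.
  have czE k : (0 < k)%N -> c k.*2 = z k by exact: interleave_even.
  exists c; split.
    apply: (@B_expansionP R T beta c u C).
    - move=> k; rewrite /c /interleave; case: eqP => [_|/eqP k0]; first exact: cont_on_cst.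
      have uk : (0 < uphalf k)%N by case: (k) k0.
      by case: (odd k); [exact: cy|exact: cz].
    - move=> n t tT; apply: le_trans (yC n t tT); apply: le_trans (sum_lam_cube_le (y^~ t) n).
      rewrite le_eqVlt; apply/orP; left; apply/eqP.
      by apply: eq_big_nat => k /andP[k0 _]; rewrite cyE.
    - move=> e e0; have [n0 Hn0] := Hu e e0; exists n0 => n Nn x t x01 tT.
      rewrite c0E mul0r add0r (@eq_Xsum _ _ _ _ (y^~ t) (z^~ t)); first exact: Hn0.
        by move=> k k0; rewrite cyE.
      by move=> k k0; rewrite czE.
  have ho := ball (v := fun k => c k.*2.-1) Q_ge0 cyE yB s1Q.
  have he := ball (v := fun k => c k.*2) E_ge0 czE zB s3E.
  have h0 : supnorm T (c 0%N) <= 0.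
    by apply: supnorm_le => // t tT; rewrite c0E normr0.
  have ha : supnorm T a <= a4 + 2 / 15 by rewrite a4E; exact: supnorm_le.
  rewrite /B_norm; apply: (@le_trans _ _
    (0%:E + (16 / 15 * Q)%:E + (16 / 15 * E)%:E + (a4 + 2 / 15)%:E)%E).
    by apply: leeD; [apply: leeD => //; apply: leeD => //|]; rewrite lee_fin.
  by rewrite -!EFinD lee_fin add0r.
move=> v b solv ballv.
have [yv [zv [Sv [gb Hv mv HSv hEv]]]] :=
  solution_modes T_gt0 beta_neqN1 f_C f_int h_d1 h_d2 phi_C psi_C solv ballv.
(* Any solution in the ball supplies a second solution of the closed system, so a is settled before
   the even modes; these then share potential, source and data. *)
have ab t : 0 <= t <= T -> b t = a t.
  apply: (odd_system_unique T_gt0 delta1_ge0 delta2_ge0 delta12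
    (F := fun k t => codd (f^~ t) k) (g := g)
    cFo hiN s1Q r2 MTr Qr NSMT gb ga (fun k k0 => (mv k k0).1) Hy HSv HS) => // s sT.
  have hs : h s != 0 by apply/eqP; exact: h_neq0.
  by rewrite /hi /g -hEv// mulrC mulfK.
split => // x t x01 tT.
have yvE k s : (0 < k)%N -> 0 <= s <= T -> yv k s = y k s.
  move=> k0 sT; have [[y1' H] _] := mv k k0.
  have H' : mode_eq T (lam R k) delta1 delta2 (fun t => a t * yv k t + codd (f^~ t) k)
      (codd phi k) (codd psi k) (yv k) y1'.
    by apply: eq_mode_eq H => t' t'T; rewrite ab.
  exact: (potential_mode_unique T_gt0 delta1_ge0 delta2_ge0 delta12 ga.2 MTr k0 H' (my k k0) sT).
have zvE k s : (0 < k)%N -> 0 <= s <= T -> zv k s = z k s.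
  move=> k0 sT; have [_ [z1' H]] := mv k k0.
  have H' : mode_eq T (lam R k) delta1 delta2
      (fun t => a t * zv k t + (ceven beta (f^~ t) k - 2 * pc beta * lam R k * y k t))
      (ceven beta phi k) (ceven beta psi k) (zv k) z1'.
    by apply: eq_mode_eq H => t' t'T; rewrite ab// yvE.
  exact: (potential_mode_unique (F := fun t => ceven beta (f^~ t) k - 2 * pc beta * lam R k * y k t)
    T_gt0 delta1_ge0 delta2_ge0 delta12 ga.2 MTr k0 H' (mz k k0) sT).
apply: (@lim_uniq R (fun n => Xsum beta (y^~ t) (z^~ t) n x)) => e e0.
  have [n0 H] := Hv e e0; exists n0 => n Nn; have := H n Nn x t x01 tT.
  rewrite (@eq_Xsum _ _ _ _ (y^~ t) (z^~ t))// => k k0; [exact: yvE|exact: zvE].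
by have [n0 H] := Hu e e0; exists n0 => n Nn; exact: H.
Qed.

End Main.

Theorem theorem3 (R : realType) (T beta delta1 delta2 : R)
  (phi phi1 phi2 phi3 psi psi1 psi2 : R -> R)
  (f fx fxx : R -> R -> R) (h h1 h2 : R -> R)
  (T_gt0 : 0 < T) (beta_neq1 : beta <> 1) (beta_neqN1 : beta <> -1)
  (delta1_ge0 : 0 <= delta1) (delta2_ge0 : 0 <= delta2)
  (delta12 : delta1 + delta2 < 1 + delta1 * delta2)
  (phi_d1 : deriv_on 0 1 phi phi1) (phi_d2 : deriv_on 0 1 phi1 phi2)
  (phi_C2 : cont_on 0 1 phi2) (phi_d3 : L2_deriv phi2 phi3)
  (phi_bc : phi 0 = beta * phi 1) (phi1_bc : phi1 0 = phi1 1)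
  (phi2_bc : phi2 0 = beta * phi2 1)
  (psi_d1 : deriv_on 0 1 psi psi1)
  (psi_C1 : cont_on 0 1 psi1) (psi_d2 : L2_deriv psi1 psi2)
  (psi_bc : psi 0 = beta * psi 1) (psi1_bc : psi1 0 = psi1 1)
  (f_C : cont_DT T f) (f_dx : deriv_x T f fx) (fx_C : cont_DT T fx)
  (f_dxx : L2_deriv_x T fx fxx)
  (f_bc : forall t, 0 <= t <= T -> f 0 t = beta * f 1 t)
  (fx_bc : forall t, 0 <= t <= T -> fx 0 t = fx 1 t)
  (h_d1 : deriv_on 0 T h h1) (h_d2 : deriv_on 0 T h1 h2)
  (h_C2 : cont_on 0 T h2)
  (h_neq0 : forall t, 0 <= t <= T -> h t <> 0)
  (f_int : forall t, 0 <= t <= T ->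
     (\int[lebesgue_measure]_(x in `[0, 1]) f x t)%R = 0)
  (phi_int : (\int[lebesgue_measure]_(x in `[0, 1]) phi x)%R = 0)
  (psi_int : (\int[lebesgue_measure]_(x in `[0, 1]) psi x)%R = 0)
  (h_phi : h 0 + delta1 * h T = phi (1 / 2))
  (h_psi : h1 0 + delta2 * h1 T = psi (1 / 2)) :
  let A := AT T beta delta1 delta2 phi phi2 phi3 psi psi1 psi2 f fx fxx h h2 in
  let B := BT T delta1 delta2 h in
  B * (A + 2) ^+ 2 < 1 ->
  (1 + 2 * delta1 + 3 * delta2 + delta1 * delta2) * T ^+ 2 * (A + 2)
    / (2 * (1 + delta1) * (1 + delta2)) < 1 ->
  let r := A + 2 in
  exists u a,
    [/\ classical_solution T beta delta1 delta2 phi psi f h u a,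
        in_ball T beta r u a &
        forall v b,
          classical_solution T beta delta1 delta2 phi psi f h v b ->
          in_ball T beta r v b ->
          (forall x t, 0 <= x <= 1 -> 0 <= t <= T -> v x t = u x t) /\
          (forall t, 0 <= t <= T -> b t = a t)].
Proof.
move=> A B HB _ r.
exact: (existence_uniqueness T_gt0 beta_neqN1 delta1_ge0 delta2_ge0 delta12
  phi_d1 phi_d2 phi_C2 phi_d3 phi_bc phi1_bc phi2_bc
  psi_d1 psi_C1 psi_d2 psi_bc psi1_bc f_C f_dx fx_C f_dxx f_bc fx_bc
  h_d1 h_d2 h_C2 h_neq0 f_int phi_int psi_int h_phi h_psi HB).
Qed.
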